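(* Let $X:\Omega\to E$ be a Gaussian random variable and $(e_j')_{j\in\mathbb{N}}\subset E'$ a sequence of functionals for which there exists a positive, monotone decreasing sequence $(c_j)\in\ell^1(\mathbb{N})$ such that $$\Vert \mathrm{cov}(X)-\mathrm{cov}(X^{(n)})\Vert_{E'\to E}\le c_n\qquad\text{for all } n\in\mathbb{N}.$$ Assume further that $(c_{j-1}-c_j)_{j\ge2}$ is monotone decreasing, that $\sum_{j\ge2}\sqrt{c_{j-1}-c_j}<\infty$, and that $c_j/\sqrt{c_{j-1}-c_j}\to0$ as $j\to\infty$. Then, for all $n\in\mathbb{N}$ and $\tau>0$, we have $$\mu\left(\Vert X-X^{(n)}\Vert_E\le\sqrt{5\max\{1,\tau\}}\sum_{j=n+1}^\infty\sqrt{c_{j-1}-c_j}\right)>1-\mathrm{e}^{-\tau}.$$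
   Context: $(\Omega,\mathcal{A},\mu)$ is a probability space, $E$ is a separable real Banach space, $E'$ its dual, and $\mathbb{N}=\{1,2,\dots\}$. A real random variable is Gaussian if its characteristic function is $t\mapsto \mathrm{e}^{it m-\sigma^2t^2/2}$ for some $m,\sigma\in\mathbb{R}$ ($\sigma=0$, a Dirac measure, is allowed). A random variable $X:\Omega\to E$ is Gaussian if $e'(X)$ is a real Gaussian random variable for every $e'\in E'$; such an $X$ belongs to the Bochner space $L^p(\mu,E)$ for all $1\le p<\infty$, and $\mathbb{E}X$ denotes its Bochner expectation. The covariance operator $\mathrm{cov}(X):E'\to E$ is $$\mathrm{cov}(X)(e')=\int_\Omega e'(X-\mathbb{E}X)\,(X-\mathbb{E}X)\,\mathrm{d}\mu .$$ For a sequence $(e_j')\subset E'$, $$X^{(n)}:=\mathbb{E}\bigl(X\,\big|\,\sigma(e_1'(X),\dots,e_n'(X))\bigr)$$ is the ($E$-valued, Bochner) conditional expectation; it is again an $E$-valued Gaussian random variable. $\Vert\cdot\Vert_{E'\to E}$ is the operator norm. Monotone decreasing is meant in the non-strict sense. *)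

(* Defs.v *)
From HB Require Import structures.
From mathcomp Require Import all_boot all_order all_algebra.
From mathcomp Require Import complex.
From mathcomp Require Import all_classical all_reals all_analysis.

Set Implicit Arguments.
Unset Strict Implicit.
Unset Printing Implicit Defensive.

Import Order.TTheory GRing.Theory Num.Theory.
Import numFieldNormedType.Exports.

Local Open Scope classical_set_scope.
Local Open Scope ring_scope.

Record dual (R : realType) (E : normedModType R) := Dual {
  dual_fun :> {linear E -> R^o};
  dual_continuous : continuous dual_fun
}.

Definition separable (E : topologicalType) : Prop :=
  exists2 D : set E, countable D & dense D.

Definition dual_norm (R : realType) (E : normedModType R) (f : dual E) : \bar R :=
  ereal_sup [set (`|f x|)%:E | x in [set x : E | `|x| <= 1]].

Definition dual_opnorm (R : realType) (E : normedModType R) (L : dual E -> E) :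
    \bar R :=
  ereal_sup [set (`|L f|)%:E | f in [set f : dual E | (dual_norm f <= 1)%E]].

Definition borel_measurable (T : Type) (E : topologicalType) (G : set_system T)
    (f : T -> E) : Prop :=
  forall B : set E, <<s open >> B -> G (f @^-1` B).

Definition simple_fun (d : measure_display) (T : measurableType d) (E : Type)
    (s : T -> E) : Prop :=
  finite_set (range s) /\ forall v : E, measurable (s @^-1` [set v]).

Definition simple_integral (d : measure_display) (T : measurableType d)
    (R : realType) (P : probability T R) (E : normedModType R) (s : T -> E) : E :=
  \sum_(v \in range s) fine (P (s @^-1` [set v])) *: v.

(* Almost everywhere convergence of the simple functions s k to f is the strong
   measurability of f. *)
Definition bochner_approx (d : measure_display) (T : measurableType d)
    (R : realType) (P : probability T R) (E : normedModType R) (f : T -> E)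
    (s : nat -> T -> E) : Prop :=
  [/\ forall k, simple_fun (s k),
      {ae P, forall w, s k w @[k --> \oo] --> f w}
    & (\int[P]_w (`|f w - s k w|)%:E)%E @[k --> \oo] --> 0%E].

Definition bochner_integrable (d : measure_display) (T : measurableType d)
    (R : realType) (P : probability T R) (E : normedModType R) (f : T -> E) :
    Prop :=
  exists s, bochner_approx P f s.

(* The limit does not depend on the approximating sequence and, when E is
   complete, the default value 0 is only taken when f is not Bochner
   integrable. *)
Definition bochner_integral (d : measure_display) (T : measurableType d)
    (R : realType) (P : probability T R) (E : normedModType R) (f : T -> E) : E :=
  xget 0 [set v : E | exists2 s, bochner_approx P f s &
                                 simple_integral P (s k) @[k --> \oo] --> v].

(* exp (a + i b), since the library has no complex exponential. *)
Definition cexp (R : realType) (z : R[i]) : R[i] :=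
  let: (a +i* b)%C := z in ((expR a * cos b) +i* (expR a * sin b))%C.

(* The complex expectation of exp (i t Z), taken on real and imaginary parts. *)
Definition char_fun (d : measure_display) (T : measurableType d)
    (R : realType) (P : probability T R) (Z : T -> R) (t : R) : R[i] :=
  ((\int[P]_w cos (t * Z w)) +i* (\int[P]_w sin (t * Z w)))%C.

Definition real_gaussian (d : measure_display) (T : measurableType d)
    (R : realType) (P : probability T R) (Z : T -> R) : Prop :=
  measurable_fun [set: T] Z /\
  exists m sigma : R, forall t : R,
    char_fun P Z t = cexp ((- (sigma ^+ 2 * t ^+ 2 / 2)) +i* (t * m))%C.

Definition gaussian (d : measure_display) (T : measurableType d)
    (R : realType) (P : probability T R) (E : normedModType R) (X : T -> E) :
    Prop :=
  borel_measurable measurable X /\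
  forall f : dual E, real_gaussian P (fun w => f (X w)).

Definition cov (d : measure_display) (T : measurableType d)
    (R : realType) (P : probability T R) (E : normedModType R) (X : T -> E)
    (f : dual E) : E :=
  let Xc := fun w => X w - bochner_integral P X in
  bochner_integral P (fun w => f (Xc w) *: Xc w).

(* Y is a version of E(X | G); the integrals over A are those of the functions
   restricted to A by its indicator. *)
Definition is_cond_exp (d : measure_display) (T : measurableType d)
    (R : realType) (P : probability T R) (E : normedModType R)
    (G : set_system T) (X Y : T -> E) : Prop :=
  [/\ borel_measurable G Y,
      bochner_integrable P Y
    & forall A, G A ->
        bochner_integral P (fun w => \1_A w *: Y w) =
        bochner_integral P (fun w => \1_A w *: X w)].

(* sigma(e_1(X), ..., e_n(X)); functionals are numbered from 1, so e 0 is
   never used. *)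
Definition sigma_first (d : measure_display) (T : measurableType d)
    (R : realType) (E : normedModType R) (e : nat -> dual E) (X : T -> E)
    (n : nat) : set_system T :=
  <<s \bigcup_(j in [set j | (1 <= j <= n)%N])
        preimage_set_system [set: T] (fun w => e j (X w) : R) measurable >>.

(* Main.v *)
Require Import Defs.
From HB Require Import structures.
From mathcomp Require Import all_boot all_order all_algebra.
From mathcomp Require Import complex finmap.
From mathcomp Require Import all_classical all_reals all_analysis.
From mathcomp Require Import measurable_realfun.
From mathcomp Require Import lra ring.

Set Implicit Arguments.
Unset Strict Implicit.
Unset Printing Implicit Defensive.

Import Order.TTheory GRing.Theory Num.Theory.
Import numFieldNormedType.Exports.

Local Open Scope classical_set_scope.
Local Open Scope ring_scope.

(* Hahn-Banach and separability give functionals f_j with |y| = sup_j f_j(y).  Let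
   xi_1, xi_2, ... be the Gram-Schmidt orthonormalisation of the centred e_j(X).  As
   uncorrelated jointly Gaussian variables are independent,
     f(X^(n)) = E f(X) + sum_(k <= n) t_k xi_k,   t_k = Cov(f(X), xi_k),
   and the covariance hypothesis says that sum_(k > n) t_k^2 <= c_n for every n and every f of
   norm at most 1.  With s_k = sqrt (c_(k-1) - c_k), Cauchy-Schwarz yields
     f(X - X^(n))^2 <= (sum_(k > n) t_k^2 / s_k) (sum_(k > n) s_k xi_k^2),
   and summation by parts bounds the first factor by S = sum_(k > n) s_k, because 1/s_k is
   increasing and c_k / s_k -> 0.  Hence |X - X^(n)|^2 <= S sum_(k > n) s_k xi_k^2, and Markov's
   inequality for exp (2/5 sum_k (s_k / S) xi_k^2), whose expectation is at most
   E exp (2/5 xi^2) <= 13/5 < e by Jensen, gives the claim.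

   That covariances are Bochner integrals of integrable functions requires E |X|^2 < oo
   (Fernique's theorem). *)

(** * A norming sequence of functionals *)

(** Gaussianity is given through characteristic functions alone, and this shapes the probabilistic
    part: moments are read off from Taylor remainders of cos, and laws are compared by turning
    trigonometric test functions into indicators of half-lines. Norms fit in because |y| <= s is a
    countable intersection of half-lines f_j(y) <= s. Fernique's argument is run for X(w) - X(w') on
    the product space, since centring X would presuppose the expectation whose existence is at
    stake. The sums in the Cauchy-Schwarz step are finite, so f(X) has to be reached from f(X^(N)):
    the mean square of the difference is at most c_N, and summability of c yields almost sure
    convergence. The remainder of the summation by parts vanishes in the same limit. The constant 5
    is tied to the exponent 2/5: for a standard normal xi, E exp (l xi^2) = (1 - 2 l)^(-1/2), which
    is sqrt 5 < e at l = 2/5. At level 5 M with M = max(1, tau), Markov's bound is 13/5 e^(-2 M);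
    one factor e^(-M) absorbs 13/5, strictly, and the other is at most e^(-tau). *)

Section HahnBanach.
Context {R : realType} {E : normedModType R}.

Lemma dual_of_bounded_linear (f : E -> R) (C : R) :
  (forall a x y, f (a *: x + y) = a * f x + f y) ->
  (forall x, `|f x| <= C * `|x|) -> exists g : dual E, forall x, g x = f x.
Proof.
move=> flin fC.
pose f' : E -> R^o := f.
have f'lin : linear f' by move=> a x y; rewrite /f' flin.
pose g : {linear E -> R^o} :=
  HB.pack_for {linear E -> R^o} f' (GRing.isLinear.Build R E R^o *:%R f' f'lin).
have gc : continuous g.
  apply: bounded_linear_continuous.
  apply/linear_boundedP; near=> r => x.
  apply: (le_trans (fC x)); apply: ler_wpM2r => //.
by exists (Dual gc).
Unshelve. all: by end_near. Qed.

(** Only one inequality of positive homogeneity is asked; rescaling gives the other. Domination by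
    the norm is built in so that a linear member is automatically continuous. *)
Definition sublinear (q : E -> R) :=
  [/\ forall x y, q (x + y) <= q x + q y,
      forall a x, 0 <= a -> q (a *: x) <= a * q x
    & forall x, q x <= `|x|].

Lemma sublinear0 q : sublinear q -> q 0 = 0.
Proof.
move=> [qD qZ _]; apply/eqP; rewrite eq_le; apply/andP; split.
  by have := qZ 0 0 (lexx _); rewrite scale0r mul0r.
by have := qD 0 0; rewrite addr0; lra.
Qed.

Lemma sublinearZ q a x : sublinear q -> 0 <= a -> q (a *: x) = a * q x.
Proof.
move=> sq; have [qD qZ _] := sq; rewrite le_eqVlt => /predU1P[<-|a0].
  by rewrite scale0r mul0r sublinear0.
apply/eqP; rewrite eq_le (qZ _ _ (ltW a0))/=.
have : 0 <= a^-1 by rewrite invr_ge0 ltW.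
move=> /(qZ _ (a *: x)); rewrite scalerA mulVf ?gt_eqF// scale1r.
by rewrite ler_pdivlMl.
Qed.

(* The witness is the infimum over t >= 0 of q (x + t y) - t q y. *)
Lemma sublinear_tilt q y : sublinear q -> exists2 q', sublinear q' &
  (forall x, q' x <= q x) /\ (forall x, q' x <= q (x + y) - q y).
Proof.
move=> sq; have [qD qZ qN] := sq.
pose A x := [set q (x + t *: y) - t * q y | t in [set t : R | 0 <= t]].
have lbA x : lbound (A x) (- q (- x)).
  move=> _ [t /= t0 <-]; rewrite -(sublinearZ _ sq t0).
  have := qD (x + t *: y) (- x); rewrite addrAC subrr add0r; lra.
have infA x : has_inf (A x).
  split; last by exists (- q (- x)).
  by exists (q (x + 0 *: y) - 0 * q y); exists 0 => /=.
have infle t x : 0 <= t -> inf (A x) <= q (x + t *: y) - t * q y.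
  by move=> t0; apply: ge_inf; [exact: (infA x).2 | exists t].
exists (fun x => inf (A x)); last split; last 2 first.
- by move=> x; have := infle 0 x (lexx _); rewrite scale0r mul0r addr0 subr0.
- by move=> x; have := infle 1 x ler01; rewrite scale1r mul1r.
split.
- move=> x1 x2; rewrite -lerBlDr; apply: lb_le_inf; first exact: (infA x1).1.
  move=> _ [t1 /= t10 <-]; rewrite lerBlDr -lerBlDl.
  apply: lb_le_inf; first exact: (infA x2).1.
  move=> _ [t2 /= t20 <-]; rewrite lerBlDl.
  apply: le_trans (infle (t1 + t2) _ (addr_ge0 t10 t20)) _.
  have := qD (x1 + t1 *: y) (x2 + t2 *: y).
  by rewrite addrACA -scalerDl; lra.
- move=> a x; rewrite le_eqVlt => /predU1P[<-|a0].
    rewrite mul0r scale0r; apply: le_trans (infle 0 _ (lexx _)) _.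
    by rewrite scale0r mul0r addr0 sublinear0 ?subrr.
  rewrite -ler_pdivrMl//; apply: lb_le_inf; first exact: (infA x).1.
  move=> _ [t /= t0 <-]; rewrite ler_pdivrMl//.
  apply: le_trans (infle (a * t) _ (mulr_ge0 (ltW a0) t0)) _.
  rewrite -scalerA -scalerDr (sublinearZ _ sq (ltW a0)); lra.
- move=> x; apply: le_trans (qN x).
  by have := infle 0 x (lexx _); rewrite scale0r mul0r addr0 subr0.
Qed.

(** Zorn's lemma for the reversed pointwise order. A chain is bounded by its pointwise infimum,
    which is finite because every member is at least -|x| at x; it is subadditive because the
    smaller of two members of the chain can be used at both arguments. *)
Lemma sublinear_minimal q0 : sublinear q0 -> exists2 q, sublinear q &
  (forall x, q x <= q0 x) /\
  forall q', sublinear q' -> (forall x, q' x <= q x) -> forall x, q x <= q' x.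
Proof.
move=> sq0.
pose Q q := sublinear q /\ forall x, q x <= q0 x.
pose T := {q : E -> R | Q q}.
pose rT : rel T := fun q1 q2 => `[< forall x, sval q2 x <= sval q1 x >].
have t0 : T by exists q0; split.
have [| | |[q [sq qq0]] qmin] := @ZL_preorder T t0 rT.
- by move=> t; apply/asboolP.
- move=> r s t /asboolP rs /asboolP st; apply/asboolP => x.
  exact: le_trans (st x) (rs x).
- move=> A Atot; have [[a0 Aa0]|noA] := pselect (exists a, A a); last first.
    by exists t0 => s As; case: noA; exists s.
  pose B x := [set sval a x | a in A].
  have infB x : has_inf (B x).
    split; first by exists (sval a0 x); exists a0.
    exists (- `|x|) => _ [[a [sa _]] _ <-] /=; have [aD _ aN] := sa.
    have := aD x (- x); rewrite subrr (sublinear0 sa).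
    by have := aN (- x); rewrite normrN; lra.
  have infle a x : A a -> inf (B x) <= sval a x.
    by move=> Aa; apply: ge_inf; [exact: (infB x).2|exists a].
  have sB : sublinear (fun x => inf (B x)) /\ forall x, inf (B x) <= q0 x.
    split; last first.
      by move=> x; apply: le_trans (infle _ _ Aa0) _; have [_] := svalP a0; exact.
    split.
    - move=> x y; rewrite -lerBlDr; apply: lb_le_inf; first exact: (infB x).1.
      move=> _ [a1 /= Aa1 <-]; rewrite lerBlDr -lerBlDl.
      apply: lb_le_inf; first exact: (infB y).1.
      move=> _ [a2 /= Aa2 <-]; rewrite lerBlDl.
      have [[D1 _ _] _] := svalP a1; have [[D2 _ _] _] := svalP a2.
      case: (Atot _ _ Aa1 Aa2) => /asboolP a12.
        apply: le_trans (infle _ _ Aa2) (le_trans (D2 x y) _).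
        by rewrite lerD2r.
      apply: le_trans (infle _ _ Aa1) (le_trans (D1 x y) _).
      by rewrite lerD2l.
    - move=> a x; rewrite le_eqVlt => /predU1P[<-|a_gt0].
        rewrite mul0r scale0r; apply: le_trans (infle _ _ Aa0) _.
        by have [sa _] := svalP a0; rewrite (sublinear0 sa).
      rewrite -ler_pdivrMl//; apply: lb_le_inf; first exact: (infB x).1.
      move=> _ [a1 /= Aa1 <-]; rewrite ler_pdivrMl//.
      apply: le_trans (infle _ _ Aa1) _.
      by have [[_ Z1 _] _] := svalP a1; apply: Z1; exact: ltW.
    - move=> x; apply: le_trans (infle _ _ Aa0) _.
      by have [[_ _ ]] := svalP a0.
  exists (exist Q _ sB) => s As; apply/asboolP => x /=; exact: infle.
- exists q => //; split => // q' sq' q'q x.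
  have h : Q q' by split=> // z; apply: le_trans (q'q z) (qq0 z).
  have /asboolP := qmin (exist Q _ h) (asboolT q'q); exact.
Qed.

(** A minimal sublinear q is linear: tilting it at y cannot decrease it, so q x <= q (x + y) - q y,
    the converse of subadditivity. Tilting the norm at x0 before minimising forces q (- x0) <= -
    |x0|, hence the value at x0. *)
Lemma hahn_banach_norming (x0 : E) : exists g : dual E,
  (forall x, `|g x| <= `|x|) /\ g x0 = `|x0|.
Proof.
have snorm : sublinear (fun x : E => `|x|).
  split => [x y|a x a0|//]; first exact: ler_normD.
  by rewrite normrZ ger0_norm.
have [q1 sq1 [_ q1x0]] := sublinear_tilt x0 snorm.
have [q sq [qq1 qmin]] := sublinear_minimal sq1.
have [qD qZ qN] := sq.
have add x y : q (x + y) = q x + q y.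
  apply/eqP; rewrite eq_le qD/=.
  have [q' sq' [q'q q'y]] := sublinear_tilt y sq.
  by rewrite -lerBrDr; apply: le_trans (q'y x); exact: qmin.
have opp x : q (- x) = - q x.
  by have := add x (- x); rewrite subrr (sublinear0 sq); lra.
have scale a x : q (a *: x) = a * q x.
  have [a0|a0] := leP 0 a; first exact: sublinearZ.
  by rewrite -[a]opprK scaleNr opp (sublinearZ _ sq) ?mulNr// oppr_ge0 ltW.
have qle x : `|q x| <= `|x|.
  by rewrite ler_norml qN andbT lerNl -opp -[leRHS]normrN.
have [||g gq] := @dual_of_bounded_linear q 1.
- by move=> a x y; rewrite add scale.
- by move=> x; rewrite mul1r.
exists g; split => [x|]; rewrite gq//.
apply/eqP; rewrite eq_le qN/= -lerN2 -opp.
have := q1x0 (- x0); rewrite addNr normr0 sub0r; exact: le_trans.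
Qed.

Lemma separable_dense_seq : separable E ->
  exists u : nat -> E, forall x (e : R), 0 < e -> exists k, `|x - u k| < e.
Proof.
move=> [D cD dD].
have D0 : D !=set0.
  by have [z []] := dD setT (ex_intro _ 0 I) openT; exists z.
have [u uD] : exists u : nat -> E, D `<=` range u.
  move: cD => /pfcard_geP[D00|[g]].
    by move: D0; rewrite D00 => -[].
  by exists g => y /(@surj _ _ _ _ g)[k _ <-]; exists k.
exists u => x e e0.
have [|z [zB Dz]] := dD (ball x e) _ (@ball_open _ _ x _).
  by exists x; apply: ballxx.
have [k _ kz] := uD _ Dz; exists k.
by move: zB; rewrite -ball_normE /ball_ /= -kz.
Qed.
(** Norming functionals of the points of a dense sequence suffice: when x moves to a nearby point,
    the norm and a functional of norm at most one both change by at most the distance. *)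
Lemma separable_norming : separable E -> exists f : nat -> dual E,
  (forall k x, `|f k x| <= `|x|) /\
  forall x a, (forall k, f k x <= a) -> `|x| <= a.
Proof.
move=> /separable_dense_seq[u uP].
have /choice[h hP] := hahn_banach_norming.
exists (h \o u); split=> [k x|x a hx] /=; first exact: (hP _).1.
apply/ler_addgt0Pr => e e0.
have e20 : 0 < e / 2 by lra.
have [k xu] := uP x (e / 2) e20.
have := hx k; have [hle huu] := hP (u k); rewrite /comp.
have := hle (x - u k); rewrite linearB huu ler_norml => /andP[].
have := ler_normD (x - u k) (u k); rewrite subrK.
lra.
Qed.

End HahnBanach.

(** * Expectations of real random variables *)

Section RealExpectation.
Context d {T : measurableType d} {R : realType} (P : probability T R).
Implicit Types U V W : T -> R.

Definition L1 U := P.-integrable [set: T] (EFin \o U).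

Definition Ex U : R := \int[P]_w U w.

Lemma L1_measurable U : L1 U -> measurable_fun [set: T] U.
Proof. by case/integrableP => /measurable_EFinP. Qed.

Lemma L1_intro U : measurable_fun [set: T] U ->
  (\int[P]_w (`|U w|)%:E < +oo)%E -> L1 U.
Proof.
move=> mU iU; apply/integrableP; split; first exact/measurable_EFinP.
exact: iU.
Qed.

Lemma ExE U : L1 U -> ((Ex U)%:E = \int[P]_w (U w)%:E)%E.
Proof. by move=> iU; rewrite fineK//; exact: integrable_fin_num. Qed.

Lemma L1_le U V : measurable_fun [set: T] U -> L1 V ->
  (forall w, `|U w| <= V w) -> L1 U.
Proof.
move=> mU iV UV; apply: le_integrable iV => //; first exact/measurable_EFinP.
by move=> w _ /=; rewrite lee_fin; apply: le_trans (UV w) (ler_norm _).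
Qed.

Lemma L1_cst (r : R) : L1 (fun=> r).
Proof. exact: finite_measure_integrable_cst. Qed.

Lemma L1_bounded U C : measurable_fun [set: T] U -> (forall w, `|U w| <= C) ->
  L1 U.
Proof. by move=> mU UC; apply: L1_le UC => //; exact: L1_cst. Qed.

Lemma L1D U V : L1 U -> L1 V -> L1 (fun w => U w + V w).
Proof. by move=> iU iV; exact: (integrableD measurableT iU iV). Qed.

Lemma L1Z (k : R) U : L1 U -> L1 (fun w => k * U w).
Proof. by move=> iU; exact: (integrableZl measurableT k iU). Qed.

Lemma L1N U : L1 U -> L1 (fun w => - U w).
Proof. by move=> iU; exact: (integrableN iU). Qed.

Lemma L1B U V : L1 U -> L1 V -> L1 (fun w => U w - V w).
Proof. by move=> iU iV; apply: L1D => //; exact: L1N. Qed.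

Lemma L1_norm U : L1 U -> L1 (fun w => `|U w|).
Proof. exact: integrable_norm. Qed.

Lemma L1_sum I (s : seq I) (Q : pred I) (F : I -> T -> R) :
  (forall i, Q i -> L1 (F i)) -> L1 (fun w => \sum_(i <- s | Q i) F i w).
Proof.
move=> iF; elim: s => [|i s IH].
  rewrite (_ : (fun w => _) = fun=> 0); first exact: L1_cst.
  by apply/funext => w; rewrite big_nil.
case Qi : (Q i); last first.
  rewrite (_ : (fun w => _) = fun w => \sum_(i <- s | Q i) F i w)//.
  by apply/funext => w; rewrite big_cons Qi.
rewrite (_ : (fun w => _) = fun w => F i w + \sum_(i <- s | Q i) F i w).
  by apply: L1D => //; exact: iF.
by apply/funext => w; rewrite big_cons Qi.
Qed.

Lemma L1M_bounded U V C : L1 U -> measurable_fun [set: T] V ->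
  (forall w, `|V w| <= C) -> L1 (fun w => U w * V w).
Proof.
move=> iU mV VC; apply: (@L1_le _ (fun w => C * `|U w|)).
- by apply: measurable_funM => //; exact: L1_measurable.
- by apply: L1Z; exact: L1_norm.
- by move=> w; rewrite normrM mulrC ler_wpM2r.
Qed.

Lemma ExD U V : L1 U -> L1 V -> Ex (fun w => U w + V w) = Ex U + Ex V.
Proof. by move=> iU iV; rewrite /Ex RintegralD. Qed.

Lemma ExB U V : L1 U -> L1 V -> Ex (fun w => U w - V w) = Ex U - Ex V.
Proof. by move=> iU iV; rewrite /Ex RintegralB. Qed.

Lemma ExZ (k : R) U : L1 U -> Ex (fun w => k * U w) = k * Ex U.
Proof. by move=> iU; rewrite /Ex RintegralZl. Qed.

Lemma Ex_cst (r : R) : Ex (fun=> r) = r.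
Proof.
rewrite /Ex Rintegral_cst//.
by have /= -> := @probability_setT _ T R P; rewrite mulr1.
Qed.

Lemma Ex_sum I (s : seq I) (Q : pred I) (F : I -> T -> R) :
  (forall i, Q i -> L1 (F i)) ->
  Ex (fun w => \sum_(i <- s | Q i) F i w) = \sum_(i <- s | Q i) Ex (F i).
Proof.
move=> iF; elim: s => [|i s IH].
  rewrite big_nil -[RHS]Ex_cst; congr Ex; apply/funext => w; exact: big_nil.
rewrite big_cons; case Qi : (Q i); last first.
  by rewrite -IH; congr Ex; apply/funext => w; rewrite big_cons Qi.
rewrite -IH -ExD; [|exact: iF|exact: L1_sum].
by congr Ex; apply/funext => w; rewrite big_cons Qi.
Qed.

Lemma Ex_le U V : L1 U -> L1 V -> (forall w, U w <= V w) -> Ex U <= Ex V.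
Proof. by move=> iU iV UV; apply: le_Rintegral. Qed.

Lemma Ex_ge0 U : (forall w, 0 <= U w) -> 0 <= Ex U.
Proof. by move=> U0; apply: Rintegral_ge0. Qed.

Lemma Ex_norm_le U V : L1 U -> L1 V -> (forall w, `|U w| <= V w) ->
  `|Ex U| <= Ex V.
Proof.
move=> iU iV UV; apply: le_trans (le_normr_Rintegral _ iU) _ => //.
by apply: Ex_le => //; exact: L1_norm.
Qed.

Lemma Ex_indic A : measurable A -> ((Ex \1_A)%:E = P A)%E.
Proof.
move=> mA; rewrite ExE; first by rewrite integral_indic// setIT.
exact: integrable_indic.
Qed.

Lemma L1_indic A : measurable A -> L1 \1_A.
Proof. exact: integrable_indic. Qed.

Lemma ae_eq_Ex U V : L1 U -> measurable_fun [set: T] V ->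
  {ae P, forall w, U w = V w} -> L1 V /\ Ex U = Ex V.
Proof.
move=> iU mV UV.
have UV' : ae_eq P [set: T] (EFin \o U) (EFin \o V).
  by apply: filterS UV => w /= -> _.
split.
  apply/integrableP; split; first exact/measurable_EFinP.
  have /integrableP[mU iUoo] := iU.
  rewrite (_ : (\int[P]_x `|(EFin \o V) x|)%E = (\int[P]_x `|(EFin \o U) x|)%E)//.
  apply: ae_eq_integral => //.
  - by apply: measurableT_comp => //; exact/measurable_EFinP.
  - by apply: measurableT_comp.
  - by apply: filterS UV => w /= -> _.
congr fine; apply: ae_eq_integral => //; first by case/integrableP : iU.
exact/measurable_EFinP.
Qed.

Lemma Ex_eq0_ae U : L1 U -> (forall w, 0 <= U w) -> Ex U = 0 ->
  {ae P, forall w, U w = 0}.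
Proof.
move=> iU U0 EU.
have /ae_eq_integral_abs : measurable_fun [set: T] (EFin \o U).
  by case/integrableP : iU.
move=> /(_ P measurableT)[h _].
have : ae_eq P [set: T] (EFin \o U) (cst 0%E).
  apply: h; rewrite -[RHS]/(0%:E) -EU ExE//; apply: eq_integral => w _ /=.
  by rewrite ger0_norm.
by apply: filterS => w /(_ I)[].
Qed.

Lemma Ex_dominated (u : nat -> T -> R) U V :
  (forall n, measurable_fun [set: T] (u n)) ->
  (forall w, u ^~ w @ \oo --> U w) -> L1 V ->
  (forall n w, `|u n w| <= V w) -> L1 U /\ Ex (u n) @[n --> \oo] --> Ex U.
Proof.
move=> mu uU iV uV.
have mU : measurable_fun [set: T] U.
  by apply: (measurable_fun_cvg mu) => w _; exact: uU.
have [|||||iU _ h] := @dominated_convergence _ _ _ P _ measurableT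
    (fun n => EFin \o u n) (EFin \o U) (EFin \o V).
- by move=> n; exact/measurable_EFinP.
- exact/measurable_EFinP.
- by apply/aeW => w _ /=; apply: cvg_EFin; [apply: nearW|exact: uU].
- exact: iV.
- by apply/aeW => w n _ /=; rewrite lee_fin.
split => //.
have iu n : L1 (u n) by exact: L1_le (uV n).
apply: (@fine_cvg _ _ _ _ _ (Ex U)).
by rewrite ExE.
Qed.

(** Integrability of the limit is part of the conclusion; this is how moments are obtained while no
    majorant is available yet. *)
Lemma Ex_fatou (u : nat -> T -> R) U (l : R) :
  (forall n, L1 (u n)) -> (forall n w, 0 <= u n w) ->
  (forall w, u ^~ w @ \oo --> U w) -> (forall n, Ex (u n) <= l) ->
  L1 U /\ Ex U <= l.
Proof.
move=> iu u0 uU ul.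
have mU : measurable_fun [set: T] U.
  apply: (measurable_fun_cvg (fun n => L1_measurable (iu n))) => w _; exact: uU.
have U0 w : 0 <= U w.
  by apply: (cvgr_to_ge (uU w)); apply: nearW.
have IU : (\int[P]_w (U w)%:E <= l%:E)%E.
  have -> : (\int[P]_w (U w)%:E = \int[P]_w limn_einf (fun n => (u n w)%:E))%E.
    apply: eq_integral => w _; apply/esym.
    have [//|-> //] := @cvg_limn_einf_sup _ (fun n => (u n w)%:E) (U w)%:E.
    by apply: cvg_EFin; [apply: nearW|exact: uU].
  apply: (le_trans (fatou _ _ _ _)) => //.
  - by move=> n; apply/measurable_EFinP; exact: L1_measurable.
  - by move=> n w _; rewrite lee_fin.
  rewrite limn_einf_lim; apply: lime_le; first exact: is_cvg_einfs.
  apply: nearW => n; apply: (@le_trans _ _ (\int[P]_w (u n w)%:E)%E).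
    by apply: ereal_inf_lbound; exists n => /=.
  by rewrite -ExE// lee_fin.
have iU : L1 U.
  apply: L1_intro => //; apply: le_lt_trans (ltry l).
  by under eq_integral do rewrite ger0_norm//.
by split => //; rewrite -lee_fin ExE.
Qed.

End RealExpectation.

(** * Moments of real Gaussian variables *)

Section TaylorRemainders.
Context {R : realType}.

(* The derivative of [cosrem n.+1] is [cosrem n], and [cosrem n.*2] is, up to
   sign, the remainder of the Taylor expansion of cos of order n. *)
Fixpoint cosrem (n : nat) (x : R) : R :=
  match n with
  | 0 => cos x
  | 1 => sin x
  | m.+2 => x ^+ m / m`!%:R - cosrem m x
  end.

(** Up to the sign (-1)^n, the remainder of the expansion of exp (- x) after n terms; as for
    [cosrem], differentiation lowers the index by one. *)
Fixpoint exprem (n : nat) (x : R) : R :=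
  match n with
  | 0 => expR (- x)
  | m.+1 => x ^+ m / m`!%:R - exprem m x
  end.

Lemma is_derive_powfact n (x : R) :
  is_derive x 1 (fun y : R => y ^+ n.+1 / n.+1`!%:R) (x ^+ n / n`!%:R).
Proof.
have -> : (fun y : R => y ^+ n.+1 / n.+1`!%:R) = n.+1`!%:R^-1 \*: (id ^+ n.+1).
  by apply/funext => y; rewrite mulrC /= exprfctE.
apply: is_derive_eq; rewrite factS natrM invfM /= /GRing.scale /=.
by rewrite mulr1; field; rewrite nat1r !pnatr_eq0 -lt0n fact_gt0.
Qed.

Lemma is_derive_cosrem n (x : R) : is_derive x 1 (cosrem n.+1) (cosrem n x).
Proof.
elim/ltn_ind: n x => -[_|[_|n IH]] x.
- exact: is_derive_sin.
- have -> : cosrem 2 = cst 1 - cos.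
    by apply/funext => y; rewrite /= expr0 fact0 divr1 /GRing.sub_fun.
  by apply: is_derive_eq; rewrite sub0r opprK.
- have H := IH n (ltn_trans (ltnSn _) (ltnSn _)) x.
  exact: (is_deriveB (is_derive_powfact n x) H).
Qed.

Lemma is_derive_exprem n (x : R) : is_derive x 1 (exprem n.+1) (exprem n x).
Proof.
elim: n x => [|n IH] x.
  have -> : exprem 1 = cst 1 - (expR \o -%R).
    by apply/funext => y; rewrite /= expr0 fact0 divr1.
  by apply: is_derive_eq; rewrite sub0r mulrN1 opprK.
exact: (is_deriveB (is_derive_powfact n x) (IH x)).
Qed.

Lemma nonneg_of_derive (f g : R -> R) : (forall x : R, is_derive x 1 f (g x)) ->
  f 0 = 0 -> (forall x, 0 <= x -> 0 <= g x) -> forall x, 0 <= x -> 0 <= f x.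
Proof.
move=> fg f0 g0 x x0; rewrite -f0.
apply: (@ger0_derive1_ndecry _ f 0) => [y _|y||//|//].
- exact: ex_derive.
- rewrite in_itv/= andbT => y0; rewrite derive1E.
  by rewrite derive_val; exact/g0/ltW.
- apply: continuous_subspaceT => y; apply: differentiable_continuous.
  by apply/derivable1_diffP.
Qed.

Lemma cosrem_at0 n : cosrem n.+1 0 = 0.
Proof.
elim/ltn_ind: n => -[_|[_|n IH]] /=; first exact: sin0.
  by rewrite expr0 fact0 divr1 cos0 subrr.
by rewrite -/(cosrem n.+1 0) IH ?ltnS// expr0n mul0r subrr.
Qed.

Lemma exprem_at0 n : exprem n.+1 0 = 0.
Proof.
elim: n => [|n IH]; first by rewrite /= expr0 fact0 divr1 oppr0 expR0 subrr.
by rewrite [LHS]/= -/(exprem n.+1 0) IH expr0n mul0r subrr.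
Qed.

Lemma exprem_ge0 n x : 0 <= x -> 0 <= exprem n x.
Proof.
elim: n x => [|n IH] x x0; first exact: expR_ge0.
by apply: (nonneg_of_derive (is_derive_exprem n)) => //; exact: exprem_at0.
Qed.

Lemma exprem_le n x : 0 <= x -> exprem n x <= x ^+ n / n`!%:R.
Proof. by move=> /(exprem_ge0 n.+1) /=; rewrite subr_ge0. Qed.

(** The chain begins at 1 - cos, since cos and sin change sign; each later remainder vanishes at 0
    and has its predecessor as derivative. *)
Lemma cosrem_ge0 n x : 0 <= x -> 0 <= cosrem n.+2 x.
Proof.
elim: n x => [|n IH] x x0.
  by rewrite /= expr0 fact0 divr1 subr_ge0 cos_le1.
by apply: (nonneg_of_derive (is_derive_cosrem n.+2)) => //; exact: cosrem_at0.
Qed.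

Lemma cosrem_even n x : cosrem n.*2 (- x) = cosrem n.*2 x.
Proof.
elim: n => [|n IH]; first exact: cosN.
by rewrite doubleS /= IH -mul2n !exprM sqrrN.
Qed.

Lemma cosrem_double_ge0 n x : 0 <= cosrem n.+1.*2 x.
Proof.
have [x0|x0] := leP 0 x; first by rewrite doubleS cosrem_ge0.
by rewrite -cosrem_even doubleS cosrem_ge0// oppr_ge0 ltW.
Qed.

Lemma cosrem_double_le n x : cosrem n.*2 x <= x ^+ n.*2 / n.*2`!%:R.
Proof. by have := cosrem_double_ge0 n x; rewrite doubleS /= subr_ge0. Qed.

Lemma continuous_cosrem n : continuous (cosrem n : R -> R).
Proof.
elim/ltn_ind: n => -[_|n _] x; first exact: continuous_cos.
have := is_derive_cosrem n x => ?; apply: differentiable_continuous.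
by apply/derivable1_diffP.
Qed.

End TaylorRemainders.

Lemma cvg_of_le_inv (R : realType) (u : nat -> R) (l C : R) :
  (forall n, `|u n - l| <= C / n.+1%:R) -> u @ \oo --> l.
Proof.
move=> uC.
have h : C / n.+1%:R @[n --> \oo] --> 0.
  rewrite -[0](mulr0 C); apply: cvgM; first exact: cvg_cst.
  exact: cvg_harmonic.
apply/cvgrPdist_le => e e0.
move/cvgr_distC_lt : h => /(_ e e0); apply: filterS => n; rewrite subr0 => hn.
rewrite distrC; apply: le_trans (uC n) _.
exact: le_trans (ler_norm _) (ltW hn).
Qed.

Section GaussianMoments.
Context d {T : measurableType d} {R : realType} (P : probability T R).

(** The error is exactly the next remainder, of order n^(-2) after scaling; a bound of order 1/n is
    enough. *)
Lemma cosrem_scaled k (z : R) :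
  (fun n => n.+1%:R ^+ k.*2 * cosrem k.*2 (n.+1%:R^-1 * z)) @ \oo -->
  z ^+ k.*2 / k.*2`!%:R.
Proof.
apply: (@cvg_of_le_inv _ _ _ (z ^+ k.+1.*2 / k.+1.*2`!%:R)) => n.
have n0 : n.+1%:R != 0 :> R by rewrite pnatr_eq0.
have n1 : 1 <= n.+1%:R :> R by rewrite ler1n.
have -> : n.+1%:R ^+ k.*2 * cosrem k.*2 (n.+1%:R^-1 * z) - z ^+ k.*2 / k.*2`!%:R
   = - (n.+1%:R ^+ k.*2 * cosrem k.+1.*2 (n.+1%:R^-1 * z)).
  rewrite doubleS /= mulrBr opprB; congr (_ - _).
  by rewrite mulrA -exprMn mulrA mulfV// mul1r.
rewrite normrN ger0_norm; last by rewrite mulr_ge0 ?exprn_ge0// cosrem_double_ge0.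
apply: (@le_trans _ _ (n.+1%:R ^+ k.*2 * ((n.+1%:R^-1 * z) ^+ k.+1.*2 / k.+1.*2`!%:R))).
  by apply: ler_wpM2l; rewrite ?exprn_ge0// cosrem_double_le.
have -> : n.+1%:R ^+ k.*2 * ((n.+1%:R^-1 * z) ^+ k.+1.*2 / k.+1.*2`!%:R) =
   z ^+ k.+1.*2 / k.+1.*2`!%:R / n.+1%:R * n.+1%:R^-1.
  rewrite doubleS !exprMn !exprS !exprVn; field.
  by rewrite nat1r n0 pnatr_eq0 -lt0n fact_gt0 expf_neq0.
apply: ler_piMr; last by rewrite invf_le1 ?ltr0n.
by rewrite !divr_ge0// exprn_even_ge0// odd_double.
Qed.

(** Counterpart of [cosrem_scaled] on the side of the characteristic function exp (- a t^2), taken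
    at t = 1/(n+1). *)
Lemma exprem_scaled k (a : R) : 0 <= a ->
  (fun n => n.+1%:R ^+ k.*2 * exprem k (a * n.+1%:R^-1 ^+ 2)) @ \oo -->
  a ^+ k / k`!%:R.
Proof.
move=> a0; apply: (@cvg_of_le_inv _ _ _ (a ^+ k.+1 / k.+1`!%:R)) => n.
have n0 : n.+1%:R != 0 :> R by rewrite pnatr_eq0.
have n1 : 1 <= n.+1%:R :> R by rewrite ler1n.
set y := a * n.+1%:R^-1 ^+ 2.
have y0 : 0 <= y by rewrite mulr_ge0// exprn_even_ge0.
have yE : n.+1%:R ^+ k.*2 * y ^+ k = a ^+ k.
  by rewrite -mul2n exprM -exprMn /y mulrCA -exprMn mulfV// expr1n mulr1.
have -> : n.+1%:R ^+ k.*2 * exprem k y - a ^+ k / k`!%:R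
   = - (n.+1%:R ^+ k.*2 * exprem k.+1 y).
  by rewrite /= mulrBr opprB mulrA yE.
rewrite normrN ger0_norm; last by rewrite mulr_ge0 ?exprn_ge0// exprem_ge0.
apply: (@le_trans _ _ (n.+1%:R ^+ k.*2 * (y ^+ k.+1 / k.+1`!%:R))).
  by apply: ler_wpM2l; rewrite ?exprn_ge0// exprem_le.
have -> : n.+1%:R ^+ k.*2 * (y ^+ k.+1 / k.+1`!%:R) =
   a ^+ k.+1 / k.+1`!%:R / n.+1%:R * n.+1%:R^-1.
  by rewrite exprSr !mulrA yE /y exprS; field; rewrite nat1r n0 pnatr_eq0 -lt0n fact_gt0.
apply: ler_piMr; last by rewrite invf_le1 ?ltr0n.
by rewrite !divr_ge0// exprn_ge0.
Qed.

(** Here [a] is half the variance. By induction E [cosrem] 2k (t Z) = [exprem] k (a t^2), because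
    both sides obey the same recursion as soon as the moment of order 2k is known. Scaling this
    identity at order 2k+2 with t = 1/(n+1) and letting n grow produces the next moment. *)
Lemma gauss_even_moment (Z : T -> R) (a : R) : measurable_fun [set: T] Z ->
  0 <= a -> (forall t, Ex P (fun w => cos (t * Z w)) = expR (- (a * t ^+ 2))) ->
  forall k, L1 P (fun w => Z w ^+ k.*2) /\
            Ex P (fun w => Z w ^+ k.*2) = k.*2`!%:R * a ^+ k / k`!%:R.
Proof.
move=> mZ a0 cZ k.
have mr n t : measurable_fun [set: T] (fun w => cosrem n (t * Z w)).
  apply: (measurableT_comp (continuous_measurable_fun (@continuous_cosrem R n))).
  exact: measurable_funM.
have fact_neq0 n : n`!%:R != 0 :> R by rewrite pnatr_eq0 -lt0n fact_gt0.
suff : [/\ L1 P (fun w => Z w ^+ k.*2),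
    Ex P (fun w => Z w ^+ k.*2) = k.*2`!%:R * a ^+ k / k`!%:R &
    forall t, L1 P (fun w => cosrem k.*2 (t * Z w)) /\
              Ex P (fun w => cosrem k.*2 (t * Z w)) = exprem k (a * t ^+ 2)].
  by case.
elim: k => [|k [i1 e1 H]].
  split.
  - exact: L1_cst.
  - by rewrite (_ : (fun w => _) = fun=> 1)// Ex_cst fact0 expr0 divr1 mulr1.
  - move=> t; split; last exact: cZ.
    by apply: (@L1_bounded _ _ _ _ _ 1) => [|w]; [exact: mr 0%N t|exact: cos_max].
have H' t : L1 P (fun w => cosrem k.+1.*2 (t * Z w)) /\
    Ex P (fun w => cosrem k.+1.*2 (t * Z w)) = exprem k.+1 (a * t ^+ 2).
  have [i2 e2] := H t.
  have E : (fun w => cosrem k.+1.*2 (t * Z w)) =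
      (fun w => t ^+ k.*2 / k.*2`!%:R * Z w ^+ k.*2 - cosrem k.*2 (t * Z w)).
    by apply/funext => w; rewrite doubleS /= exprMn mulrAC.
  rewrite E; split; first by apply: L1B => //; exact: L1Z.
  rewrite ExB//; last exact: L1Z.
  rewrite ExZ// e1 e2 /=; congr (_ - _).
  by rewrite exprMn -exprM mul2n; field; rewrite !fact_neq0.
pose V w := Z w ^+ k.+1.*2 / k.+1.*2`!%:R.
pose u n w := n.+1%:R ^+ k.+1.*2 * cosrem k.+1.*2 (n.+1%:R^-1 * Z w).
have iu n : L1 P (u n) by apply: L1Z; have [] := H' (n.+1%:R^-1).
have u0 n w : 0 <= u n w by rewrite mulr_ge0 ?exprn_ge0// cosrem_double_ge0.
have uV w : u ^~ w @ \oo --> V w by exact: cosrem_scaled.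
have Eu n : Ex P (u n) = n.+1%:R ^+ k.+1.*2 * exprem k.+1 (a * n.+1%:R^-1 ^+ 2).
  by have [i e] := H' (n.+1%:R^-1); rewrite ExZ// e.
have [|iV _] := @Ex_fatou _ _ _ P u V (a ^+ k.+1 / k.+1`!%:R) iu u0 uV.
  move=> n; rewrite Eu; have an0 : 0 <= a * n.+1%:R^-1 ^+ 2.
    by rewrite mulr_ge0// exprn_even_ge0.
  apply: (@le_trans _ _ (n.+1%:R ^+ k.+1.*2 *
      ((a * n.+1%:R^-1 ^+ 2) ^+ k.+1 / k.+1`!%:R))).
    by apply: ler_wpM2l; rewrite ?exprn_ge0// exprem_le.
  rewrite mulrA -mul2n exprM -exprMn mulrCA -exprMn mulfV ?pnatr_eq0//.
  by rewrite expr1n mulr1.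
(* Integrability of [V] from Fatou's lemma makes [V] itself a majorant, which upgrades the
   inequality to convergence of the expectations. *)
have [|_ EuV] := Ex_dominated (fun n => L1_measurable (iu n)) uV iV.
  move=> n w; rewrite ger0_norm// /u.
  apply: (@le_trans _ _ (n.+1%:R ^+ k.+1.*2 *
      ((n.+1%:R^-1 * Z w) ^+ k.+1.*2 / k.+1.*2`!%:R))).
    by apply: ler_wpM2l; rewrite ?exprn_ge0// cosrem_double_le.
  by rewrite mulrA -exprMn mulrA mulfV ?pnatr_eq0// mul1r.
have EV : Ex P V = a ^+ k.+1 / k.+1`!%:R.
  move: EuV; rewrite (funext Eu) => EuV.
  by apply: (cvg_unique _ EuV) => //; exact: exprem_scaled.
have VE : (fun w => Z w ^+ k.+1.*2) = (fun w => k.+1.*2`!%:R * V w).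
  by apply/funext => w; rewrite /V mulrC divfK.
split => //.
- by rewrite VE; exact: L1Z.
- by rewrite VE ExZ// EV mulrA.
Qed.

(** The exact value is sqrt 5; the rational bound 13/5 lies between it and e. It comes from
    integrating the exponential series term by term with the even moments of the standard normal
    law. *)
Lemma gauss_exp_moment (Z : T -> R) : measurable_fun [set: T] Z ->
  (forall t, Ex P (fun w => cos (t * Z w)) = expR (- (2^-1 * t ^+ 2))) ->
  L1 P (fun w => expR (2 / 5 * Z w ^+ 2)) /\
  Ex P (fun w => expR (2 / 5 * Z w ^+ 2)) <= 13 / 5.
Proof.
move=> mZ cZ.
have h20 : 0 <= 2^-1 :> R by rewrite invr_ge0.
have M := gauss_even_moment mZ h20 cZ.
have fact_neq0 n : n`!%:R != 0 :> R by rewrite pnatr_eq0 -lt0n fact_gt0.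
pose v j w := (2 / 5) ^+ j / j`!%:R * Z w ^+ j.*2.
pose b j : R := (2 / 5) ^+ j / j`!%:R * (j.*2`!%:R * 2^-1 ^+ j / j`!%:R).
have iv j : L1 P (v j) by apply: L1Z; have [] := M j.
have Ev j : Ex P (v j) = b j by rewrite ExZ ?(M j).2//; have [] := M j.
have v0 j w : 0 <= v j w.
  apply: mulr_ge0; last by rewrite exprn_even_ge0// odd_double.
  by apply: divr_ge0 => //; apply: exprn_ge0; exact: divr_ge0.
have bS j : b j.+1 = 2 * (2 * j%:R + 1) / (5 * (j%:R + 1)) * b j.
  have E1 : j.*2.+1%:R = 2 * j%:R + 1 :> R by rewrite -natr1 -mul2n natrM.
  have E2 : j.*2.+2%:R = 2 * (j%:R + 1) :> R.
    by rewrite -natr1 E1; ring.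
  rewrite /b doubleS !factS !natrM !exprS E1 E2 -natr1.
  have j1 : j%:R + 1 != 0 :> R by rewrite natr1 pnatr_eq0.
  by field; rewrite j1 fact_neq0.
have b0 j : 0 <= b j.
  have h : 0 <= 2 / 5 :> R by exact: divr_ge0.
  by rewrite /b; apply: mulr_ge0; apply: divr_ge0.
have bb j : b j.+1 <= 4 / 5 * b j.
  rewrite bS; apply: ler_wpM2r => //.
  have j0 : 0 <= j%:R :> R by [].
  by rewrite ler_pdivrMr; [lra|lra].
(* Ratios at most 4/5 bound the tail from index N on by 5 b_N, so the left-hand side is
   non-increasing; its first value is 7/5 + 6/5. *)
have bsum N : \sum_(0 <= j < N.+2) b j + 5 * b N.+2 <= 13 / 5.
  elim: N => [|N IH].
    have b0E : b 0%N = 1 by rewrite /b double0 fact0 !expr0 !(mulr1n, divr1, mulr1).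
    have b1E : b 1%N = 2 / 5 by rewrite bS b0E mulr0n !(mulr0, add0r, mulr1).
    have b2E : b 2%N = 6 / 25 by rewrite bS b1E; field.
    rewrite big_nat_recr//= big_nat1 b0E b1E b2E; lra.
  by rewrite big_nat_recr//=; have := bb N.+2; lra.
pose u N w := \sum_(0 <= j < N) v j w.
apply: (@Ex_fatou _ _ _ P u) => [N|N w|w|N].
- exact: L1_sum.
- by apply: sumr_ge0.
- rewrite (_ : u ^~ w = series (exp_coeff (2 / 5 * Z w ^+ 2))).
    exact: is_cvg_series_exp_coeff.
  apply/funext => N; rewrite /u /series/=; apply: eq_bigr => j _.
  by rewrite /v /exp_coeff/= [in RHS](exprMn _ (2 / 5)) -exprM mul2n mulrAC.
- rewrite Ex_sum//; under eq_bigr do rewrite Ev.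
  apply: le_trans (bsum N); rewrite !big_nat_recr//=.
  by have := b0 N; have := b0 N.+1; have := b0 N.+2; lra.
Qed.

End GaussianMoments.

(** * Uniqueness of characteristic functions *)

Section SignPolynomials.
Context {R : realType}.

(* Iterating x |-> (3 x - x^3) / 2 on [-1, 1] converges to the sign of x. *)
Definition sgstep (x : R) : R := (3 * x - x ^+ 3) / 2.

Fixpoint sgpoly (k : nat) : {poly R} :=
  if k is j.+1 then 2^-1%:P * (3%:P * sgpoly j - sgpoly j ^+ 3) else 'X.

Lemma horner_sgpoly k x : (sgpoly k).[x] = iter k sgstep x.
Proof.
elim: k => [|k IH] /=; first by rewrite hornerX.
by rewrite !hornerE IH /sgstep mulrC.
Qed.

Lemma sgstep_ge x : 0 <= x <= 1 -> x <= sgstep x <= 1.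
Proof.
move=> /andP[x0 x1]; rewrite /sgstep; apply/andP; split.
  have : 0 <= x * (1 - x) * (1 + x) by rewrite !mulr_ge0//; lra.
  by lra.
have : 0 <= (1 - x) ^+ 2 * (2 + x) by rewrite mulr_ge0 ?sqr_ge0//; lra.
by lra.
Qed.

Lemma iter_sgstep_ge k x : 0 <= x <= 1 -> x <= iter k sgstep x <= 1.
Proof.
move=> /andP[x0 x1]; elim: k => [|k /andP[h1 h2]] /=; first by rewrite lexx.
have /andP[h3 ->] : iter k sgstep x <= sgstep (iter k sgstep x) <= 1.
  by apply: sgstep_ge; rewrite h2 (le_trans x0).
by rewrite (le_trans h1).
Qed.

Lemma iter_sgstepN k x : iter k sgstep (- x) = - iter k sgstep x.
Proof. by elim: k => [//|k IH] /=; rewrite IH /sgstep; field. Qed.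

Lemma iter_sgstep_le1 k x : `|x| <= 1 -> `|iter k sgstep x| <= 1.
Proof.
have [x0 x1|x0 x1] := ger0P x.
  have /andP[h1 h2] : x <= iter k sgstep x <= 1 by apply: iter_sgstep_ge; rewrite x0.
  by rewrite ger0_norm// (le_trans x0).
have /andP[h1 h2] : - x <= iter k sgstep (- x) <= 1.
  by apply: iter_sgstep_ge; rewrite x1 oppr_ge0 ltW.
rewrite -normrN -iter_sgstepN ger0_norm// (le_trans _ h1)// oppr_ge0; exact: ltW.
Qed.

(** From 1 - sgstep y = (1 - y (1 + y) / 2) (1 - y): the iterates y stay above x, so every step
    contracts the distance to 1 by at least the factor 1 - x / 2. *)
Lemma iter_sgstep_geom k x : 0 <= x <= 1 ->
  1 - iter k sgstep x <= (1 - x / 2) ^+ k.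
Proof.
move=> /andP[x0 x1]; elim: k => [|k IH]; first by rewrite expr0 /=; lra.
have /andP[h1 h2] : x <= iter k sgstep x <= 1 by apply: iter_sgstep_ge; rewrite x0.
rewrite exprS /=; set y := iter k sgstep x in IH h1 h2 *.
apply: (@le_trans _ _ ((1 - x / 2) * (1 - y))); last by rewrite ler_wpM2l//; lra.
have -> : 1 - sgstep y = (1 - y * (1 + y) / 2) * (1 - y) by rewrite /sgstep; field.
apply: ler_wpM2r; first lra.
suff : x <= y * (1 + y) by lra.
have : 0 <= y * y by rewrite mulr_ge0//; lra.
by lra.
Qed.

Lemma iter_sgstep_cvg x : 0 < x <= 1 -> iter k sgstep x @[k --> \oo] --> (1 : R).
Proof.
move=> /andP[x0 x1].
have g : (1 - x / 2) ^+ k @[k --> \oo] --> (0 : R).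
  by apply: cvg_expr; rewrite ger0_norm; lra.
apply: (@squeeze_cvgr _ _ _ _ (fun k => 1 - (1 - x / 2) ^+ k) (fun=> 1)).
- apply: nearW => k; rewrite lerBlDr -lerBlDl.
  have h : 0 <= x <= 1 by rewrite ltW.
  by rewrite iter_sgstep_geom//=; have /andP[] := iter_sgstep_ge k h.
- by rewrite -[X in _ --> X]subr0; apply: cvgB => //; exact: cvg_cst.
- exact: cvg_cst.
Qed.

(** For a sign s in {-1, 0, 1}, 1 - (s + s^2) / 2 is the indicator of s <= 0. The simpler (1 - s) /
    2 would give 1/2 at the origin. *)
Definition hlpoly k : {poly R} := 1 - 2^-1%:P * (sgpoly k + sgpoly k ^+ 2).

Lemma hlpoly_bound k x : `|x| <= 1 -> `|(hlpoly k).[x]| <= 2.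
Proof.
move=> /(iter_sgstep_le1 k); rewrite !hornerE horner_sgpoly.
set y := iter _ _ _ => y1.
have y2 : y ^+ 2 <= 1 by rewrite -real_normK ?num_real// expr_le1.
have y20 : 0 <= y ^+ 2 by exact: sqr_ge0.
by move: y1; rewrite !ler_norml => /andP[]; lra.
Qed.

Lemma hlpoly_cvg x : `|x| <= 1 ->
  (hlpoly k).[x] @[k --> \oo] --> ((x <= 0)%R%:R : R).
Proof.
move=> x1.
have -> : (fun k => (hlpoly k).[x]) =
    fun k => 1 - 2^-1 * (iter k sgstep x + iter k sgstep x * iter k sgstep x).
  by apply/funext => k; rewrite !hornerE horner_sgpoly expr2.
have lim (l : R) : iter k sgstep x @[k --> \oo] --> l ->
    1 - 2^-1 * (iter k sgstep x + iter k sgstep x * iter k sgstep x) @[k --> \oo]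
      --> 1 - 2^-1 * (l + l * l).
  move=> xl; apply: cvgB; first exact: cvg_cst.
  by apply: cvgM; [exact: cvg_cst|apply: cvgD => //; exact: cvgM].
have [x0|x0|x0] := ltrgt0P x.
- have -> : false%:R = 1 - 2^-1 * (1 + 1 * 1) :> R by rewrite mulr0n; field.
  by apply/lim/iter_sgstep_cvg; rewrite x0 -(gtr0_norm x0).
- have -> : true%:R = 1 - 2^-1 * ((- 1) + (- 1) * (- 1)) :> R by rewrite mulr1n; field.
  apply: lim; rewrite (_ : (fun k => _) = fun k => - iter k sgstep (- x)).
    have xN : 0 < - x <= 1 by rewrite oppr_gt0 x0 -(ltr0_norm x0).
    exact: (cvgN (iter_sgstep_cvg xN)).
  by apply/funext => k; rewrite iter_sgstepN opprK.
- have -> : true%:R = 1 - 2^-1 * (0 + 0 * 0) :> R by rewrite mulr1n; field.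
  apply: lim; rewrite (_ : (fun k => _) = fun=> 0); first exact: cvg_cst.
  by apply/funext; elim=> [//|k IH] /=; rewrite IH /sgstep; ring.
Qed.

End SignPolynomials.

Lemma measurable_cut d (S : measurableType d) (R : realType) (u : S -> R) a :
  measurable_fun [set: S] u ->
  measurable_fun [set: S] (fun w => (u w <= a)%R%:R : R).
Proof.
move=> mu; apply: (measurableT_comp (f := fun b : bool => b%:R : R)) => //.
exact: measurable_fun_ler.
Qed.

Lemma cut_norm_le1 (R : realType) (a b : R) : `|(a <= b)%R%:R : R| <= 1.
Proof. by rewrite ger0_norm// lern1; case: (_ <= _)%R. Qed.

Section TrigUniqueness.
Context d {T : measurableType d} {R : realType} (P : probability T R).

Section OneCoordinate.
Variables A A' y y' th th' : T -> R.
Hypotheses (iA : L1 P A) (iA' : L1 P A').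
Hypotheses (my : measurable_fun [set: T] y) (my' : measurable_fun [set: T] y').
Hypotheses (mth : measurable_fun [set: T] th) (mth' : measurable_fun [set: T] th').

Let testcos (h : R -> R) s := Ex P (fun w => A w * (h (y w) * cos (s * y w + th w))) =
   Ex P (fun w => A' w * (h (y' w) * cos (s * y' w + th' w))).
Let testsin (h : R -> R) s := Ex P (fun w => A w * (h (y w) * sin (s * y w + th w))) =
   Ex P (fun w => A' w * (h (y' w) * sin (s * y' w + th' w))).

(** The weights [A], [A'] carry the coordinates already treated and the phases [th], [th'] those
    still to come. Quantifying over all frequencies s is what makes the class stable under
    multiplication by sines. *)
Definition trig_good (h : R -> R) := [/\ measurable_fun [set: R] h,
  exists C, forall x, `|h x| <= C & forall s, testcos h s /\ testsin h s].

Lemma L1_trig (h f : R -> R) (B v ph : T -> R) C s : L1 P B ->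
  measurable_fun [set: T] v -> measurable_fun [set: T] ph ->
  measurable_fun [set: R] h -> measurable_fun [set: R] f ->
  (forall x, `|h x| <= C) -> (forall x, `|f x| <= 1) ->
  L1 P (fun w => B w * (h (v w) * f (s * v w + ph w))).
Proof.
move=> iB mv mph mh mf hC f1; apply: (@L1M_bounded _ _ _ _ _ _ C) => // [|w].
  apply: measurable_funM; first exact: measurableT_comp.
  by apply: measurableT_comp => //; apply: measurable_funD => //; exact: measurable_funM.
rewrite normrM -[leRHS]mulr1; apply: ler_pM => //.
Qed.

Let mcos : measurable_fun [set: R] (@cos R).
Proof. by apply: continuous_measurable_fun; exact: continuous_cos. Qed.
Let msin : measurable_fun [set: R] (@sin R).
Proof. by apply: continuous_measurable_fun; exact: continuous_sin. Qed.

Lemma trig_goodD h1 h2 : trig_good h1 -> trig_good h2 ->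
  trig_good (fun x => h1 x + h2 x).
Proof.
move=> [m1 [C1 b1] g1] [m2 [C2 b2] g2]; split; first exact: measurable_funD.
  by exists (C1 + C2) => x; rewrite (le_trans (ler_normD _ _))// lerD.
have key (f : R -> R) (B v ph : T -> R) s : L1 P B ->
    measurable_fun [set: T] v -> measurable_fun [set: T] ph ->
    measurable_fun [set: R] f -> (forall x, `|f x| <= 1) ->
    Ex P (fun w => B w * ((h1 (v w) + h2 (v w)) * f (s * v w + ph w))) =
    Ex P (fun w => B w * (h1 (v w) * f (s * v w + ph w))) +
    Ex P (fun w => B w * (h2 (v w) * f (s * v w + ph w))).
  move=> iB mv mph mf f1.
  rewrite -ExD; [|exact: (L1_trig s iB mv mph m1 mf b1 f1)|
                  exact: (L1_trig s iB mv mph m2 mf b2 f1)].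
  by congr Ex; apply/funext => w; rewrite -mulrDr -mulrDl.
move=> s; have [g1c g1s] := g1 s; have [g2c g2s] := g2 s.
split; rewrite /testcos /testsin.
  by rewrite !key// ?g1c ?g2c//; exact: cos_max.
by rewrite !key// ?g1s ?g2s//; exact: sin_max.
Qed.

Lemma trig_goodZ c h : trig_good h -> trig_good (fun x => c * h x).
Proof.
move=> [mh [C hC] g]; split; first exact: measurable_funM.
  by exists (`|c| * C) => x; rewrite normrM ler_wpM2l.
have key (f : R -> R) (B v ph : T -> R) s : L1 P B ->
    measurable_fun [set: T] v -> measurable_fun [set: T] ph ->
    measurable_fun [set: R] f -> (forall x, `|f x| <= 1) ->
    Ex P (fun w => B w * ((c * h (v w)) * f (s * v w + ph w))) =
    c * Ex P (fun w => B w * (h (v w) * f (s * v w + ph w))).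
  move=> iB mv mph mf f1.
  rewrite -ExZ; last exact: (L1_trig s iB mv mph mh mf hC f1).
  by congr Ex; apply/funext => w; ring.
move=> s; have [gc gs] := g s.
split; rewrite /testcos /testsin.
  by rewrite !key// ?gc//; exact: cos_max.
by rewrite !key// ?gs//; exact: sin_max.
Qed.

(** Product-to-sum formulas: the extra sine only moves the frequency s to s + b and s - b. *)
Lemma trig_good_sinM h a b : trig_good h ->
  trig_good (fun x => h x * sin (b * (x - a))).
Proof.
move=> [mh [C hC] g]; have C0 : 0 <= C by exact: le_trans (hC 0).
split.
- apply: measurable_funM => //; apply: measurableT_comp => //.
  by apply: measurable_funM => //; exact: measurable_funB.
- exists C => x; rewrite normrM -[leRHS]mulr1 ler_pM//; exact: sin_max.
have E (B v ph : T -> R) s : L1 P B ->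
    measurable_fun [set: T] v -> measurable_fun [set: T] ph ->
    let ec t := Ex P (fun w => B w * (h (v w) * cos (t * v w + ph w))) in
    let es t := Ex P (fun w => B w * (h (v w) * sin (t * v w + ph w))) in
    Ex P (fun w => B w * (h (v w) * sin (b * (v w - a)) * cos (s * v w + ph w))) =
      2^-1 * (cos (b * a) * es (s + b) - sin (b * a) * ec (s + b) -
              (cos (b * a) * es (s - b) + sin (b * a) * ec (s - b))) /\
    Ex P (fun w => B w * (h (v w) * sin (b * (v w - a)) * sin (s * v w + ph w))) =
      2^-1 * (cos (b * a) * ec (s - b) - sin (b * a) * es (s - b) -
              (cos (b * a) * ec (s + b) + sin (b * a) * es (s + b))).
  move=> iB mv mph ec es.
  have ic t := L1_trig t iB mv mph mh mcos hC (@cos_max R).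
  have is_ t := L1_trig t iB mv mph mh msin hC (@sin_max R).
  have lin4 (k1 k2 k3 k4 : R) (U1 U2 U3 U4 : T -> R) :
      L1 P U1 -> L1 P U2 -> L1 P U3 -> L1 P U4 ->
      Ex P (fun w => k1 * U1 w + k2 * U2 w + k3 * U3 w + k4 * U4 w) =
      k1 * Ex P U1 + k2 * Ex P U2 + k3 * Ex P U3 + k4 * Ex P U4.
    move=> i1 i2 i3 i4.
    rewrite ExD; [|by apply: L1D; [apply: L1D|]; exact: L1Z|exact: L1Z].
    rewrite ExD; [|by apply: L1D; exact: L1Z|exact: L1Z].
    by rewrite ExD ?ExZ//; exact: L1Z.
  have addE w : (s + b) * v w + ph w = (s * v w + ph w) + b * v w by ring.
  have subE w : (s - b) * v w + ph w = (s * v w + ph w) - b * v w by ring.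
  split.
    transitivity (2^-1 * cos (b * a) * es (s + b) + - 2^-1 * sin (b * a) * ec (s + b)
      + - 2^-1 * cos (b * a) * es (s - b) + - 2^-1 * sin (b * a) * ec (s - b)).
      rewrite -lin4; [|exact: is_|exact: ic|exact: is_|exact: ic].
      congr Ex; apply/funext => w.
      by rewrite addE subE mulrBr !(sinD, cosD, sinN, cosN); field.
    by ring.
  transitivity (2^-1 * cos (b * a) * ec (s - b) + - 2^-1 * sin (b * a) * es (s - b)
    + - 2^-1 * cos (b * a) * ec (s + b) + - 2^-1 * sin (b * a) * es (s + b)).
    rewrite -lin4; [|exact: ic|exact: is_|exact: ic|exact: is_].
    congr Ex; apply/funext => w.
    by rewrite addE subE mulrBr !(sinD, cosD, sinN, cosN); field.
  by ring.
move=> s; have [e1 e2] := E A y th s iA my mth.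
have [e1' e2'] := E A' y' th' s iA' my' mth'.
have [gc1 gs1] := g (s + b); have [gc2 gs2] := g (s - b).
split; rewrite /testcos /testsin.
  by rewrite e1 e1' gc1 gs1 gc2 gs2.
by rewrite e2 e2' gc1 gs1 gc2 gs2.
Qed.

Lemma trig_good_lim (h_ : nat -> R -> R) h C : (forall k, trig_good (h_ k)) ->
  (forall k x, `|h_ k x| <= C) -> (forall x, h_ ^~ x @ \oo --> h x) ->
  trig_good h.
Proof.
move=> g hC hh.
have mh_ k : measurable_fun [set: R] (h_ k) by have [] := g k.
have mh : measurable_fun [set: R] h.
  by apply: (measurable_fun_cvg mh_) => x _; exact: hh.
split => //.
  exists C => x; apply: (cvgr_to_le (cvg_norm (hh x))); exact: nearW.
have key (f : R -> R) (B v ph : T -> R) s : L1 P B ->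
    measurable_fun [set: T] v -> measurable_fun [set: T] ph ->
    measurable_fun [set: R] f -> (forall x, `|f x| <= 1) ->
    Ex P (fun w => B w * (h_ k (v w) * f (s * v w + ph w))) @[k --> \oo] -->
    Ex P (fun w => B w * (h (v w) * f (s * v w + ph w))).
  move=> iB mv mph mf f1.
  apply: (Ex_dominated _ _ (L1Z C (L1_norm iB)) _).2 => [k|w|k w].
  - exact: L1_measurable (L1_trig s iB mv mph (mh_ k) mf (hC k) f1).
  - by apply: cvgM; [exact: cvg_cst|apply: cvgM; [exact: hh|exact: cvg_cst]].
  - rewrite normrM mulrC ler_wpM2r// normrM -[leRHS]mulr1 ler_pM//.
move=> s; split; rewrite /testcos /testsin.
  have K := key _ A y th s iA my mth mcos (@cos_max R).
  have K' := key _ A' y' th' s iA' my' mth' mcos (@cos_max R).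
  have KK k : Ex P (fun w => A w * (h_ k (y w) * cos (s * y w + th w))) =
      Ex P (fun w => A' w * (h_ k (y' w) * cos (s * y' w + th' w))).
    by have [_ _ /(_ s)[]] := g k.
  by rewrite (funext KK) in K; exact: (cvg_unique _ K K').
have K := key _ A y th s iA my mth msin (@sin_max R).
have K' := key _ A' y' th' s iA' my' mth' msin (@sin_max R).
have KK k : Ex P (fun w => A w * (h_ k (y w) * sin (s * y w + th w))) =
    Ex P (fun w => A' w * (h_ k (y' w) * sin (s * y' w + th' w))).
  by have [_ _ /(_ s)[]] := g k.
by rewrite (funext KK) in K; exact: (cvg_unique _ K K').
Qed.

Lemma trig_good_poly (p : {poly R}) a b : trig_good (fun=> 1) ->
  trig_good (fun x => p.[sin (b * (x - a))]).
Proof.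
move=> g1; elim/poly_ind: p => [|p c IH].
  rewrite (_ : (fun x => _) = fun x => 0 * 1); first exact: trig_goodZ.
  by apply/funext => x; rewrite horner0 mul0r.
rewrite (_ : (fun x => _) =
    fun x => p.[sin (b * (x - a))] * sin (b * (x - a)) + c * 1).
  by apply: trig_goodD; [exact: trig_good_sinM|exact: trig_goodZ].
by apply/funext => x; rewrite !hornerE.
Qed.

(** A double limit. For fixed N, the polynomials [hlpoly] applied to sin ((x - a) / (N + 1))
    converge boundedly to the indicator of a periodic set; as N grows the period becomes infinite
    and the sine eventually has the sign of x - a. *)
Lemma trig_good_halfline a : trig_good (fun=> 1) ->
  trig_good (fun x => (x <= a)%R%:R).
Proof.
move=> g1; apply: (@trig_good_lim
    (fun N x => (sin (N.+1%:R^-1 * (x - a)) <= 0)%R%:R) _ 1).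
- move=> N; apply: (@trig_good_lim
      (fun k x => (hlpoly k).[sin (N.+1%:R^-1 * (x - a))]) _ 2).
  + by move=> k; exact: trig_good_poly.
  + by move=> k x; apply: hlpoly_bound; exact: sin_max.
  + by move=> x; apply: hlpoly_cvg; exact: sin_max.
- by move=> k x; rewrite ger0_norm// lern1; case: (_ <= _)%R.
- move=> x; apply: cvg_near_cst.
  have h : n.+1%:R^-1 * (x - a) @[n --> \oo] --> (0 : R).
    rewrite -[X in _ --> X](mul0r (x - a)); apply: cvgM; last exact: cvg_cst.
    exact: cvg_harmonic.
  have /cvgr_distC_lt /(_ 1 ltr01) := h.
  apply: filterS => N; rewrite subr0 => hN.
  have N0 : 0 < N.+1%:R^-1 :> R by rewrite invr_gt0.
  have pi1 : 1 < pi :> R by apply: lt_le_trans (pi_ge2 _); lra.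
  congr (_%:R); congr nat_of_bool; have [xa|xa] := leP x a.
  - rewrite -oppr_ge0 -sinN; apply: sin_ge0_pi; apply/andP; split.
      by rewrite -mulrN opprB mulr_ge0 ?subr_ge0// ltW.
    by rewrite (le_trans (ler_norm _))// normrN ltW// (lt_trans hN).
  - apply/negbTE; rewrite -ltNge; apply: sin_gt0_pi; apply/andP; split.
      by rewrite mulr_gt0// subr_gt0.
    by rewrite (le_lt_trans (ler_norm _))// (lt_trans hN).
Qed.

End OneCoordinate.

(** Uniqueness of Fourier transforms of finite signed measures on R^n, the images under z and z' of
    the measures with densities G and G'. The coordinates are converted one at a time from
    trigonometric factors to half-line indicators: [W] holds the converted ones, [S] the others.
    Signed weights are allowed because conditional expectations will be tested with a functional as
    weight. *)
Lemma trig_uniqueness (n : nat) (z z' : nat -> T -> R) (G G' : T -> R) :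
  L1 P G -> L1 P G' -> (forall i, measurable_fun [set: T] (z i)) ->
  (forall i, measurable_fun [set: T] (z' i)) ->
  (forall t : nat -> R,
    Ex P (fun w => G w * cos (\sum_(0 <= i < n) t i * z i w)) =
    Ex P (fun w => G' w * cos (\sum_(0 <= i < n) t i * z' i w)) /\
    Ex P (fun w => G w * sin (\sum_(0 <= i < n) t i * z i w)) =
    Ex P (fun w => G' w * sin (\sum_(0 <= i < n) t i * z' i w))) ->
  forall a : nat -> R,
    Ex P (fun w => G w * \prod_(0 <= i < n) (z i w <= a i)%R%:R) =
    Ex P (fun w => G' w * \prod_(0 <= i < n) (z' i w <= a i)%R%:R).
Proof.
move=> iG iG' mz mz' H a.
pose W (v : nat -> T -> R) k w := \prod_(0 <= i < k) ((v i w <= a i)%R%:R : R).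
have iW (B : T -> R) (v : nat -> T -> R) k : L1 P B ->
    (forall i, measurable_fun [set: T] (v i)) -> L1 P (fun w => B w * W v k w).
  move=> iB mv; apply: (@L1M_bounded _ _ _ _ _ _ 1) => // [|w].
    by apply: measurable_prod => i _; exact: measurable_cut.
  rewrite /W normr_prod; apply: prodr_ile1 => i _.
  by rewrite normr_ge0 /= ger0_norm// lern1; case: (_ <= _)%R.
pose S (v : nat -> T -> R) (t : nat -> R) k w := \sum_(k <= i < n) t i * v i w.
have mS (v : nat -> T -> R) t k : (forall i, measurable_fun [set: T] (v i)) ->
    measurable_fun [set: T] (S v t k).
  by move=> mv; apply: measurable_sum => i; exact: measurable_funM.
suff : forall k, (k <= n)%N -> forall t,
    Ex P (fun w => G w * W z k w * cos (S z t k w)) =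
    Ex P (fun w => G' w * W z' k w * cos (S z' t k w)) /\
    Ex P (fun w => G w * W z k w * sin (S z t k w)) =
    Ex P (fun w => G' w * W z' k w * sin (S z' t k w)).
  move=> /(_ n (leqnn n) (fun=> 0))[+ _].
  have SE v w : cos (S v (fun=> 0) n w) = 1 by rewrite /S big_geq// cos0.
  by under eq_fun do rewrite SE mulr1; under [in RHS]eq_fun do rewrite SE mulr1.
elim=> [_ t|k IH kn t].
  have WE B v (f : R -> R) : (fun w => B w * W v 0%N w * f (S v t 0%N w)) =
      (fun w => B w * f (\sum_(0 <= i < n) t i * v i w)).
    by apply/funext => w; rewrite /W big_nil mulr1.
  by rewrite !WE; exact: H.
have IHk := IH (ltnW kn).
have g1 : trig_good (fun w => G w * W z k w) (fun w => G' w * W z' k w)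
    (z k) (z' k) (S z t k.+1) (S z' t k.+1) (fun=> 1).
  split => //; first by exists 1 => x; rewrite normr1.
  move=> s; have := IHk (fun i => if i == k then s else t i).
  have SE v w : S v (fun i => if i == k then s else t i) k w =
      s * v k w + S v t k.+1 w.
    rewrite /S big_ltn// eqxx; congr (_ + _); apply: eq_big_nat => i /andP[ki _].
    by rewrite gtn_eqF.
  have FE B v (f : R -> R) :
      (fun w => B w * W v k w * f (S v (fun i => if i == k then s else t i) k w)) =
      (fun w => B w * W v k w * (1 * f (s * v k w + S v t k.+1 w))).
    by apply/funext => w; rewrite SE mul1r.
  by rewrite !FE.
have [_ _ /(_ 0)] := trig_good_halfline (iW _ _ k iG mz) (iW _ _ k iG' mz')
  (mz k) (mz' k) (mS z t k.+1 mz) (mS z' t k.+1 mz') (a k) g1.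
have FE B v (f : R -> R) :
    (fun w => B w * W v k w * ((v k w <= a k)%R%:R * f (0 * v k w + S v t k.+1 w))) =
    (fun w => B w * W v k.+1 w * f (S v t k.+1 w)).
  by apply/funext => w; rewrite mul0r add0r /W big_nat_recr//= !mulrA.
by rewrite !FE.
Qed.

End TrigUniqueness.

(** * Functionals and second moments *)

Section DualSpace.
Context {R : realType} {E : normedModType R}.
Implicit Types g h : dual E.

(* Type of the values fixed to R rather than R^o. *)
Definition ev g (x : E) : R := g x.

Lemma evD g x y : ev g (x + y) = ev g x + ev g y. Proof. exact: linearD. Qed.
Lemma evB g x y : ev g (x - y) = ev g x - ev g y. Proof. exact: linearB. Qed.
Lemma evZ g a x : ev g (a *: x) = a * ev g x. Proof. exact: linearZ. Qed.

Lemma ev_bounded g : exists2 C : R, 0 <= C & forall x, `|ev g x| <= C * `|x|.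
Proof.
have /linear_boundedP := continuous_linear_bounded 0 (@dual_continuous _ _ g 0).
move=> /pinfty_ex_gt0 [C C0 hC]; exists C; first exact: ltW.
by move=> x; exact: hC.
Qed.

Lemma dual_comb_ex (a b : R) g h :
  exists k : dual E, forall x, ev k x = a * ev g x + b * ev h x.
Proof.
have [C _ hC] := ev_bounded g; have [D _ hD] := ev_bounded h.
apply: (@dual_of_bounded_linear _ _ _ (`|a| * C + `|b| * D)).
  by move=> c x y; rewrite !evD !evZ; ring.
move=> x; rewrite (le_trans (ler_normD _ _))// !normrM mulrDl -!mulrA.
by rewrite lerD// ler_wpM2l.
Qed.

Definition dual_comb a g b h : dual E := sval (cid (dual_comb_ex a b g h)).

Lemma ev_comb a g b h x : ev (dual_comb a g b h) x = a * ev g x + b * ev h x.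
Proof. by rewrite /dual_comb; case: cid. Qed.

Lemma dual0_ex : exists k : dual E, forall x, ev k x = 0.
Proof.
apply: (@dual_of_bounded_linear _ _ (fun=> 0) 0) => [a x y|x].
  by rewrite mulr0 addr0.
by rewrite normr0 mul0r.
Qed.

Definition dual0 : dual E := sval (cid dual0_ex).

Lemma ev_dual0 x : ev dual0 x = 0.
Proof. by rewrite /dual0; case: cid. Qed.

Fixpoint dual_sum (n : nat) (t : nat -> R) (g : nat -> dual E) : dual E :=
  if n is m.+1 then dual_comb 1 (dual_sum m t g) (t m) (g m) else dual0.

Lemma ev_dual_sum n t (g : nat -> dual E) x :
  ev (dual_sum n t g) x = \sum_(0 <= i < n) t i * ev (g i) x.
Proof.
elim: n => [|n IH] /=; first by rewrite ev_dual0 big_nil.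
by rewrite ev_comb big_nat_recr//= IH mul1r.
Qed.

Definition norming (f : nat -> dual E) :=
  (forall k x, `|ev (f k) x| <= `|x|) /\
  forall x (a : R), (forall k, ev (f k) x <= a) -> `|x| <= a.

Lemma norming_leP f x a : norming f -> (`|x| <= a) <-> forall k, ev (f k) x <= a.
Proof.
move=> [f1 f2]; split => [xa k|]; last exact: f2.
by rewrite (le_trans (ler_norm _))// (le_trans (f1 _ _)).
Qed.

(** The norm is a countable supremum of functionals; measurability tested through functionals is
    therefore enough throughout. *)
Lemma norming_measurable d (T : measurableType d) f (Y : T -> E) : norming f ->
  (forall k, measurable_fun [set: T] (fun w => ev (f k) (Y w))) ->
  measurable_fun [set: T] (fun w => `|Y w|).
Proof.
move=> nf mY.
have ub w : ubound (range (fun k => ev (f k) (Y w))) `|Y w|.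
  by move=> _ [k _ <-]; apply: (norming_leP _ _ nf).1.
rewrite (_ : (fun w => _) = (fun w => sups (fun k => ev (f k) (Y w)) 0)).
  by apply: measurable_fun_sups => // w _; exists `|Y w|; exact: ub.
apply/funext => w; apply/eqP; rewrite eq_le; apply/andP; split.
  apply/(norming_leP _ _ nf) => k; apply: ub_le_sup; last by exists k.
  by exists `|Y w| => _ [j _ <-]; apply: ub; exists j.
apply: ge_sup; first by exists (ev (f 0%N) (Y w)); exists 0%N.
by move=> _ [j _ <-]; apply: ub; exists j.
Qed.

End DualSpace.

Section SquareIntegrable.
Context d {T : measurableType d} {R : realType} (P : probability T R).
Implicit Types U V : T -> R.

Definition L2 U := measurable_fun [set: T] U /\ L1 P (fun w => U w ^+ 2).

Lemma L2_prod U V : L2 U -> L2 V -> L1 P (fun w => U w * V w).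
Proof.
move=> [mU iU] [mV iV]; apply: (L1_le _ (L1D iU iV)).
  exact: measurable_funM.
move=> w; rewrite normrM -(real_normK (num_real (U w))).
rewrite -(real_normK (num_real (V w))).
have := sqr_ge0 (`|U w| - `|V w|).
have := normr_ge0 (U w); have := normr_ge0 (V w); nra.
Qed.

Lemma L2_L1 U : L2 U -> L1 P U.
Proof.
move=> [mU iU]; apply: (L1_le mU (L1D (L1_cst P 1) iU)) => w.
rewrite -(real_normK (num_real (U w))).
have := sqr_ge0 (`|U w| - 1); have := normr_ge0 (U w); nra.
Qed.

Lemma L2_bounded U C : measurable_fun [set: T] U -> (forall w, `|U w| <= C) -> L2 U.
Proof.
move=> mU UC; split => //; apply: (@L1_bounded _ _ _ _ _ (C ^+ 2)).
  exact: measurable_funX.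
by move=> w; rewrite normrX lerXn2r// nnegrE (le_trans _ (UC w)).
Qed.

Lemma L2_comb a b U V : L2 U -> L2 V -> L2 (fun w => a * U w + b * V w).
Proof.
move=> sU sV; have [mU iU] := sU; have [mV iV] := sV.
split; first by apply: measurable_funD; exact: measurable_funM.
have -> : (fun w => (a * U w + b * V w) ^+ 2) = (fun w =>
    a ^+ 2 * U w ^+ 2 + 2 * a * b * (U w * V w) + b ^+ 2 * V w ^+ 2).
  by apply/funext => w; ring.
by apply: L1D; [apply: L1D|]; apply: L1Z => //; exact: L2_prod.
Qed.

Lemma Ex_comb_prod a b U V W : L2 U -> L2 V -> L2 W ->
  Ex P (fun w => (a * U w + b * V w) * W w) =
  a * Ex P (fun w => U w * W w) + b * Ex P (fun w => V w * W w).
Proof.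
move=> sU sV sW; have iUW := L2_prod sU sW; have iVW := L2_prod sV sW.
rewrite -(ExZ a iUW) -(ExZ b iVW) -ExD; [|exact: L1Z|exact: L1Z].
by congr Ex; apply/funext => w; ring.
Qed.

Lemma Ex_comb_sq a b U V : L2 U -> L2 V ->
  Ex P (fun w => (a * U w + b * V w) ^+ 2) =
  a ^+ 2 * Ex P (fun w => U w ^+ 2) + 2 * a * b * Ex P (fun w => U w * V w) +
  b ^+ 2 * Ex P (fun w => V w ^+ 2).
Proof.
move=> sU sV; have [_ iU] := sU; have [_ iV] := sV; have iUV := L2_prod sU sV.
rewrite -(ExZ _ iU) -(ExZ _ iUV) -(ExZ _ iV).
rewrite -ExD; [|exact: L1Z|exact: L1Z].
rewrite -ExD; [|by apply: L1D; exact: L1Z|exact: L1Z].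
by congr Ex; apply/funext => w; ring.
Qed.

(** The function t -> E (t U + V)^2 is then affine and nonnegative, so its slope is zero; otherwise
    the t chosen below would give it the value -1. *)
Lemma Ex_CauchySchwarz0 U V : L2 U -> L2 V -> Ex P (fun w => U w ^+ 2) = 0 ->
  Ex P (fun w => U w * V w) = 0.
Proof.
move=> sU sV U0.
have h t : 0 <= 2 * t * Ex P (fun w => U w * V w) + Ex P (fun w => V w ^+ 2).
  have <- : Ex P (fun w => (t * U w + 1 * V w) ^+ 2) =
      2 * t * Ex P (fun w => U w * V w) + Ex P (fun w => V w ^+ 2).
    by rewrite Ex_comb_sq// U0; ring.
  by apply: Ex_ge0 => w; exact: sqr_ge0.
apply/eqP; apply: contraT => c0; set c := Ex P _ in c0 h.
have := h (- (Ex P (fun w => V w ^+ 2) + 1) / (2 * c)).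
rewrite (_ : 2 * _ * c = - (Ex P (fun w => V w ^+ 2) + 1)); last by field.
by lra.
Qed.

End SquareIntegrable.

(** * Independent copies on the product space *)

Section ProductExpectation.
Context d {T : measurableType d} {R : realType} (P : probability T R).

Definition PP : probability (T * T)%type R := (P \x P)%E.

Lemma measurable_fst_comp (u : T -> R) : measurable_fun [set: T] u ->
  measurable_fun [set: T * T] (fun z => u z.1).
Proof. by move=> mu; exact: measurableT_comp mu measurable_fst. Qed.

Lemma measurable_snd_comp (u : T -> R) : measurable_fun [set: T] u ->
  measurable_fun [set: T * T] (fun z => u z.2).
Proof. by move=> mu; exact: measurableT_comp mu measurable_snd. Qed.

Lemma Ex_prod_bounded (u v : T -> R) C D : measurable_fun [set: T] u ->
  measurable_fun [set: T] v -> (forall w, `|u w| <= C) -> (forall w, `|v w| <= D) ->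
  L1 PP (fun z => u z.1 * v z.2) /\ Ex PP (fun z => u z.1 * v z.2) = Ex P u * Ex P v.
Proof.
move=> mu mv uC vD.
have iuv : L1 PP (fun z => u z.1 * v z.2).
  apply: (@L1_bounded _ _ _ _ _ (C * D)) => [|z].
    by apply: measurable_funM; [exact: measurable_fst_comp|exact: measurable_snd_comp].
  by rewrite normrM ler_pM.
have iu : L1 P u by exact: L1_bounded uC.
have iv : L1 P v by exact: L1_bounded vD.
split => //; apply: EFin_inj; rewrite ExE//.
rewrite -(integral12_prod_meas1 iuv) /fubini_F.
under eq_integral => x _.
  rewrite (_ : (\int[P]_y (EFin \o _) (x, y))%E = (u x * Ex P v)%:E); last first.
    rewrite -ExZ// ExE//; exact: L1Z.
  over.
rewrite mulrC -(ExZ (Ex P v) iu) ExE; last exact: L1Z.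
by apply: eq_integral => x _; rewrite mulrC.
Qed.

End ProductExpectation.

(** * Fernique's theorem *)

Lemma cvg_prod_bool (R : realType) (b : nat -> bool) :
  \prod_(0 <= i < n) ((b i)%:R : R) @[n --> \oo] --> (`[< forall i, b i >]%:R : R).
Proof.
have [bT|/existsNP[k /negP/negbTE bk]] := pselect (forall i, b i).
  rewrite asboolT//; rewrite (_ : (fun n => _) = fun=> 1); first exact: cvg_cst.
  by apply/funext => n; rewrite big1// => i _; rewrite bT.
rewrite asboolF; last by move=> /(_ k); rewrite bk.
apply: cvg_near_cst; near=> n.
have kn : (k < n)%N by near: n; exact: nbhs_infty_gt.
apply/eqP; rewrite prodf_seq_eq0; apply/hasP; exists k.
  by rewrite mem_index_iota.
by rewrite bk eqxx.
Unshelve. all: by end_near. Qed.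

Section CentredGaussian.
Context d {T : measurableType d} {R : realType} (P : probability T R).
Context {E : normedModType R}.

(** A weak form that mentions no vector-valued expectation, so that it makes sense before any
    integrability is known; [a] is half the variance of the functional. *)
Definition centred_gaussian (X : T -> E) := forall g : dual E,
  measurable_fun [set: T] (fun w => ev g (X w)) /\
  exists2 a, 0 <= a & forall t, Ex P (fun w => cos (t * ev g (X w))) =
                                  expR (- (a * t ^+ 2)) /\
                                Ex P (fun w => sin (t * ev g (X w))) = 0.

Variable X : T -> E.
Hypothesis gX : centred_gaussian X.

Lemma centred_gaussian_L2 g : L2 P (fun w => ev g (X w)).
Proof.
have [mg [a a0 ga]] := gX g; split => //.
by have [] := gauss_even_moment mg a0 (fun t => (ga t).1) 1.
Qed.

Lemma centred_gaussian_char g :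
  Ex P (fun w => cos (ev g (X w))) = expR (- (Ex P (fun w => ev g (X w) ^+ 2) / 2)) /\
  Ex P (fun w => sin (ev g (X w))) = 0.
Proof.
have [mg [a a0 ga]] := gX g.
have [_ ->] := gauss_even_moment mg a0 (fun t => (ga t).1) 1.
have [] := ga 1; under eq_fun do rewrite mul1r.
under [in X in _ -> X -> _]eq_fun do rewrite mul1r.
move=> -> ->; split => //; congr (expR (- _)).
by rewrite (_ : 1.*2`! = 2)%N// (_ : 1`! = 1)%N// mulr1n; field.
Qed.

Let q g := Ex P (fun w => ev g (X w) ^+ 2).

Lemma pair_char g h :
  Ex (PP P) (fun z => cos (ev g (X z.1) + ev h (X z.2))) = expR (- ((q g + q h) / 2)) /\
  Ex (PP P) (fun z => sin (ev g (X z.1) + ev h (X z.2))) = 0.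
Proof.
have [mg _] := gX g; have [mh _] := gX h.
have mcos (u : T -> R) : measurable_fun [set: T] u ->
    measurable_fun [set: T] (fun w => cos (u w)).
  by apply: measurableT_comp; apply: continuous_measurable_fun; exact: continuous_cos.
have msin (u : T -> R) : measurable_fun [set: T] u ->
    measurable_fun [set: T] (fun w => sin (u w)).
  by apply: measurableT_comp; apply: continuous_measurable_fun; exact: continuous_sin.
have [cg sg] := centred_gaussian_char g; have [ch sh] := centred_gaussian_char h.
have [i1 e1] := Ex_prod_bounded P (mcos _ mg) (mcos _ mh)
   (fun w => cos_max _) (fun w => cos_max _).
have [i2 e2] := Ex_prod_bounded P (msin _ mg) (msin _ mh)
   (fun w => sin_max _) (fun w => sin_max _).
have [i3 e3] := Ex_prod_bounded P (mcos _ mg) (msin _ mh)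
   (fun w => cos_max _) (fun w => sin_max _).
have [i4 e4] := Ex_prod_bounded P (msin _ mg) (mcos _ mh)
   (fun w => sin_max _) (fun w => cos_max _).
split.
  under eq_fun do rewrite cosD.
  by rewrite ExB// e1 e2 sg sh mul0r subr0 cg ch -expRD; congr expR; rewrite /q; ring.
under eq_fun do rewrite sinD.
by rewrite ExD// e3 e4 sg sh mul0r mulr0 addr0.
Qed.

(** The 3-4-5 triangle keeps the coefficients rational, where a rotation by pi/4 would bring in sqrt
    2. *)
Let U (z : T * T) := (4 / 5) *: X z.1 - (3 / 5) *: X z.2.
Let V (z : T * T) := (3 / 5) *: X z.1 + (4 / 5) *: X z.2.

(* Rotation invariance: (U, V) has the characteristic function of an independent
   pair of copies of X, because the quadratic form [q] is invariant under the
   rotation of angle arctan (3/4). *)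
Lemma rotation_char g h :
  Ex (PP P) (fun z => cos (ev g (U z) + ev h (V z))) =
  Ex (PP P) (fun z => cos (ev g (X z.1) + ev h (X z.2))) /\
  Ex (PP P) (fun z => sin (ev g (U z) + ev h (V z))) =
  Ex (PP P) (fun z => sin (ev g (X z.1) + ev h (X z.2))).
Proof.
have E1 z : ev g (U z) + ev h (V z) =
    ev (dual_comb (4 / 5) g (3 / 5) h) (X z.1) +
    ev (dual_comb (- (3 / 5)) g (4 / 5) h) (X z.2).
  by rewrite !ev_comb /U /V !(evB, evD) !evZ; ring.
have -> : (fun z => cos (ev g (U z) + ev h (V z))) = (fun z =>
    cos (ev (dual_comb (4 / 5) g (3 / 5) h) (X z.1) +
         ev (dual_comb (- (3 / 5)) g (4 / 5) h) (X z.2))).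
  by apply/funext => z; rewrite E1.
have -> : (fun z => sin (ev g (U z) + ev h (V z))) = (fun z =>
    sin (ev (dual_comb (4 / 5) g (3 / 5) h) (X z.1) +
         ev (dual_comb (- (3 / 5)) g (4 / 5) h) (X z.2))).
  by apply/funext => z; rewrite E1.
have [-> ->] := pair_char g h; have [-> ->] := pair_char
  (dual_comb (4 / 5) g (3 / 5) h) (dual_comb (- (3 / 5)) g (4 / 5) h).
split => //; congr (expR (- (_ / 2))); rewrite /q.
under eq_fun do rewrite ev_comb.
under [in X in _ + X]eq_fun do rewrite ev_comb.
rewrite !Ex_comb_sq//; try exact: centred_gaussian_L2.
by field.
Qed.

Variable f : nat -> dual E.
Hypothesis nf : norming f.

Let mev g : measurable_fun [set: T] (fun w => ev g (X w)). Proof. by have [] := gX g. Qed.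

Let mU g : measurable_fun [set: T * T] (fun z => ev g (U z)).
Proof.
rewrite (_ : (fun z => _) = (fun z => 4 / 5 * ev g (X z.1) - 3 / 5 * ev g (X z.2))).
  apply: measurable_funB; apply: measurable_funM => //.
    exact: (measurable_fst_comp (mev g)).
  exact: (measurable_snd_comp (mev g)).
by apply/funext => z; rewrite /U evB !evZ.
Qed.

Let mV g : measurable_fun [set: T * T] (fun z => ev g (V z)).
Proof.
rewrite (_ : (fun z => _) = (fun z => 3 / 5 * ev g (X z.1) + 4 / 5 * ev g (X z.2))).
  apply: measurable_funD; apply: measurable_funM => //.
    exact: (measurable_fst_comp (mev g)).
  exact: (measurable_snd_comp (mev g)).
by apply/funext => z; rewrite /V evD !evZ.
Qed.

(** The conditions on two norms are interleaved into one sequence of half-lines: even indices test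
    the first vector at level s, odd ones the second at level t. Finite products of these indicators
    have equal expectations by [trig_uniqueness], and they converge to the indicators of the two
    events. *)
Lemma rotation_norm s t :
  Ex (PP P) (fun z => (`|U z| <= s)%R%:R * (`|V z| <= t)%R%:R) =
  Ex P (fun w => (`|X w| <= s)%R%:R) * Ex P (fun w => (`|X w| <= t)%R%:R).
Proof.
have mX : measurable_fun [set: T] (fun w => `|X w|).
  by apply: (norming_measurable nf) => k; exact: mev.
have [_ <-] := Ex_prod_bounded P (measurable_cut s mX) (measurable_cut t mX)
  (fun w => cut_norm_le1 _ _) (fun w => cut_norm_le1 _ _).
pose a i : R := if odd i then t else s.
pose z1 i (z : T * T) := ev (f i./2) (if odd i then V z else U z).
pose z2 i (z : T * T) := ev (f i./2) (if odd i then X z.2 else X z.1).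
have mz1 i : measurable_fun [set: T * T] (z1 i).
  by rewrite /z1; case: (odd i); [exact: mV|exact: mU].
have mz2 i : measurable_fun [set: T * T] (z2 i).
  rewrite /z2; case: (odd i); first exact: (measurable_snd_comp (mev _)).
  exact: (measurable_fst_comp (mev _)).
have i1 : L1 (PP P) (fun=> 1) by exact: L1_cst.
have key n : Ex (PP P) (fun z => \prod_(0 <= i < n) (z1 i z <= a i)%R%:R) =
    Ex (PP P) (fun z => \prod_(0 <= i < n) (z2 i z <= a i)%R%:R).
  have E1 (v : T * T -> R) : Ex (PP P) v = Ex (PP P) (fun z => 1 * v z).
    by congr Ex; apply/funext => z; rewrite mul1r.
  rewrite E1 [RHS]E1.
  apply: (@trig_uniqueness _ _ _ (PP P) n z1 z2 (fun=> 1) (fun=> 1) i1 i1 mz1 mz2) => r.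
  pose g := dual_sum n (fun i => if odd i then 0 else r i) (fun i => f i./2).
  pose h := dual_sum n (fun i => if odd i then r i else 0) (fun i => f i./2).
  have S1 z : \sum_(0 <= i < n) r i * z1 i z = ev g (U z) + ev h (V z).
    rewrite !ev_dual_sum -big_split/=; apply: eq_bigr => i _.
    by rewrite /z1; case: (odd i); rewrite mul0r ?addr0 ?add0r.
  have S2 z : \sum_(0 <= i < n) r i * z2 i z = ev g (X z.1) + ev h (X z.2).
    rewrite !ev_dual_sum -big_split/=; apply: eq_bigr => i _.
    by rewrite /z2; case: (odd i); rewrite mul0r ?addr0 ?add0r.
  have F1 (k : R -> R) : (fun z => 1 * k (\sum_(0 <= i < n) r i * z1 i z)) =
      (fun z => k (ev g (U z) + ev h (V z))).
    by apply/funext => z; rewrite mul1r S1.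
  have F2 (k : R -> R) : (fun z => 1 * k (\sum_(0 <= i < n) r i * z2 i z)) =
      (fun z => k (ev g (X z.1) + ev h (X z.2))).
    by apply/funext => z; rewrite mul1r S2.
  by rewrite !F1 !F2; exact: rotation_char.
have lim (zz : nat -> T * T -> R) (y1 y2 : T * T -> E) :
    (forall i, measurable_fun [set: T * T] (zz i)) ->
    (forall i z, zz i z = ev (f i./2) (if odd i then y2 z else y1 z)) ->
    Ex (PP P) (fun z => \prod_(0 <= i < n) (zz i z <= a i)%R%:R) @[n --> \oo] -->
    Ex (PP P) (fun z => (`|y1 z| <= s)%R%:R * (`|y2 z| <= t)%R%:R).
  move=> mzz zzE; apply: (Ex_dominated _ _ (L1_cst (PP P) 1) _).2 => [n|z|n z].
  - by apply: measurable_prod => i _; exact: measurable_cut.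
  - rewrite (_ : (_ <= s)%R%:R * _ = `[< forall i, zz i z <= a i >]%:R); last first.
      rewrite -natrM mulnb; congr (_%:R); congr nat_of_bool; apply/idP/idP.
        move=> /andP[/(norming_leP _ _ nf) h1 /(norming_leP _ _ nf) h2].
        by apply/asboolP => i; rewrite zzE /a; case: (odd i).
      move=> /asboolP h; apply/andP; split; apply/(norming_leP _ _ nf) => k.
        by have := h k.*2; rewrite zzE /a odd_double doubleK.
      by have := h k.*2.+1; rewrite zzE /a /= odd_double uphalf_double.
    exact: cvg_prod_bool.
  - rewrite normr_prod; apply: prodr_ile1 => i _.
    by rewrite normr_ge0 /=; exact: cut_norm_le1.
have L1 := lim z1 U V mz1 (fun i z => erefl).
have L2 := lim z2 (fun z => X z.1) (fun z => X z.2) mz2 (fun i z => erefl).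
by rewrite (funext key) in L1; exact: (cvg_unique _ L1 L2).
Qed.

Let F s := Ex P (fun w => (`|X w| <= s)%R%:R).

Let mX : measurable_fun [set: T] (fun w => `|X w|).
Proof. by apply: (norming_measurable nf) => k; exact: mev. Qed.

Let iF s : L1 P (fun w => (`|X w| <= s)%R%:R).
Proof.
by apply: (@L1_bounded _ _ _ _ _ 1) => [|w]; [exact: measurable_cut|exact: cut_norm_le1].
Qed.

Lemma norm_cdf_cvg : F n%:R @[n --> \oo] --> (1 : R).
Proof.
rewrite -[X in _ --> X](Ex_cst P 1).
apply: (Ex_dominated _ _ (L1_cst P 1) _).2 => [n|w|n w].
- exact: measurable_cut.
- apply: cvg_near_cst; near=> n.
  rewrite /=; suff -> : `|X w| <= n%:R by [].
  by near: n; exact: nbhs_infty_ger.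
- exact: cut_norm_le1.
Unshelve. all: by end_near. Qed.

(** If |U| <= s and |V| > t, the inverse rotation makes both independent copies larger in norm than
    (3 t - 4 s) / 5. The event |V| > t is approached by t < |V| <= t' with t' tending to infinity,
    because [rotation_norm] concerns finite levels. *)
Lemma fernique_step s t : F s * (1 - F t) <= (1 - F ((3 * t - 4 * s) / 5)) ^+ 2.
Proof.
set r := (_ / 5).
have key t' : F s * F t' - F s * F t <= (1 - F r) ^+ 2.
  rewrite /F -!rotation_norm.
  have iUV b : L1 (PP P) (fun z => (`|U z| <= s)%R%:R * (`|V z| <= b)%R%:R).
    apply: (@L1_bounded _ _ _ _ _ (1 * 1)) => [|z].
      by apply: measurable_funM; apply: measurable_cut; exact: (norming_measurable nf).
    by rewrite normrM ler_pM//; exact: cut_norm_le1.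
  have mr : measurable_fun [set: T] (fun w => 1 - (`|X w| <= r)%R%:R : R).
    by apply: measurable_funB => //; exact: measurable_cut.
  have br w : `|1 - (`|X w| <= r)%R%:R : R| <= 1.
    by case: (_ <= r)%R; rewrite ?mulr1n ?mulr0n ?subrr ?subr0 ?normr0 ?normr1.
  have [iR eR] := Ex_prod_bounded P mr mr br br.
  have <- : Ex (PP P) (fun z => (1 - (`|X z.1| <= r)%R%:R) * (1 - (`|X z.2| <= r)%R%:R)) =
      (1 - Ex P (fun w => (`|X w| <= r)%R%:R)) ^+ 2.
    by rewrite eR ExB//; [rewrite Ex_cst expr2|exact: L1_cst].
  rewrite -ExB//; apply: Ex_le => //; first exact: L1B.
  move=> z; have [Us|Us] := leP `|U z| s; last first.
    by rewrite mulr0n !mul0r subrr; case: (_ <= r)%R; case: (_ <= r)%R;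
      rewrite ?mulr1n ?mulr0n ?subrr ?subr0 ?mulr0 ?mul0r ?mulr1.
  rewrite mulr1n !mul1r.
  have [Vt|Vt] := leP `|V z| t.
    rewrite mulr1n; apply: (@le_trans _ _ 0).
      by rewrite subr_le0; case: (_ <= t')%R; rewrite ?mulr1n ?mulr0n ?lexx ?ler01.
    by case: (_ <= r)%R; case: (_ <= r)%R;
      rewrite ?mulr1n ?mulr0n ?subrr ?subr0 ?mulr0 ?mul0r ?mulr1 ?ler01.
  have comb2 (a b c e : R) (x y : E) :
      (a *: x + b *: y) + (c *: x + e *: y) = (a + c) *: x + (b + e) *: y.
    by rewrite addrACA -!scalerDl.
  have UE : U z = (4 / 5) *: X z.1 + (- (3 / 5)) *: X z.2 by rewrite scaleNr.
  have E1 : (3 / 5) *: V z = X z.1 - (4 / 5) *: U z.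
    have -> : X z.1 - (4 / 5) *: U z = (1 *: X z.1 + 0 *: X z.2) +
        ((- (4 / 5) * (4 / 5)) *: X z.1 + (- (4 / 5) * (- (3 / 5))) *: X z.2).
      by rewrite scale1r scale0r addr0 UE -scaleNr scalerDr !scalerA.
    by rewrite comb2 /V scalerDr !scalerA; congr (_ *: _ + _ *: _); field.
  have E2 : (4 / 5) *: V z = X z.2 + (3 / 5) *: U z.
    have -> : X z.2 + (3 / 5) *: U z = (0 *: X z.1 + 1 *: X z.2) +
        ((3 / 5 * (4 / 5)) *: X z.1 + (3 / 5 * (- (3 / 5))) *: X z.2).
      by rewrite scale1r scale0r add0r UE scalerDr !scalerA.
    by rewrite comb2 /V scalerDr !scalerA; congr (_ *: _ + _ *: _); field.
  have n1 : 3 / 5 * `|V z| <= `|X z.1| + 4 / 5 * `|U z|.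
    have h k : 0 <= k -> k * `|V z| = `|k *: V z| by move=> k0; rewrite normrZ ger0_norm.
    rewrite h// E1; apply: le_trans (ler_normB _ _) _.
    by rewrite normrZ ger0_norm.
  have n2 : 4 / 5 * `|V z| <= `|X z.2| + 3 / 5 * `|U z|.
    have h k : 0 <= k -> k * `|V z| = `|k *: V z| by move=> k0; rewrite normrZ ger0_norm.
    rewrite h// E2; apply: le_trans (ler_normD _ _) _.
    by rewrite normrZ ger0_norm.
  have U0 := normr_ge0 (U z); have V0 := normr_ge0 (V z).
  have r1 : (`|X z.1| <= r)%R = false by apply/negbTE; rewrite -ltNge /r; lra.
  have r2 : (`|X z.2| <= r)%R = false by apply/negbTE; rewrite -ltNge /r; lra.
  rewrite r1 r2 mulr0n !subr0 mulr1.
  by case: (_ <= t')%R; rewrite ?mulr1n ?mulr0n ?lexx ?ler01.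
have lim : F s * F n%:R - F s * F t @[n --> \oo] --> F s * 1 - F s * F t.
  by apply: cvgB; [apply: cvgM; [exact: cvg_cst|exact: norm_cdf_cvg]|exact: cvg_cst].
rewrite mulrBr; apply: (cvgr_to_le lim).
by apply: nearW => n; exact: key.
Qed.

(* Truncations of |X|^2 at the levels t_0 = s, t_(n+1) = (5 t_n + 4 s) / 3, for
   which the previous step reads P(|X| <= s) P(|X| > t_(n+1)) <= P(|X| > t_n)^2. *)
Theorem centred_fernique : L1 P (fun w => `|X w| ^+ 2).
Proof.
have sq_le (x y : R) : 0 <= x -> x <= y -> x ^+ 2 <= y ^+ 2.
  by move=> x0 xy; rewrite !expr2 ler_pM.
(* The bound s >= 1 makes the levels t_n unbounded, so that the truncations exhaust |X|^2; 19/20 is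
   close enough to 1 to start the geometric decay. *)
have [s [s1 Fs]] : exists s : R, 1 <= s /\ 19 / 20 <= F s.
  have e0 : 0 < 1 / 20 :> R by [].
  have /cvgrPdist_le /(_ _ e0) h := norm_cdf_cvg.
  near \oo => n; exists n%:R; split.
    by rewrite ler1n; near: n; exact: nbhs_infty_gt.
  have : `|1 - F n%:R| <= 1 / 20 by near: n.
  by rewrite ler_norml => /andP[_]; lra.
pose t := fix t n : R := if n is m.+1 then (5 * t m + 4 * s) / 3 else s.
have tS n : t n.+1 = (5 * t n + 4 * s) / 3 by [].
have ts n : s <= t n by elim: n => [|n IH]; rewrite ?lexx// tS; lra.
have t3 n : 0 <= t n <= 3 ^+ n * s.
  apply/andP; split; first by have := ts n; lra.
  elim: n => [|n IH]; first by rewrite expr0 mul1r.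
  by rewrite tS exprS -mulrA; have := ts n; lra.
have tn n : n%:R <= t n.
  elim: n => [|n IH]; first by rewrite /=; lra.
  by rewrite tS -natr1; have := ts n; lra.
have F1 r : F r <= 1.
  rewrite -[leRHS](Ex_cst P 1); apply: Ex_le => //; first exact: L1_cst.
  by move=> w; rewrite lern1; case: (_ <= _)%R.
have p20 n : 1 - F (t n) <= (1 / 19) ^+ n / 20.
  have F0 : 0 < F s by lra.
  (* With p = P(|X| > t_m) <= 1/20 and P(|X| <= s) >= 19/20, the bound p^2 / P(|X| <= s) is at most
     p / 19. *)
  have main m : 1 - F (t m) <= 1 / 20 -> 1 - F (t m.+1) <= 1 / 19 * (1 - F (t m)).
    move=> pm; have := fernique_step s (t m.+1).
    have -> : (3 * t m.+1 - 4 * s) / 5 = t m by rewrite tS; field.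
    move=> st; have := F1 (t m); have := F1 (t m.+1); nra.
  have small m : (1 / 19 : R) ^+ m / 20 <= 1 / 20.
    by apply: ler_wpM2r => //; apply: exprn_ile1; lra.
  elim: n => [|n IH]; first by rewrite expr0 /=; lra.
  have := main n (le_trans IH (small n)); rewrite exprS; lra.
pose u n w := Num.min (`|X w| ^+ 2) (t n ^+ 2).
have mu n : measurable_fun [set: T] (u n).
  by apply: measurable_minr => //; exact: measurable_funX.
have u0 n w : 0 <= u n w by rewrite le_min !sqr_ge0.
have iu n : L1 P (u n).
  apply: (@L1_bounded _ _ _ _ _ (t n ^+ 2)) => // w.
  by rewrite ger0_norm// ge_min lexx orbT.
(* Passing from t_n to t_(n+1) adds at most t_(n+1)^2 P(|X| > t_n) <= (9/20) s^2 (9/19)^n: squared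
   levels grow like 9^n, tails decay like 19^(-n). The right-hand side grows by (10/19) s^2
   (9/19)^n. *)
have Eu n : Ex P (u n) <= s ^+ 2 * (2 - (9 / 19) ^+ n).
  elim: n => [|n IH].
    rewrite expr0 -[leRHS](Ex_cst P); apply: Ex_le => //; first exact: L1_cst.
    by move=> w; rewrite ge_min; apply/orP; right => /=; lra.
  apply: (@le_trans _ _ (Ex P (u n) + t n.+1 ^+ 2 * (1 - F (t n)))).
    rewrite /F -[X in X - _](Ex_cst P) -ExB//; last exact: L1_cst.
    have i1 : L1 P (fun w => 1 - (`|X w| <= t n)%R%:R) by apply: L1B => //; exact: L1_cst.
    rewrite -ExZ// -ExD//; last exact: L1Z.
    apply: Ex_le => //; first by apply: L1D => //; exact: L1Z.
    move=> w; have [Xt|Xt] := leP `|X w| (t n).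
      rewrite mulr1n subrr mulr0 addr0 /u ge_min; apply/orP; left.
      by rewrite le_min lexx /= sq_le.
    rewrite mulr0n subr0 mulr1 ge_min; apply/orP; right.
    by rewrite lerDr.
  have /andP[t0 tle] := t3 n.+1.
  have T2 : t n.+1 ^+ 2 <= 9 * 9 ^+ n * s ^+ 2.
    apply: (@le_trans _ _ ((3 ^+ n.+1 * s) ^+ 2)).
      exact: sq_le.
    by rewrite exprMn -exprM mulnC exprM -exprS (_ : 3 ^+ 2 = 9)//; lra.
  have p0 : 0 <= 1 - F (t n) by rewrite subr_ge0.
  have h1 : t n.+1 ^+ 2 * (1 - F (t n)) <= 9 * 9 ^+ n * s ^+ 2 * ((1 / 19) ^+ n / 20).
    by apply: ler_pM => //; exact: sqr_ge0.
  have h2 : 9 * 9 ^+ n * s ^+ 2 * ((1 / 19) ^+ n / 20) = 9 / 20 * s ^+ 2 * (9 / 19) ^+ n.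
    have -> : 9 / 19 = 9 * (1 / 19) :> R by field.
    by rewrite [(9 * (1 / 19)) ^+ n]exprMn; field.
  have h3 : 0 <= s ^+ 2 * (9 / 19) ^+ n by rewrite mulr_ge0 ?sqr_ge0 ?exprn_ge0.
  rewrite [(9 / 19) ^+ n.+1]exprS; rewrite h2 in h1.
  move: h1 h3 IH; set qn := (9 / 19) ^+ n; set s2 := s ^+ 2; set e := Ex P _.
  set X' := _ * (1 - F _); move=> h1 h3 IH.
  rewrite (_ : 9 / 20 * s2 * qn = 9 / 20 * (s2 * qn)) in h1; last by ring.
  rewrite (_ : s2 * (2 - 9 / 19 * qn) = 2 * s2 - 9 / 19 * (s2 * qn)); last by ring.
  rewrite (_ : s2 * (2 - qn) = 2 * s2 - s2 * qn) in IH; last by ring.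
  by move: (s2 * qn) h1 h3 IH => sq; lra.
apply: (@Ex_fatou _ _ _ P u _ (s ^+ 2 * 2) iu u0 _ _).1 => [w|n].
  apply: cvg_near_cst; near=> n; rewrite /u; apply/min_idPl.
  have h : `|X w| <= t n.
    by apply: le_trans (tn n); near: n; exact: nbhs_infty_ger.
  exact: sq_le.
apply: le_trans (Eu n) _; rewrite ler_wpM2l ?sqr_ge0// gerBl exprn_ge0//.
Unshelve. all: by end_near. Qed.

End CentredGaussian.

(** * First moments from the derivative of a sine transform at 0 *)

Section SinLimit.
Context d {T : measurableType d} {R : realType} (P : probability T R).

Lemma sin_taylor (x : R) : `|sin x - x| <= `|x| ^+ 3.
Proof.
wlog x0 : x / 0 <= x.
  move=> H; have [x0|x0] := leP 0 x; first exact: H.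
  have -> : sin x - x = - (sin (- x) - - x) by rewrite sinN; ring.
  by rewrite normrN -(normrN x) H// oppr_ge0 ltW.
have h1 := cosrem_ge0 1 x0; have h2 := cosrem_ge0 3 x0.
have x3 : 0 <= x ^+ 3 by exact: exprn_ge0.
move: h1 h2; rewrite /= (_ : 1`! = 1)%N// (_ : 3`! = 6)%N// expr1 divr1 => h1 h2.
by rewrite distrC ger0_norm// (ger0_norm x0); lra.
Qed.

Lemma sin_scaled (x : R) : n.+1%:R * sin (n.+1%:R^-1 * x) @[n --> \oo] --> x.
Proof.
apply: (@cvg_of_le_inv _ _ _ (`|x| ^+ 3)) => n.
have n0 : n.+1%:R != 0 :> R by rewrite pnatr_eq0.
have n1 : 1 <= n.+1%:R :> R by rewrite ler1n.
have -> : n.+1%:R * sin (n.+1%:R^-1 * x) - x =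
    n.+1%:R * (sin (n.+1%:R^-1 * x) - n.+1%:R^-1 * x).
  by rewrite mulrBr mulrA mulfV// mul1r.
rewrite normrM ger0_norm//; apply: (@le_trans _ _ (n.+1%:R * `|n.+1%:R^-1 * x| ^+ 3)).
  by rewrite ler_wpM2l// sin_taylor.
rewrite normrM ger0_norm ?invr_ge0//.
have -> : n.+1%:R * (n.+1%:R^-1 * `|x|) ^+ 3 = `|x| ^+ 3 / n.+1%:R * n.+1%:R^-1.
  by field; rewrite nat1r.
by rewrite ler_piMr ?divr_ge0 ?exprn_ge0// invf_le1 ?ltr0n.
Qed.

Lemma sin_le (x : R) : `|sin x| <= `|x|.
Proof.
wlog x0 : x / 0 <= x.
  move=> H; have [x0|x0] := leP 0 x; first exact: H.
  by rewrite -normrN -sinN -[leRHS]normrN H// oppr_ge0 ltW.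
have h1 := cosrem_ge0 1 x0.
move: h1; rewrite /= (_ : 1`! = 1)%N// expr1 divr1 => h1.
rewrite (ger0_norm x0); have [x1|x1] := leP x 1.
  rewrite ger0_norm; first lra.
  by apply: sin_ge0_pi; rewrite x0 (le_trans x1)// (le_trans _ (pi_ge2 _))//; lra.
exact: le_trans (sin_max _) (ltW x1).
Qed.

(** Differentiation of u -> E (sin (u G) B) at 0, with |sin x| <= |x| providing the majorant; it
    converts knowledge of characteristic functions into knowledge of first moments. *)
Lemma Ex_sin_limit (G B : T -> R) C : L1 P G -> measurable_fun [set: T] B ->
  (forall w, `|B w| <= C) -> (forall u, Ex P (fun w => sin (u * G w) * B w) = 0) ->
  Ex P (fun w => G w * B w) = 0.
Proof.
move=> iG mB BC H; have mG := L1_measurable iG.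
have ms u : measurable_fun [set: T] (fun w => sin (u * G w)).
  apply: (measurableT_comp (continuous_measurable_fun (@continuous_sin R))).
  exact: measurable_funM.
have [|w|||_ L] := @Ex_dominated _ _ _ P
  (fun n w => n.+1%:R * (sin (n.+1%:R^-1 * G w) * B w)) (fun w => G w * B w)
  (fun w => C * `|G w|).
- by move=> n; apply: measurable_funM => //; apply: measurable_funM.
- under eq_fun do rewrite mulrA.
  by apply: cvgM; [exact: sin_scaled|exact: cvg_cst].
- by apply: L1Z; exact: L1_norm.
- move=> n w; rewrite mulrA normrM mulrC ler_pM// normrM ger0_norm//.
  by rewrite -ler_pdivlMl// (le_trans (sin_le _))// normrM ger0_norm// invr_ge0.
apply: (cvg_unique _ L) => //.
rewrite (_ : (fun n => _) = fun=> 0); first exact: cvg_cst.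
apply/funext => n; rewrite ExZ ?H ?mulr0//.
apply: (@L1_bounded _ _ _ _ _ (1 * C)) => [|w]; first exact: measurable_funM.
by rewrite normrM ler_pM// sin_max.
Qed.

End SinLimit.

(** * Square integrability of Gaussian vectors *)

Section GaussianVector.
Context d {T : measurableType d} {R : realType} (P : probability T R).
Context {E : normedModType R}.

Lemma continuous_ev (g : dual E) : continuous (ev g : E -> R).
Proof. exact: dual_continuous. Qed.

Lemma borel_measurable_ev (G : set_system T) (X : T -> E) (g : dual E) (B : set R) :
  borel_measurable G X -> measurable B -> G ((fun w => ev g (X w)) @^-1` B).
Proof.
move=> mX mB; apply: (mX (ev g @^-1` B)).
move: B mB; change (measurable `<=` [set B : set R | <<s open >> (ev g @^-1` B)]).
rewrite [X in X `<=` _](RGenOInfty.measurableE R).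
apply: smallest_sub; first split.
- by rewrite /= preimage_set0; exact: sigma_algebra0.
- by move=> A /= oA; rewrite setTD preimage_setC -setTD; exact: sigma_algebraCD.
- by move=> F /= oF; rewrite preimage_bigcup; exact: sigma_algebra_bigcup.
move=> _ [x ->] /=; apply: sub_sigma_algebra.
by apply: open_comp => [y _|]; [exact: continuous_ev|exact: rray_open].
Qed.

Lemma borel_measurable_evT (X : T -> E) (g : dual E) :
  borel_measurable measurable X -> measurable_fun [set: T] (fun w => ev g (X w)).
Proof. by move=> mX _ B mB; rewrite setTI; exact: borel_measurable_ev. Qed.

(** The phases exp (i t m) of the two copies cancel, leaving exp (- sigma^2 t^2) whatever the
    mean. *)
Lemma symmetrization_centred (X : T -> E) : gaussian P X ->
  centred_gaussian (PP P) (fun z => X z.1 - X z.2).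
Proof.
move=> [bX gX] g.
have mg := borel_measurable_evT g bX.
split.
  under eq_fun do rewrite evB.
  by apply: measurable_funB; [exact: measurable_fst_comp mg|exact: measurable_snd_comp mg].
have [_ [m [sigma ch]]] := gX g.
exists (sigma ^+ 2); first exact: sqr_ge0.
move=> t; have := ch t; rewrite /char_fun /cexp => -[ec es].
have mct : measurable_fun [set: T] (fun w => cos (t * ev g (X w))).
  apply: (measurableT_comp (continuous_measurable_fun (@continuous_cos R))).
  exact: measurable_funM.
have mst : measurable_fun [set: T] (fun w => sin (t * ev g (X w))).
  apply: (measurableT_comp (continuous_measurable_fun (@continuous_sin R))).
  exact: measurable_funM.
have [i1 e1] := Ex_prod_bounded P mct mct (fun w => cos_max _) (fun w => cos_max _).
have [i2 e2] := Ex_prod_bounded P mst mst (fun w => sin_max _) (fun w => sin_max _).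
have [i3 e3] := Ex_prod_bounded P mst mct (fun w => sin_max _) (fun w => cos_max _).
have [i4 e4] := Ex_prod_bounded P mct mst (fun w => cos_max _) (fun w => sin_max _).
split.
  under eq_fun do rewrite evB mulrBr cosB.
  rewrite ExD// e1 e2 /Ex ec es.
  transitivity (expR (- (sigma ^+ 2 * t ^+ 2 / 2)) * expR (- (sigma ^+ 2 * t ^+ 2 / 2))
     * (cos (t * m) ^+ 2 + sin (t * m) ^+ 2)); first by ring.
  by rewrite cos2Dsin2 mulr1 -expRD; congr expR; field.
under eq_fun do rewrite evB mulrBr sinB.
by rewrite ExB// e3 e4 mulrC subrr.
Qed.

Lemma ae_ex (Q : T -> Prop) : {ae P, forall w, Q w} -> exists w, Q w.
Proof.
move=> [N [mN N0 QN]]; apply: contrapT => /forallNP nQ.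
have NT : N = [set: T] by apply/seteqP; split => // w _; apply: QN; exact: nQ.
by have := @probability_setT _ T R P; rewrite -NT N0 => /eqP; rewrite eq_sym onee_eq0.
Qed.

(** Fernique's theorem for the symmetrised vector and Fubini's theorem give one fixed vector X x
    with E |X x - X|^2 finite; the triangle inequality does the rest. *)
Lemma norming_sq_integrable (X : T -> E) (f : nat -> dual E) :
  norming f -> gaussian P X ->
  L1 P (fun w => `|X w| ^+ 2).
Proof.
move=> nf gX; have [bX _] := gX.
have mX (u : E) : measurable_fun [set: T] (fun w => `|X w - u|).
  apply: (norming_measurable nf) => k; under eq_fun do rewrite evB.
  by apply: measurable_funB => //; exact: borel_measurable_evT.
have mX0 : measurable_fun [set: T] (fun w => `|X w|).
  by have := mX 0; under eq_fun do rewrite subr0.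
have iZ := centred_fernique (symmetrization_centred gX) nf.
have [x ix] : exists x, L1 P (fun w => `|X x - X w| ^+ 2).
  by have [x ix] := ae_ex (ae_integrable1 iZ); exists x.
apply: (@L1_le _ _ _ _ _ (fun w => 2 * `|X x - X w| ^+ 2 + 2 * `|X x| ^+ 2)).
- exact: measurable_funX.
- by apply: L1D; [exact: L1Z|exact: L1_cst].
- move=> w; rewrite ger0_norm ?exprn_ge0//.
  have := ler_normB (X x) (X x - X w); rewrite subKr => h.
  have h1 := normr_ge0 (X w); have h2 := sqr_ge0 (`|X x| - `|X x - X w|).
  apply: (@le_trans _ _ ((`|X x| + `|X x - X w|) ^+ 2)); last lra.
  by rewrite !expr2 ler_pM.
Qed.

End GaussianVector.

(** * Centring, and independence of uncorrelated functionals *)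

Section CentredGaussianFacts.
Context d {T : measurableType d} {R : realType} (P : probability T R).
Context {E : normedModType R}.

(** The parameter [mu] of the characteristic function is not known beforehand to be the expectation.
    Since E sin (t (g(X) - mu)) vanishes for all t, [Ex_sin_limit] gives E (g(X) - mu) = 0. *)
Lemma gaussian_centred (X : T -> E) (m : E) : gaussian P X ->
  (forall g, L1 P (fun w => ev g (X w))) ->
  (forall g, ev g m = Ex P (fun w => ev g (X w))) ->
  centred_gaussian P (fun w => X w - m).
Proof.
move=> [bX gX] iX mE g; have mg := borel_measurable_evT g bX.
have [_ [mu [sigma ch]]] := gX g.
have ms t : measurable_fun [set: T] (fun w => sin (t * ev g (X w))).
  apply: (measurableT_comp (continuous_measurable_fun (@continuous_sin R))).
  exact: measurable_funM.
have mc t : measurable_fun [set: T] (fun w => cos (t * ev g (X w))).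
  apply: (measurableT_comp (continuous_measurable_fun (@continuous_cos R))).
  exact: measurable_funM.
have is_ t : L1 P (fun w => sin (t * ev g (X w))).
  by apply: L1_bounded (ms t) _ => w; exact: sin_max.
have ic t : L1 P (fun w => cos (t * ev g (X w))).
  by apply: L1_bounded (mc t) _ => w; exact: cos_max.
have C t : Ex P (fun w => cos (t * (ev g (X w) - mu))) = expR (- (sigma ^+ 2 / 2 * t ^+ 2)).
  have := ch t; rewrite /char_fun /cexp => -[ec es].
  transitivity (cos (t * mu) * Ex P (fun w => cos (t * ev g (X w))) +
                sin (t * mu) * Ex P (fun w => sin (t * ev g (X w)))).
    rewrite -!ExZ// -ExD; [|exact: L1Z|exact: L1Z].
    by congr Ex; apply/funext => w; rewrite mulrBr cosB; ring.
  rewrite /Ex ec es.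
  transitivity (expR (- (sigma ^+ 2 * t ^+ 2 / 2)) * (cos (t * mu) ^+ 2 + sin (t * mu) ^+ 2)).
    by ring.
  by rewrite cos2Dsin2 mulr1; congr expR; field.
have S t : Ex P (fun w => sin (t * (ev g (X w) - mu))) = 0.
  have := ch t; rewrite /char_fun /cexp => -[ec es].
  transitivity (cos (t * mu) * Ex P (fun w => sin (t * ev g (X w))) -
                sin (t * mu) * Ex P (fun w => cos (t * ev g (X w)))).
    rewrite -!ExZ// -ExB; [|exact: L1Z|exact: L1Z].
    by congr Ex; apply/funext => w; rewrite mulrBr sinB; ring.
  by rewrite /Ex ec es; ring.
have iZ : L1 P (fun w => ev g (X w) - mu) by apply: L1B => //; exact: L1_cst.
have muE : mu = ev g m.
  apply/eqP; rewrite mE eq_sym -subr_eq0; apply/eqP.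
  rewrite -[X in _ - X](Ex_cst P) -ExB//; last exact: L1_cst.
  transitivity (Ex P (fun w => (ev g (X w) - mu) * 1)).
    by congr Ex; apply/funext => w; rewrite mulr1.
  apply: (@Ex_sin_limit _ _ _ P _ (fun=> 1) 1) => // [w|u]; first by rewrite normr1.
  by under eq_fun do rewrite mulr1; exact: S.
split; first by under eq_fun do rewrite evB -muE; exact: L1_measurable iZ.
exists (sigma ^+ 2 / 2); first by rewrite divr_ge0// sqr_ge0.
by move=> t; under eq_fun do rewrite evB -muE; rewrite C;
  under eq_fun do rewrite evB -muE; rewrite S.
Qed.

(* The joint characteristic function is even in the coefficient of [g]. *)
Lemma centred_orthogonal (Y : T -> E) g h : centred_gaussian P Y ->
  Ex P (fun w => ev g (Y w) * ev h (Y w)) = 0 ->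
  Ex P (fun w => ev g (Y w) * cos (ev h (Y w))) = 0 /\
  Ex P (fun w => ev g (Y w) * sin (ev h (Y w))) = 0.
Proof.
move=> gY gh0.
have sg := centred_gaussian_L2 gY g; have sh := centred_gaussian_L2 gY h.
have mcos (u : T -> R) : measurable_fun [set: T] u ->
    measurable_fun [set: T] (fun w => cos (u w)).
  by apply: measurableT_comp; apply: continuous_measurable_fun; exact: continuous_cos.
have msin (u : T -> R) : measurable_fun [set: T] u ->
    measurable_fun [set: T] (fun w => sin (u w)).
  by apply: measurableT_comp; apply: continuous_measurable_fun; exact: continuous_sin.
have char u : Ex P (fun w => cos (u * ev g (Y w) + ev h (Y w))) =
    expR (- ((u ^+ 2 * Ex P (fun w => ev g (Y w) ^+ 2) +
              Ex P (fun w => ev h (Y w) ^+ 2)) / 2)) /\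
    Ex P (fun w => sin (u * ev g (Y w) + ev h (Y w))) = 0.
  have [] := centred_gaussian_char gY (dual_comb u g 1 h).
  have E1 : (fun w => ev (dual_comb u g 1 h) (Y w)) =
      (fun w => u * ev g (Y w) + 1 * ev h (Y w)).
    by apply/funext => w; rewrite ev_comb.
  have E2 (k : R -> R) : (fun w => k (ev (dual_comb u g 1 h) (Y w))) =
      (fun w => k (u * ev g (Y w) + ev h (Y w))).
    by apply/funext => w; rewrite ev_comb mul1r.
  rewrite (E2 cos) (E2 sin) => -> ->; split => //.
  rewrite (_ : (fun w => ev _ _ ^+ 2) = fun w => (u * ev g (Y w) + 1 * ev h (Y w)) ^+ 2).
    by rewrite Ex_comb_sq// gh0 mulr0 addr0 expr1n mul1r.
  by apply/funext => w; rewrite ev_comb.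
have mug u : measurable_fun [set: T] (fun w => u * ev g (Y w)).
  by apply: measurable_funM => //; have [] := sg.
have mh : measurable_fun [set: T] (fun w => ev h (Y w)) by have [] := sh.
have prod_L1 (a b : T -> R) : measurable_fun [set: T] a -> measurable_fun [set: T] b ->
    (forall w, `|a w| <= 1) -> (forall w, `|b w| <= 1) -> L1 P (fun w => a w * b w).
  move=> ma mb a1 b1; apply: (@L1_bounded _ _ _ _ _ (1 * 1)) => [|w].
    exact: measurable_funM.
  by rewrite normrM ler_pM.
have icc u := prod_L1 _ _ (mcos _ (mug u)) (mcos _ mh) (fun w => cos_max _) (fun w => cos_max _).
have iss u := prod_L1 _ _ (msin _ (mug u)) (msin _ mh) (fun w => sin_max _) (fun w => sin_max _).
have isc u := prod_L1 _ _ (msin _ (mug u)) (mcos _ mh) (fun w => sin_max _) (fun w => cos_max _).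
have ics u := prod_L1 _ _ (mcos _ (mug u)) (msin _ mh) (fun w => cos_max _) (fun w => sin_max _).
have ig : L1 P (fun w => ev g (Y w)) by exact: L2_L1.
split.
  apply: (Ex_sin_limit ig (mcos _ mh) (fun w => cos_max _)) => u.
  have [_ c1] := char u; have [_ c2] := char (- u).
  have E1 : Ex P (fun w => sin (u * ev g (Y w)) * cos (ev h (Y w))) +
      Ex P (fun w => cos (u * ev g (Y w)) * sin (ev h (Y w))) = 0.
    by rewrite -ExD// -[RHS]c1; congr Ex; apply/funext => w; rewrite sinD.
  have E2 : Ex P (fun w => cos (u * ev g (Y w)) * sin (ev h (Y w))) -
      Ex P (fun w => sin (u * ev g (Y w)) * cos (ev h (Y w))) = 0.
    rewrite -ExB// -[RHS]c2; congr Ex; apply/funext => w.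
    by rewrite mulNr sinD sinN cosN; ring.
  lra.
apply: (Ex_sin_limit ig (msin _ mh) (fun w => sin_max _)) => u.
have [c1 _] := char u; have [c2 _] := char (- u); rewrite sqrrN -c1 in c2.
have E1 : Ex P (fun w => cos (u * ev g (Y w) + ev h (Y w))) =
    Ex P (fun w => cos (u * ev g (Y w)) * cos (ev h (Y w))) -
    Ex P (fun w => sin (u * ev g (Y w)) * sin (ev h (Y w))).
  by rewrite -ExB//; congr Ex; apply/funext => w; rewrite cosD.
have E2 : Ex P (fun w => cos (- u * ev g (Y w) + ev h (Y w))) =
    Ex P (fun w => cos (u * ev g (Y w)) * cos (ev h (Y w))) +
    Ex P (fun w => sin (u * ev g (Y w)) * sin (ev h (Y w))).
  rewrite -ExD//; congr Ex; apply/funext => w.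
  by rewrite mulNr cosD sinN cosN; ring.
by rewrite E1 E2 in c2; lra.
Qed.

End CentredGaussianFacts.

(** * Bochner integrals *)

Section Bochner.
Context d {T : measurableType d} {R : realType} (P : probability T R).
Context {E : completeNormedModType R}.
Variables (f : nat -> dual E) (nf : norming f).
Implicit Types (s Y : T -> E) (g : dual E).

Definition weakly_measurable Y :=
  forall g, measurable_fun [set: T] (fun w => ev g (Y w)).

Lemma weakly_measurable_norm Y : weakly_measurable Y ->
  measurable_fun [set: T] (fun w => `|Y w|).
Proof. by move=> mY; apply: (norming_measurable nf) => k; exact: mY. Qed.

Lemma weakly_measurableB Y Z : weakly_measurable Y -> weakly_measurable Z ->
  weakly_measurable (fun w => Y w - Z w).
Proof.
by move=> mY mZ g; under eq_fun do rewrite evB; exact: measurable_funB.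
Qed.

Lemma weakly_measurable_cst (x : E) : weakly_measurable (fun=> x).
Proof. by move=> g; exact: measurable_cst. Qed.

Lemma weakly_measurableZ (k : T -> R) Y : measurable_fun [set: T] k ->
  weakly_measurable Y -> weakly_measurable (fun w => k w *: Y w).
Proof.
by move=> mk mY g; under eq_fun do rewrite evZ; exact: measurable_funM.
Qed.

Lemma ev_sum g (I : Type) (r : seq I) (F : I -> E) :
  ev g (\sum_(i <- r) F i) = \sum_(i <- r) ev g (F i).
Proof. exact: raddf_sum. Qed.

Lemma simple_fun_decomp (h : E -> R) s : simple_fun s -> forall w,
  h (s w) = \sum_(v <- fset_set (range s)) h v * \1_(s @^-1` [set v]) w.
Proof.
move=> [fs _] w.
have sw : s w \in fset_set (range s) by rewrite in_fset_set//; apply/mem_set; exists w.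
rewrite (bigD1_seq (s w)) ?fset_uniq// indicE mem_set// mulr1.
rewrite big1 /= ?addr0// => v vs.
rewrite indicE memNset ?mulr0// => svw; move/eqP: vs; apply; exact: esym svw.
Qed.

Lemma simple_fun_ev (h : E -> R) s : simple_fun s -> L1 P (fun w => h (s w)) /\
  Ex P (fun w => h (s w)) =
    \sum_(v <- fset_set (range s)) h v * fine (P (s @^-1` [set v])).
Proof.
move=> ss; have [_ ms] := ss.
rewrite (funext (simple_fun_decomp h ss)).
have i1 v : L1 P (fun w => h v * \1_(s @^-1` [set v]) w).
  by apply: L1Z; exact: L1_indic.
split; first exact: L1_sum.
rewrite Ex_sum//; apply: eq_bigr => v _; rewrite ExZ; last exact: L1_indic.
by rewrite -(Ex_indic P (ms v)).
Qed.

Lemma simple_fun_weakly_measurable s : simple_fun s -> weakly_measurable s.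
Proof. by move=> ss g; have [/L1_measurable] := simple_fun_ev (ev g) ss. Qed.

Lemma ev_simple_integral g s : simple_fun s ->
  ev g (simple_integral P s) = Ex P (fun w => ev g (s w)).
Proof.
move=> ss; have [_ ->] := simple_fun_ev (ev g) ss; have [fs _] := ss.
rewrite /simple_integral fsbig_finite//= ev_sum.
by apply: eq_bigr => v _; rewrite evZ mulrC.
Qed.

Section Approximation.
Variables (Y : T -> E) (s : nat -> T -> E).
Hypotheses (mY : weakly_measurable Y) (sY : bochner_approx P Y s).

Let ss k : simple_fun (s k). Proof. by have [] := sY. Qed.

Let mD k : measurable_fun [set: T] (fun w => `|Y w - s k w|).
Proof.
apply: weakly_measurable_norm; apply: weakly_measurableB => //.
exact: simple_fun_weakly_measurable.
Qed.

(** The approximating integrals are extended reals and may be infinite for small k; their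
    convergence to 0 makes them finite only eventually. *)
Let near_L1 e : 0 < e -> \forall k \near \oo,
  L1 P (fun w => `|Y w - s k w|) /\ Ex P (fun w => `|Y w - s k w|) <= e.
Proof.
move=> e0; have [_ _ /fine_cvgP[fin /cvgrPdist_le/(_ _ e0) lim]] := sY.
near=> k; have fk : (\int[P]_w (`|Y w - s k w|)%:E)%E \is a fin_num by near: k.
have lk : `|0 - fine (\int[P]_w (`|Y w - s k w|)%:E)%E| <= e by near: k.
split; last first.
  apply: le_trans lk; rewrite sub0r normrN; exact: ler_norm.
apply: L1_intro => //; under eq_integral do rewrite normr_id.
by rewrite ltey_eq fk.
Unshelve. all: by end_near. Qed.

Lemma bochner_approx_L1 : L1 P (fun w => `|Y w|).
Proof.
have [k [ik _]] := filter_ex (near_L1 ltr01).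
have [is_ _] := simple_fun_ev (fun x => `|x|) (ss k).
apply: (L1_le _ (L1D ik is_)); first exact: weakly_measurable_norm.
by move=> w; rewrite normr_id -{1}(subrK (s k w) (Y w)) ler_normD.
Qed.

Lemma bochner_approx_ev g : L1 P (fun w => ev g (Y w)) /\
  ev g (simple_integral P (s k)) @[k --> \oo] --> Ex P (fun w => ev g (Y w)).
Proof.
have [C C0 gC] := ev_bounded g.
have iY : L1 P (fun w => ev g (Y w)).
  by apply: (L1_le (mY g) (L1Z C bochner_approx_L1)) => w; exact: gC.
split => //; apply/cvgrPdist_le => e e0.
have C1 : 0 < C + 1 by rewrite ltr_wpDl.
have e1 : 0 < e / (C + 1) by exact: divr_gt0.
have := near_L1 e1; apply: filterS => k [ik Ek].
have [is_ _] := simple_fun_ev (ev g) (ss k).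
rewrite ev_simple_integral// -ExB//.
apply: (@le_trans _ _ (Ex P (fun w => C * `|Y w - s k w|))).
  apply: Ex_norm_le; [exact: L1B|exact: L1Z|move=> w].
  by rewrite -evB; exact: gC.
rewrite ExZ//; apply: (@le_trans _ _ (C * (e / (C + 1)))); first exact: ler_wpM2l.
rewrite mulrCA -[leRHS]mulr1 ler_wpM2l ?(ltW e0)//.
by rewrite ler_pdivrMr// mul1r lerDl.
Qed.

(** The Cauchy property is checked against the norming sequence, which reduces the triangle
    inequality for vector integrals to the one for real expectations; completeness of [E] then gives
    the limit. *)
Lemma bochner_approx_cvg : cvg (simple_integral P (s k) @[k --> \oo]).
Proof.
apply: cauchy_cvg; apply: cauchy_exP => e e0.
have e3 : 0 < e / 3 by exact: divr_gt0.
have nr := near_L1 e3; have [K [iK EK]] := filter_ex nr.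
exists (simple_integral P (s K)); rewrite /fmapE /=.
apply: filterS nr => k [ik Ek] /=.
rewrite -ball_normE /ball_ /=; apply: (@le_lt_trans _ _ (e / 3 + e / 3)); last lra.
apply: (norming_leP _ _ nf).2 => j; rewrite evB !ev_simple_integral//.
have [is1 _] := simple_fun_ev (ev (f j)) (ss K).
have [is2 _] := simple_fun_ev (ev (f j)) (ss k).
rewrite -ExB//.
apply: (@le_trans _ _ (Ex P (fun w => `|Y w - s K w| + `|Y w - s k w|))); last first.
  by rewrite ExD// lerD.
apply: Ex_le => //; [exact: L1B|exact: L1D|move=> w].
rewrite -evB; apply: le_trans (ler_norm _) (le_trans (nf.1 _ _) _).
rewrite (_ : s K w - s k w = (Y w - s k w) - (Y w - s K w)).
  by rewrite [leRHS]addrC; exact: ler_normB.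
by rewrite opprB [RHS]addrC addrA subrK.
Qed.

End Approximation.

Lemma bochner_integrable_L1 Y : weakly_measurable Y -> bochner_integrable P Y ->
  L1 P (fun w => `|Y w|).
Proof. by move=> mY [s sY]; exact: bochner_approx_L1 mY sY. Qed.

(** Whichever limit [xget] selects, its image under g is the real expectation; the default value is
    excluded because [bochner_approx_cvg] exhibits a limit. *)
Lemma ev_bochner_integral g Y : weakly_measurable Y -> bochner_integrable P Y ->
  ev g (bochner_integral P Y) = Ex P (fun w => ev g (Y w)).
Proof.
move=> mY [s sY]; rewrite /bochner_integral; case: xgetP.
  move=> v _ [s' s'Y s'v]; have [_ h] := bochner_approx_ev mY s'Y g.
  apply: (cvg_unique _ _ h) => //.
  by apply: continuous_cvg; [exact: continuous_ev|exact: s'v].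
move=> /(_ (lim (simple_integral P (s k) @[k --> \oo]))) []; exists s => //.
exact: bochner_approx_cvg mY sY.
Qed.

(* [s k.+1] moves to the [k]-th point of a dense sequence whenever that point is
   closer to [Y] than [s k]. *)
Lemma L1_bochner_integrable Y : separable E -> weakly_measurable Y ->
  L1 P (fun w => `|Y w|) -> bochner_integrable P Y.
Proof.
move=> /separable_dense_seq[u uP] mY iY.
pose s := fix s k w : E := if k is j.+1 then
  if `|Y w - u j| < `|Y w - s j w| then u j else s j w else 0.
have ss k : simple_fun (s k).
  elim: k => [|k IH].
    split => [|v].
      by apply: (sub_finite_set (B := [set 0])) => // _ [w _ <-].
    rewrite (_ : s 0%N = cst 0)// preimage_cst; case: ifP => _ //.
  have [fs ms] := IH; split => [|v].
    apply: (sub_finite_set (B := [set u k] `|` range (s k))).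
      by move=> _ [w _ <-] /=; case: ifP => _; [left|right; exists w].
    by rewrite finite_setU; split.
  pose A := [set w | `|Y w - u k| < `|Y w - s k w|].
  have mA : measurable A.
    rewrite (_ : A = ~` [set w | `|Y w - s k w| <= `|Y w - u k|]); last first.
      by apply/seteqP; split => w; rewrite /A /= ltNge => /negP.
    apply: measurableC; rewrite -[X in measurable X]setTI.
    apply: measurable_fun_le => //; apply: weakly_measurable_norm; apply: weakly_measurableB => //.
      exact: simple_fun_weakly_measurable.
  rewrite (_ : s k.+1 @^-1` [set v] =
      (A `&` (cst (u k) @^-1` [set v])) `|` (~` A `&` (s k @^-1` [set v]))).
    apply: measurableU; apply: measurableI => //.
      by rewrite preimage_cst; case: ifP.
    exact: measurableC.
  apply/seteqP; split => w /=; rewrite /A /=.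
    by case: ifP => h; [left|right; split => //; apply/negP; rewrite h].
  by move=> [[-> ]|[/negP/negbTE ->]].
have mono k w : `|Y w - s k.+1 w| <= `|Y w - s k w|.
  by rewrite /=; case: ifP => // /ltW.
have le0 k w : `|Y w - s k w| <= `|Y w|.
  elim: k => [|k IH]; first by rewrite subr0.
  exact: le_trans (mono k w) IH.
have leu k w : `|Y w - s k.+1 w| <= `|Y w - u k|.
  by rewrite /=; case: ifP => // /negbT; rewrite -leNgt.
have cvg0 w : `|Y w - s k w| @[k --> \oo] --> (0 : R).
  apply/cvgrPdist_lt => e e0; have [k uk] := uP (Y w) e e0.
  near=> n; rewrite sub0r normrN normr_id; apply: le_lt_trans uk.
  apply: le_trans (leu k w).
  have kn : (k.+1 <= n)%N by near: n; exact: nbhs_infty_ge.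
  rewrite -(subnK kn); elim: (n - k.+1)%N => [|m IH]; first by rewrite add0n.
  by rewrite addSn; exact: le_trans (mono _ _) IH.
exists s; split => //.
  apply/aeW => w; apply/cvgrPdist_lt => e e0.
  have /cvgrPdist_lt/(_ e e0) := cvg0 w.
  by apply: filterS => k; rewrite sub0r normrN normr_id.
have mD k : measurable_fun [set: T] (fun w => `|Y w - s k w|).
  apply: weakly_measurable_norm; apply: weakly_measurableB => //.
  exact: simple_fun_weakly_measurable.
have [|_ h] := Ex_dominated mD cvg0 iY; first by move=> k w; rewrite normr_id.
rewrite Ex_cst in h.
rewrite (_ : (fun k => _) = fun k => (Ex P (fun w => `|Y w - s k w|))%:E).
  by apply: cvg_EFin => //; exact: nearW.
apply/funext => k; rewrite ExE//; apply: (L1_le _ iY) => //.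
by move=> w; rewrite normr_id.
Unshelve. all: by end_near. Qed.

End Bochner.

(** * Gram-Schmidt orthonormalisation of functionals *)

Section GramSchmidt.
Context d {T : measurableType d} {R : realType} (P : probability T R).
Context {E : normedModType R}.
Variable Y : T -> E.
Hypothesis sY : forall g : dual E, L2 P (fun w => ev g (Y w)).
Implicit Types g h : dual E.

Definition covf g h : R := Ex P (fun w => ev g (Y w) * ev h (Y w)).

Lemma covfC g h : covf g h = covf h g.
Proof. by congr Ex; apply/funext => w; rewrite mulrC. Qed.

Lemma covf_ge0 g : 0 <= covf g g.
Proof. by apply: Ex_ge0 => w; rewrite -expr2 sqr_ge0. Qed.

Lemma covf_comb a g b h (k : dual E) :
  covf (dual_comb a g b h) k = a * covf g k + b * covf h k.
Proof.
rewrite -Ex_comb_prod//; congr Ex; apply/funext => w.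
by rewrite ev_comb.
Qed.

Lemma covf_dual0 (k : dual E) : covf dual0 k = 0.
Proof.
rewrite -[RHS](Ex_cst P); congr Ex; apply/funext => w.
by rewrite ev_dual0 mul0r.
Qed.

Lemma covf_sum n t (g : nat -> dual E) (k : dual E) :
  covf (dual_sum n t g) k = \sum_(0 <= i < n) t i * covf (g i) k.
Proof.
elim: n => [|n IH]; first by rewrite big_nil covf_dual0.
by rewrite /= covf_comb big_nat_recr//= IH mul1r.
Qed.

Lemma covf_degenerate g h : covf g g = 0 -> covf g h = 0.
Proof. by move=> g0; apply: (Ex_CauchySchwarz0 (sY g) (sY h)). Qed.

(** The orthogonal projection is carried out on functionals rather than on random variables, so that
    residuals are again functionals of Y and every combination of them is Gaussian at no cost. *)
Definition residual n (G : nat -> dual E) g : dual E :=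
  dual_comb 1 g (- 1) (dual_sum n (fun k => covf g (G k)) G).

Lemma residual_ext n (G G' : nat -> dual E) g :
  (forall k, (k < n)%N -> G k = G' k) -> residual n G g = residual n G' g.
Proof.
rewrite /residual => GG'; congr dual_comb.
elim: n GG' => [//|n IH] GG' /=; rewrite GG'// IH// => k kn.
by apply: GG'; exact: ltnW.
Qed.

(* A degenerate residual is sent to the zero functional, because 0^-1 = 0. *)
Definition normalize g : dual E := dual_comb (Num.sqrt (covf g g))^-1 g 0 g.

Variable e : nat -> dual E.

(** Course-of-values recursion: stage n tabulates the first n functionals, and [gs] reads off the
    last entry of each table. *)
Fixpoint gs_upto n : nat -> dual E :=
  if n is m.+1 then
    fun k => if k == m then normalize (residual m (gs_upto m) (e m)) else gs_upto m k
  else fun=> dual0.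

Definition gs n := gs_upto n.+1 n.

Lemma gs_uptoE n k : (k < n)%N -> gs_upto n k = gs k.
Proof.
elim: n => [//|n IH]; rewrite ltnS leq_eqVlt => /predU1P[->//|kn].
by rewrite /= ltn_eqF// IH.
Qed.

Lemma gsE n : gs n = normalize (residual n gs (e n)).
Proof.
rewrite /gs /= eqxx; congr normalize; apply: residual_ext => k kn.
exact: gs_uptoE.
Qed.

Lemma covf_normalize g (k : dual E) : covf (normalize g) k = (Num.sqrt (covf g g))^-1 * covf g k.
Proof. by rewrite covf_comb mul0r addr0. Qed.

Lemma covf_normalize_self g :
  covf (normalize g) (normalize g) = 0 \/ covf (normalize g) (normalize g) = 1.
Proof.
rewrite covf_normalize covfC covf_normalize.
have [->|g0] := eqVneq (covf g g) 0; first by left; rewrite !mulr0.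
right; rewrite -{3}(sqr_sqrtr (covf_ge0 g)); set r := Num.sqrt _.
have r0 : r != 0 by rewrite gt_eqF// sqrtr_gt0 lt_def g0 covf_ge0.
by field.
Qed.

Lemma residual_orth n g : (forall i j, (i < n)%N -> (j < n)%N -> i != j ->
    covf (gs i) (gs j) = 0) ->
  forall j, (j < n)%N -> covf (residual n gs g) (gs j) = 0.
Proof.
move=> orth j jn; rewrite covf_comb mul1r covf_sum.
rewrite (bigD1_seq j) ?iota_uniq ?mem_index_iota//=.
rewrite big_nat_cond big1 ?addr0; last first.
  by move=> i /andP[/andP[_ i_n] ij]; rewrite orth// mulr0.
have [] := covf_normalize_self (residual j gs (e j)); rewrite -gsE => jj.
  by rewrite (covfC g) (covf_degenerate g jj) !mul0r mulr0 addr0.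
by rewrite jj mulr1 mulN1r subrr.
Qed.

Lemma gs_orth i j : i != j -> covf (gs i) (gs j) = 0.
Proof.
suff H n : forall i j, (i < n)%N -> (j < n)%N -> i != j -> covf (gs i) (gs j) = 0.
  by apply: (H (maxn i j).+1); rewrite ltnS ?leq_maxl ?leq_maxr.
elim: n => [//|n IH] {}i {}j.
have step k : (k < n)%N -> covf (gs n) (gs k) = 0.
  by move=> kn; rewrite gsE covf_normalize residual_orth// mulr0.
rewrite ltnS leq_eqVlt => /predU1P[->|i_n]; rewrite ltnS leq_eqVlt => /predU1P[->|jn];
  rewrite ?eqxx// => ij.
- exact: step.
- by rewrite covfC step.
- exact: IH.
Qed.

Lemma gs_norm i : covf (gs i) (gs i) = 0 \/ covf (gs i) (gs i) = 1.
Proof. by rewrite gsE; exact: covf_normalize_self. Qed.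

Lemma residual_gs n g j : (j < n)%N -> covf (residual n gs g) (gs j) = 0.
Proof. by apply: residual_orth => i k _ _; exact: gs_orth. Qed.

Lemma residual_covf n g h : covf (residual n gs g) h =
  covf g h - \sum_(0 <= k < n) covf g (gs k) * covf (gs k) h.
Proof. by rewrite covf_comb mul1r covf_sum mulN1r. Qed.

(** The functional e_i is its own residual plus a combination of earlier [gs]. That residual is
    either a nonzero multiple of [gs] i, to which the residual of g is orthogonal, or degenerate,
    hence uncorrelated with everything. *)
Lemma residual_e n g i : (i < n)%N -> covf (residual n gs g) (e i) = 0.
Proof.
move=> i_n; set h := residual n gs g.
have hr : covf h (residual i gs (e i)) = 0.
  have [r0|r0] := eqVneq (covf (residual i gs (e i)) (residual i gs (e i))) 0.
    by rewrite covfC; exact: covf_degenerate.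
  have := residual_gs g i_n; rewrite -/h covfC gsE covf_normalize => /eqP.
  rewrite mulf_eq0 invr_eq0 sqrtr_eq0 leNgt lt_def r0 covf_ge0 /=.
  by rewrite covfC => /eqP.
move: hr; rewrite covfC residual_covf big_nat_cond big1 ?subr0 1?covfC// => k.
move=> /andP[/andP[_ ki] _]; rewrite (covfC _ h) residual_gs ?mulr0//.
exact: ltn_trans ki i_n.
Qed.

Lemma residual_norm n g : covf (residual n gs g) (residual n gs g) =
  covf g g - \sum_(0 <= k < n) covf g (gs k) ^+ 2.
Proof.
rewrite residual_covf covfC residual_covf -addrA; congr (_ + _).
rewrite (_ : \sum_(0 <= k < n) covf g (gs k) * covf (gs k) (residual n gs g) = 0).
  by rewrite subr0; congr (- _); apply: eq_bigr => k _; rewrite (covfC (gs k)).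
rewrite big_nat_cond big1// => k /andP[/andP[_ kn] _].
by rewrite (covfC (gs k)) residual_gs ?mulr0.
Qed.

Lemma ev_residual n g x : ev (residual n gs g) x =
  ev g x - \sum_(0 <= k < n) covf g (gs k) * ev (gs k) x.
Proof. by rewrite ev_comb ev_dual_sum mul1r mulN1r. Qed.

(** Serves to show that the orthonormalised variables are measurable for the conditioning
    sigma-algebra. *)
Lemma gs_span n : exists t, forall x, ev (gs n) x = \sum_(0 <= i < n.+1) t i * ev (e i) x.
Proof.
elim/ltn_ind: n => n IH.
have /choice[t tP] : forall k, exists t : nat -> R, (k < n)%N ->
    forall x, ev (gs k) x = \sum_(0 <= i < n.+1) t i * ev (e i) x.
  move=> k; have [kn|nk] := ltnP k n; last by exists (fun=> 0).
  have [t tP] := IH k kn; exists (fun i => if (i <= k)%N then t i else 0) => _ x.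
  have kn1 : (k.+1 <= n.+1)%N by exact: ltnW.
  rewrite tP [RHS](big_cat_nat _ kn1)//=.
  rewrite [X in _ = _ + X]big_nat_cond [X in _ = _ + X]big1 ?addr0; last first.
    by move=> i /andP[/andP[ki _] _]; rewrite leqNgt ki mul0r.
  by apply: eq_big_nat => i /andP[_ ik]; rewrite -ltnS ik.
set a := (Num.sqrt (covf (residual n gs (e n)) (residual n gs (e n))))^-1.
exists (fun i => a * ((i == n)%:R - \sum_(0 <= k < n) covf (e n) (gs k) * t k i)) => x.
rewrite gsE ev_comb mul0r addr0 -/a ev_residual.
under [RHS]eq_bigr do rewrite -mulrA mulrBl.
rewrite -mulr_sumr sumrB; congr (a * (_ - _)).
  rewrite (bigD1_seq n) ?iota_uniq ?mem_index_iota ?ltnSn//= eqxx mul1r.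
  by rewrite big1 ?addr0// => i /negbTE->; rewrite mul0r.
under [RHS]eq_bigr do rewrite mulr_suml.
rewrite exchange_big/=; apply: eq_big_nat => k /andP[_ kn].
rewrite tP// mulr_sumr; apply: eq_bigr => i _; ring.
Qed.

End GramSchmidt.

(** * Conditional expectations *)

Lemma sigma_algebra_preimage_halfline (T : Type) (R : realType)
    (G : set_system T) (z : T -> R) : sigma_algebra setT G ->
  (forall x, G [set w | z w <= x]) -> forall B : set R, measurable B -> G (z @^-1` B).
Proof.
move=> [G0 GC GU] Gz B mB.
move: B mB; change (measurable `<=` [set B : set R | G (z @^-1` B)]).
rewrite [X in X `<=` _](RGenOInfty.measurableE R).
apply: smallest_sub; first split.
- by rewrite /= preimage_set0.
- by move=> A /= oA; rewrite setTD preimage_setC -setTD; exact: GC.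
- by move=> F /= oF; rewrite preimage_bigcup; exact: GU.
move=> _ [x ->] /=; rewrite (_ : z @^-1` _ = [set: T] `\` [set w | z w <= x]).
  exact/GC/Gz.
apply/seteqP; split => w /=; rewrite in_itv/= andbT ltNge.
  by move=> /negP ?; split.
by move=> [_ /negP].
Qed.

(** * Sigma-algebras of finitely many real variables *)

Section PiLambda.
Context d {T : measurableType d} {R : realType} (P : probability T R).
Variables (n : nat) (z : nat -> T -> R).
Hypothesis mz : forall i, measurable_fun [set: T] (z i).

Definition cylinders : set_system T :=
  [set A | exists a : nat -> R, A = [set w | forall i, (i < n)%N -> z i w <= a i]].

Definition sigma_upto : set_system T :=
  <<s \bigcup_(j in [set j | (j < n)%N])
        preimage_set_system [set: T] (z j) measurable >>.

Lemma cylinders_setI : setI_closed cylinders.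
Proof.
move=> _ _ [a ->] [b ->]; exists (fun i => Num.min (a i) (b i)).
apply/seteqP; split => w /=.
  by move=> [wa wb] i i_n; rewrite le_min wa// wb.
by move=> wab; split => i i_n; have := wab i i_n; rewrite le_min => /andP[].
Qed.

Lemma sigma_upto_cylinders : sigma_upto `<=` <<s cylinders >>.
Proof.
apply: smallest_sub; first exact: smallest_sigma_algebra.
move=> _ [j /= jn] [B mB <-]; rewrite setTI.
apply: sigma_algebra_preimage_halfline mB; first exact: smallest_sigma_algebra.
move=> x.
(* A cylinder constrains all coordinates at once; letting the other levels grow leaves a constraint
   on [z j] alone. *)
rewrite (_ : [set w | z j w <= x] = \bigcup_N
    [set w | forall i, (i < n)%N -> z i w <= if i == j then x else N%:R]).
  apply: sigma_algebra_bigcup => N; apply: sub_sigma_algebra.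
  by exists (fun i => if i == j then x else N%:R).
apply/seteqP; split => w /=; last first.
  by move=> [N _ /(_ j jn)]; rewrite eqxx.
move=> zx; exists (Num.bound (\sum_(0 <= i < n) `|z i w|)) => // i i_n.
case: ifP => [/eqP->//|_]; apply: (@le_trans _ _ (\sum_(0 <= i < n) `|z i w|)).
  rewrite (bigD1_seq i) ?iota_uniq ?mem_index_iota//=.
  by apply: (le_trans (ler_norm _)); rewrite lerDl sumr_ge0.
by apply: ltW; apply: archi_boundP; apply: sumr_ge0.
Qed.

Lemma sigma_upto_measurable : sigma_upto `<=` measurable.
Proof.
apply: smallest_sub; first exact: sigma_algebra_measurable.
by move=> _ [j _] [B mB <-]; exact: mz.
Qed.

Lemma sigma_upto_preimage j (B : set R) : (j < n)%N -> measurable B ->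
  sigma_upto (z j @^-1` B).
Proof.
move=> jn mB; apply: sub_sigma_algebra; exists j => //; exists B => //.
by rewrite setTI.
Qed.

(** Dynkin's argument: the measurable sets A with E (1_A U) = 0 form a lambda-system containing the
    cylinders, which are stable under intersection. The whole space is reached by letting all levels
    tend to infinity. *)
Lemma sigma_upto_orthogonal (U : T -> R) : L1 P U ->
  (forall a : nat -> R, Ex P (fun w => U w * \prod_(0 <= i < n) (z i w <= a i)%R%:R) = 0) ->
  forall A, sigma_upto A -> Ex P (fun w => \1_A w * U w) = 0.
Proof.
move=> iU H A /sigma_upto_cylinders GA.
pose D := [set A : set T | measurable A /\ Ex P (fun w => \1_A w * U w) = 0].
suff [] : D A by [].
have i1 B : measurable B -> L1 P (fun w => \1_B w * U w).
  move=> mB; under eq_fun do rewrite mulrC.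
  apply: (L1M_bounded (C := 1) iU) => [|w]; first exact: measurable_indic.
  by rewrite indicE ger0_norm// lern1; case: (_ \in _).
have mcyl a : measurable [set w | forall i, (i < n)%N -> z i w <= a i].
  rewrite (_ : mkset _ = \bigcap_(i in [set i | (i < n)%N]) [set w | z i w <= a i]).
    apply: bigcap_measurableType => i _; rewrite -[X in measurable X]setTI.
    exact: measurable_fun_le.
  by apply/seteqP; split.
have cylE a w : \1_[set w | forall i, (i < n)%N -> z i w <= a i] w =
    \prod_(0 <= i < n) (z i w <= a i)%R%:R :> R.
  rewrite indicE; have [h|h] := pselect (forall i, (i < n)%N -> z i w <= a i).
    rewrite mem_set// big_nat_cond big1// => i /andP[/andP[_ i_n] _].
    by rewrite h.
  rewrite memNset//; apply/esym/eqP; rewrite prodf_seq_eq0.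
  move/existsNP : h => [i /not_implyP[i_n /negP/negbTE zi]].
  by apply/hasP; exists i; rewrite ?mem_index_iota//= zi.
have cylD : cylinders `<=` D.
  move=> _ [a ->]; split; first exact: mcyl.
  by rewrite -[RHS](H a); congr Ex; apply/funext => w; rewrite cylE mulrC.
apply: (lambda_system_subset cylinders_setI _ cylD) GA => //.
have H1 : Ex P U = 0.
  have [_ lim] : L1 P U /\
      Ex P (fun w => U w * \prod_(0 <= i < n) (z i w <= N%:R)%R%:R) @[N --> \oo] --> Ex P U.
    apply: (Ex_dominated _ _ (L1_norm iU)) => [N|w|N w].
    - apply: measurable_funM; first exact: (L1_measurable iU).
      by apply: measurable_prod => i _; exact: measurable_cut.
    - apply: cvg_near_cst; near=> N; rewrite big_nat_cond big1 ?mulr1//.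
      move=> i /andP[/andP[_ i_n] _]; suff -> : z i w <= N%:R by [].
      apply: (@le_trans _ _ (\sum_(0 <= i < n) `|z i w|)).
        rewrite (bigD1_seq i) ?iota_uniq ?mem_index_iota//=.
        by apply: (le_trans (ler_norm _)); rewrite lerDl sumr_ge0.
      by near: N; exact: nbhs_infty_ger.
    - rewrite normrM -[leRHS]mulr1 ler_wpM2l// normr_prod; apply: prodr_ile1 => i _.
      by rewrite normr_ge0 /=; exact: cut_norm_le1.
  apply: (cvg_unique _ lim) => //.
  by rewrite (_ : (fun N => _) = fun=> 0); [exact: cvg_cst|exact/funext].
split => //.
- by split => //; rewrite -[RHS]H1; congr Ex; apply/funext => w; rewrite indicT mul1r.
- move=> B C BC [mB B0] [mC C0]; split; first exact: measurableD.
  transitivity (Ex P (fun w => \1_B w * U w) - Ex P (fun w => \1_C w * U w)); last first.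
    by rewrite B0 C0 subr0.
  rewrite -ExB//; [|exact: i1|exact: i1]; congr Ex; apply/funext => w.
  rewrite -mulrBl; congr (_ * _); rewrite !indicE in_setD.
  have [Cw|Cw] := boolP (w \in C); last by rewrite andbT subr0.
  by rewrite (mem_set (BC _ (set_mem Cw))) /= subrr.
- move=> F ndF DF; split; first by apply: bigcupT_measurable => k; have [] := DF k.
  have mF k : measurable (F k) by have [] := DF k.
  have [_ lim] : L1 P (fun w => \1_(\bigcup_k F k) w * U w) /\
      Ex P (fun w => \1_(F k) w * U w) @[k --> \oo] -->
      Ex P (fun w => \1_(\bigcup_k F k) w * U w).
    apply: (Ex_dominated _ _ (L1_norm iU)) => [k|w|k w].
    - by apply: (L1_measurable (P := P)); exact: i1.
    - apply: cvg_near_cst.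
      have [[k _ Fkw]|Fw] := pselect ((\bigcup_k F k) w).
        have Uw : (\bigcup_k F k) w by exists k.
        near=> m; have km : (k <= m)%N by near: m; exact: nbhs_infty_ge.
        have Fmw : F m w by move: Fkw; apply/subsetPset/ndF.
        by rewrite !indicE (mem_set Fmw) (mem_set Uw).
      by apply: nearW => k; rewrite !indicE !memNset// => Fkw; apply: Fw; exists k.
    - by rewrite normrM ler_piMl// indicE ger0_norm// lern1; case: (_ \in _).
  apply: (cvg_unique _ lim) => //.
  rewrite (_ : (fun k => _) = fun=> 0); first exact: cvg_cst.
  by apply/funext => k; have [] := DF k.
Unshelve. all: by end_near. Qed.

(** Testing with the set where U <= 0 and with its complement gives E |U| = 0. *)
Lemma sigma_upto_unique (U : T -> R) : L1 P U -> sigma_upto [set w | U w <= 0] ->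
  (forall A, sigma_upto A -> Ex P (fun w => \1_A w * U w) = 0) ->
  {ae P, forall w, U w = 0}.
Proof.
move=> iU GU H.
set A := [set w | U w <= 0] in GU *.
have GAC : sigma_upto (~` A) by rewrite -setTD; apply: sigma_algebraCD.
have i1 B : measurable B -> L1 P (fun w => \1_B w * U w).
  move=> mB; under eq_fun do rewrite mulrC.
  apply: (L1M_bounded (C := 1) iU) => [|w]; first exact: measurable_indic.
  by rewrite indicE ger0_norm// lern1; case: (_ \in _).
have mA := sigma_upto_measurable GU; have mAC := sigma_upto_measurable GAC.
have E0 : Ex P (fun w => `|U w|) = 0.
  transitivity (Ex P (fun w => \1_(~` A) w * U w) - Ex P (fun w => \1_A w * U w)).
    rewrite -ExB; [|exact: i1|exact: i1]; congr Ex; apply/funext => w.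
    rewrite !indicE in_setC; have [Aw|Aw] := boolP (w \in A).
      by rewrite mul0r mul1r sub0r ler0_norm//; exact: set_mem Aw.
    rewrite mul0r mul1r subr0 gtr0_norm// ltNge; apply: contra Aw => Uw.
    exact: mem_set.
  by rewrite !H// subr0.
have := Ex_eq0_ae (L1_norm iU) (fun w => normr_ge0 _) E0.
by apply: filterS => w /normr0_eq0.
Qed.

End PiLambda.

Lemma L1_le_ae d (T : measurableType d) (R : realType) (P : probability T R)
    (U V : T -> R) : measurable_fun [set: T] U -> L1 P V ->
  {ae P, forall w, `|U w| <= V w} -> L1 P U.
Proof.
move=> mU iV UV; have mV := L1_measurable iV.
have mN : measurable_fun [set: T] (fun w => `|U w|).
  exact: measurableT_comp (@normr_measurable R setT) mU.
(* The minimum is dominated everywhere and agrees with |U| almost everywhere. *)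
have iW : L1 P (fun w => Num.min `|U w| `|V w|).
  apply: (L1_le _ (L1_norm iV)) => [|w].
    by apply: measurable_minr => //; exact: measurableT_comp (@normr_measurable R setT) mV.
  by rewrite ger0_norm ?ge_min ?lexx ?orbT// le_min !normr_ge0.
have [|iN _] := ae_eq_Ex iW mN.
  by apply: filterS UV => w UVw; apply/min_idPl; exact: le_trans UVw (ler_norm _).
by apply: (L1_le mU iN) => w.
Qed.

Lemma sigma_first_upto d (T : measurableType d) (R : realType)
    (E : normedModType R) (e : nat -> dual E) (X : T -> E) n :
  sigma_first e X n = sigma_upto n (fun i w => ev (e i.+1) (X w)).
Proof.
rewrite /sigma_first /sigma_upto; congr (<<s _ >>).
apply/seteqP; split => A [j /= jn] h.
  exists j.-1; move: jn => /andP[j0 jn]; first by rewrite /= prednK.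
  by move: h; rewrite -{1}(prednK j0).
by exists j.+1.
Qed.

Section ConditionalExpectation.
Context d {T : measurableType d} {R : realType} (P : probability T R).
Context {E : completeNormedModType R}.
Hypothesis hE : separable E.
Variables (f : nat -> dual E) (nf : norming f).
Variables (X : T -> E) (gX : gaussian P X) (e : nat -> dual E).
Implicit Types g h : dual E.

Lemma borel_weakly_measurable (G : set_system T) (Y : T -> E) :
  G `<=` measurable -> borel_measurable G Y -> weakly_measurable Y.
Proof.
move=> Gm bY g _ B mB; rewrite setTI; apply: Gm.
exact: borel_measurable_ev.
Qed.

Let wX : weakly_measurable X.
Proof. by case: gX => bX _; exact: borel_weakly_measurable (@subset_refl _ _) bX. Qed.

Let iX2 : L1 P (fun w => `|X w| ^+ 2). Proof. exact: (norming_sq_integrable nf gX). Qed.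

Let iX : L1 P (fun w => `|X w|).
Proof. by apply: L2_L1; split => //; exact: (weakly_measurable_norm nf). Qed.

Let m := bochner_integral P X.

Let Xc w := X w - m.

Let evm g : ev g m = Ex P (fun w => ev g (X w)).
Proof. by apply: (ev_bochner_integral nf) => //; exact: (L1_bochner_integrable nf). Qed.

Let iev g : L1 P (fun w => ev g (X w)).
Proof.
have [C _ gC] := ev_bounded g.
exact: (L1_le (wX g) (L1Z C iX)).
Qed.

Let gXc : centred_gaussian P Xc. Proof. exact: gaussian_centred. Qed.

Let sXc g : L2 P (fun w => ev g (Xc w)). Proof. exact: centred_gaussian_L2. Qed.

Let wXc : weakly_measurable Xc. Proof. by move=> g; have [] := sXc g. Qed.

Let iXc2 : L1 P (fun w => `|Xc w| ^+ 2).
Proof.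
apply: (@L1_le _ _ _ _ _ (fun w => 2 * `|X w| ^+ 2 + 2 * `|m| ^+ 2)).
- by apply: measurable_funX; exact: (weakly_measurable_norm nf).
- by apply: L1D; [exact: L1Z|exact: L1_cst].
- move=> w; rewrite ger0_norm ?exprn_ge0//.
  have h := ler_normB (X w) m; have h2 := sqr_ge0 (`|X w| - `|m|).
  apply: (@le_trans _ _ ((`|X w| + `|m|) ^+ 2)); last lra.
  by rewrite !expr2 ler_pM.
Qed.

Let sN : L2 P (fun w => `|Xc w|).
Proof. by split => //; exact: (weakly_measurable_norm nf). Qed.

Let e' i := e i.+1.
Let q := covf P Xc.
Let gam := gs P Xc e'.

Let z i w := ev (e' i) (X w).

Let mz i : measurable_fun [set: T] (z i). Proof. exact: wX. Qed.

Section OneConditioning.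
Variables (n : nat) (Y : T -> E).
Hypothesis hY : is_cond_exp P (sigma_first e X n) X Y.

Let bY : borel_measurable (sigma_upto n z) Y.
Proof. by case: hY; rewrite sigma_first_upto. Qed.

Let wY : weakly_measurable Y.
Proof.
apply: borel_weakly_measurable bY; exact: sigma_upto_measurable.
Qed.

Let iY : L1 P (fun w => `|Y w|).
Proof. by apply: (bochner_integrable_L1 nf) => //; case: hY. Qed.

Let ievY g : L1 P (fun w => ev g (Y w)).
Proof.
have [C _ gC] := ev_bounded g.
exact: (L1_le (wY g) (L1Z C iY)).
Qed.

Let cond_ev A g : sigma_upto n z A ->
  Ex P (fun w => \1_A w * ev g (Y w)) = Ex P (fun w => \1_A w * ev g (X w)).
Proof.
move=> GA; have mA := sigma_upto_measurable mz GA.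
have key (Z : T -> E) : weakly_measurable Z -> L1 P (fun w => `|Z w|) ->
    ev g (bochner_integral P (fun w => \1_A w *: Z w)) =
    Ex P (fun w => \1_A w * ev g (Z w)).
  move=> wZ iZ.
  have w1 : weakly_measurable (fun w => (\1_A w : R) *: Z w).
    by apply: weakly_measurableZ => //; exact: measurable_indic.
  rewrite (ev_bochner_integral nf)//.
    by congr Ex; apply/funext => w; rewrite evZ.
  apply: (L1_bochner_integrable nf) => //.
  apply: (L1_le _ iZ); first exact: (weakly_measurable_norm nf).
  move=> w; rewrite normr_id normrZ ler_piMl// indicE ger0_norm// lern1.
  by case: (_ \in _).
have [_ _ /(_ A)] := hY; rewrite sigma_first_upto => /(_ GA).
by move=> /(congr1 (ev g)); rewrite !key.
Qed.

Let res g := residual P Xc n gam g.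

(** The residual is uncorrelated with every combination of the conditioning functionals, so
    [centred_orthogonal] annihilates its product with their cosines and sines. [trig_uniqueness],
    comparing the weight [res g] with the weight 0, passes to products of half-lines, and the
    pi-lambda argument to the sigma-algebra. *)
Let res_orth g A : sigma_upto n z A ->
  Ex P (fun w => \1_A w * ev (res g) (Xc w)) = 0.
Proof.
apply: (sigma_upto_orthogonal mz (L2_L1 (sXc (res g)))) => a.
(* Centring a coordinate only shifts its level. *)
pose zc i w := ev (e' i) (Xc w).
have prodE w : \prod_(0 <= i < n) ((z i w <= a i)%R%:R : R) =
    \prod_(0 <= i < n) (zc i w <= a i - ev (e' i) m)%R%:R.
  by apply: eq_bigr => i _; rewrite /zc /Xc evB lerD2r.
under eq_fun do rewrite prodE.
have i0 : L1 P (fun=> 0) by exact: L1_cst.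
rewrite (@trig_uniqueness _ _ _ P n zc zc _ (fun=> 0) (L2_L1 (sXc (res g))) i0).
- by rewrite -[RHS](Ex_cst P); congr Ex; apply/funext => w; rewrite mul0r.
- by move=> i; exact: wXc.
- by move=> i; exact: wXc.
move=> t; have zE w : \sum_(0 <= i < n) t i * zc i w = ev (dual_sum n t e') (Xc w).
  by rewrite ev_dual_sum.
have orth : Ex P (fun w => ev (res g) (Xc w) * ev (dual_sum n t e') (Xc w)) = 0.
  rewrite -/(covf P Xc _ _) covfC covf_sum// big_nat_cond big1// => i.
  by move=> /andP[/andP[_ i_n] _]; rewrite covfC /res residual_e// mulr0.
have [c0 s0] := centred_orthogonal gXc orth.
have Z0 (k : R -> R) : Ex P (fun w => 0 * k (\sum_(0 <= i < n) t i * zc i w)) = 0.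
  by rewrite -[RHS](Ex_cst P); congr Ex; apply/funext => w; rewrite mul0r.
split; first by rewrite (Z0 cos) -[RHS]c0; congr Ex; apply/funext => w; rewrite zE.
by rewrite (Z0 sin) -[RHS]s0; congr Ex; apply/funext => w; rewrite zE.
Qed.

(** Both sides are measurable for the conditioning sigma-algebra and have the same integral over
    each of its sets: the residual integrates to 0 there by [res_orth]. *)
Lemma cond_exp_projection g : {ae P, forall w,
  ev g (Y w) = ev g m + \sum_(0 <= k < n) q g (gam k) * ev (gam k) (Xc w)}.
Proof.
pose pr w := ev g m + \sum_(0 <= k < n) q g (gam k) * ev (gam k) (Xc w).
have resE w : ev (res g) (Xc w) = ev g (X w) - pr w.
  by rewrite /res ev_residual /pr {1}/Xc evB opprD addrA.
have iXc h : L1 P (fun w => ev h (Xc w)) by exact: L2_L1.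
have ipr : L1 P pr.
  by apply: L1D; [exact: L1_cst|apply: L1_sum => k _; exact: L1Z].
pose U w := ev g (Y w) - pr w.
have iU : L1 P U by exact: L1B.
suff : {ae P, forall w, U w = 0}.
  by apply: filterS => w /eqP; rewrite subr_eq0 => /eqP.
apply: (sigma_upto_unique mz iU).
  (* [S] is [T] with the conditioning sigma-algebra as its measurable structure, so that the usual
     closure properties of measurable functions apply to it. *)
  pose G0 : set_system T := \bigcup_(j in [set j | (j < n)%N])
        preimage_set_system [set: T] (z j) measurable.
  pose S := g_sigma_algebraType G0.
  have mYS : measurable_fun [set: S] (fun w => ev g (Y w)).
    by move=> _ B mB; rewrite setTI; exact: (borel_measurable_ev g bY mB).
  have mzS i : (i < n)%N -> measurable_fun [set: S] (z i).
    by move=> i_n _ B mB; rewrite setTI; exact: sigma_upto_preimage.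
  have mgS k : (k < n)%N -> measurable_fun [set: S] (fun w => ev (gam k) (Xc w)).
    move=> kn; have [t tE] := gs_span P Xc e' k.
    rewrite (_ : (fun w => _) = fun w =>
        \sum_(i < k.+1) t i * (z i w - ev (e' i) m)).
      apply: measurable_sum => i; apply: measurable_funM => //.
      apply: measurable_funB => //; apply: mzS; exact: leq_trans (ltn_ord i) kn.
    apply/funext => w; rewrite tE big_mkord; apply: eq_bigr => i _.
    by rewrite /Xc evB.
  have mprS : measurable_fun [set: S] pr.
    apply: measurable_funD => //.
    rewrite (_ : (fun w => _) = fun w : S =>
        \sum_(k < n) q g (gam k) * ev (gam k) (Xc w)).
      by apply: measurable_sum => k; apply: measurable_funM => //; exact: mgS.
    by apply/funext => w; rewrite big_mkord.
  have mUS : measurable_fun [set: S] U by exact: measurable_funB.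
  have := @measurable_fun_le _ S R [set: S] U (fun=> 0) measurableT mUS
    (measurable_cst _).
  by rewrite setTI; exact.
move=> A GA.
have mA := sigma_upto_measurable mz GA.
have i1 (B : T -> R) : L1 P B -> L1 P (fun w => \1_A w * B w).
  move=> iB; under eq_fun do rewrite mulrC.
  apply: (L1M_bounded (C := 1) iB) => [|w]; first exact: measurable_indic.
  by rewrite indicE ger0_norm// lern1; case: (_ \in _).
transitivity (Ex P (fun w => \1_A w * ev g (Y w)) -
    Ex P (fun w => \1_A w * ev g (X w)) + Ex P (fun w => \1_A w * ev (res g) (Xc w))).
  rewrite -ExB; [|exact: i1|exact: i1].
  rewrite -ExD; [|by apply: L1B; exact: i1|exact: i1].
  by congr Ex; apply/funext => w; rewrite resE /U; ring.
by rewrite res_orth// addr0 cond_ev// subrr.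
Qed.

Let mY := bochner_integral P Y.

Let evmY g : ev g mY = ev g m.
Proof.
rewrite /mY (ev_bochner_integral nf)//; last by case: hY.
have GT : sigma_upto n z setT.
  by rewrite -setC0 -setTD; apply: sigma_algebraCD; exact: sigma_algebra0.
have := cond_ev g GT; under eq_fun do rewrite indicT mul1r.
by under [in X in _ = X -> _]eq_fun do rewrite indicT mul1r; rewrite evm.
Qed.

Let Yc w := Y w - mY.

Let Yc_ae g : {ae P, forall w,
  ev g (Yc w) = ev (dual_sum n (fun k => q g (gam k)) gam) (Xc w)}.
Proof.
apply: filterS (cond_exp_projection g) => w h.
by rewrite /Yc evB evmY h ev_dual_sum; ring.
Qed.

(** A square integrable majorant of |Yc|. The coefficients Cov(f_j(X), xi_k) are at most E (|Xc|
    |xi_k|) uniformly in j, so that the norm of the projection is controlled without writing its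
    coefficients as vectors of [E]. *)
Let B w := \sum_(0 <= k < n) Ex P (fun w => `|Xc w| * `|ev (gam k) (Xc w)|) *
                             `|ev (gam k) (Xc w)|.

Let sabs g : L2 P (fun w => `|ev g (Xc w)|).
Proof.
split; first exact: measurableT_comp (@normr_measurable R setT) (wXc g).
by under eq_fun do rewrite real_normK ?num_real//; have [] := sXc g.
Qed.

Let sB : L2 P B.
Proof.
rewrite /B; elim: (n) => [|k IH].
  rewrite (_ : (fun w => _) = fun=> 0); last by apply/funext => w; rewrite big_nil.
  by apply: (@L2_bounded _ _ _ _ _ 0) => // w; rewrite normr0.
have := L2_comb 1 (Ex P (fun w => `|Xc w| * `|ev (gam k) (Xc w)|)) IH (sabs (gam k)).
congr (L2 P _); apply/funext => w.
by rewrite big_nat_recr//= mul1r.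
Qed.

Let Yc_le : {ae P, forall w, `|Yc w| <= B w}.
Proof.
have := ae_foralln (fun j => Yc_ae (f j)).
apply: filterS => w h; apply: (norming_leP _ _ nf).2 => j; rewrite h ev_dual_sum.
apply: ler_sum => k _; apply: le_trans (ler_norm _) _; rewrite normrM ler_wpM2r//.
apply: Ex_norm_le => [||w']; [exact: L2_prod|exact: L2_prod|].
by rewrite normrM ler_wpM2r//; exact: nf.1.
Qed.

(** Evaluating the difference of the covariances on g twice yields the variance of the residual;
    this is what turns an operator norm bound into a bound on tails of squared coefficients. *)
Lemma ev_cov_diff g : (forall x, `|ev g x| <= `|x|) ->
  ev g (cov P X g - cov P Y g) = q g g - \sum_(0 <= k < n) q g (gam k) ^+ 2.
Proof.
move=> g1; rewrite evB; congr (_ - _).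
  rewrite /cov -/m (ev_bochner_integral nf); first last.
  - apply: (L1_bochner_integrable nf) => //; first exact: (weakly_measurableZ (wXc g) wXc).
    apply: (L1_le _ iXc2).
      by apply: (weakly_measurable_norm nf) => //; exact: (weakly_measurableZ (wXc g) wXc).
    move=> w; rewrite normr_id normrZ expr2 ler_wpM2r//; exact: g1.
  - exact: (weakly_measurableZ (wXc g) wXc).
  by congr Ex; apply/funext => w; rewrite evZ.
have wYc : weakly_measurable Yc.
  by apply: weakly_measurableB => //; exact: weakly_measurable_cst.
rewrite /cov -/mY (ev_bochner_integral nf); first last.
- apply: (L1_bochner_integrable nf) => //; first exact: (weakly_measurableZ (wYc g) wYc).
  apply: (L1_le_ae _ sB.2).
    by apply: (weakly_measurable_norm nf) => //; exact: (weakly_measurableZ (wYc g) wYc).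
  apply: filterS Yc_le => w h; rewrite normr_id normrZ expr2 ler_pM//.
  exact: le_trans (g1 _) h.
- exact: (weakly_measurableZ (wYc g) wYc).
pose p := dual_sum n (fun k => q g (gam k)) gam.
transitivity (covf P Xc p p).
  apply/esym; apply: (ae_eq_Ex _ _ _).2.
  - exact: L2_prod.
  - under eq_fun do rewrite evZ.
    exact: (measurable_funM (wYc g) (wYc g)).
  - by apply: filterS (Yc_ae g) => w h; rewrite evZ -[dual_fun _ _]/(ev g (Yc w)) h.
rewrite {1}/p covf_sum//; apply: eq_big_nat => k /andP[_ kn].
rewrite expr2; congr (_ * _); rewrite covfC.
have := residual_gs sXc e' g kn; rewrite /residual covf_comb// mul1r mulN1r.
by move/eqP; rewrite subr_eq0 => /eqP <-.
Qed.

Lemma cond_exp_residual g :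
  L1 P (fun w => (ev g (X w) - ev g (Y w)) ^+ 2) /\
  Ex P (fun w => (ev g (X w) - ev g (Y w)) ^+ 2) =
    q g g - \sum_(0 <= k < n) q g (gam k) ^+ 2.
Proof.
have [|||i ei] := @ae_eq_Ex _ _ _ P (fun w => ev (res g) (Xc w) ^+ 2)
    (fun w => (ev g (X w) - ev g (Y w)) ^+ 2).
- by have [] := sXc (res g).
- by apply: measurable_funX; apply: measurable_funB; [exact: wX|exact: wY].
- apply: filterS (cond_exp_projection g) => w ->.
  by rewrite /res ev_residual {1}/Xc evB; congr (_ ^+ 2); ring.
by split => //; rewrite -ei /q -residual_norm.
Qed.

End OneConditioning.

(** A degenerate coordinate vanishes almost everywhere and contributes exp 0 = 1; otherwise the
    variance 1 forces a = 1/2. *)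
Lemma gs_exp_moment k : L1 P (fun w => expR (2 / 5 * ev (gam k) (Xc w) ^+ 2)) /\
  Ex P (fun w => expR (2 / 5 * ev (gam k) (Xc w) ^+ 2)) <= 13 / 5.
Proof.
have [mg [a a0 ga]] := gXc (gam k).
have [i2 e2] := gauss_even_moment mg a0 (fun t => (ga t).1) 1.
have qE : q (gam k) (gam k) = 2 * a.
  transitivity (Ex P (fun w => ev (gam k) (Xc w) ^+ 1.*2)).
    by congr Ex; apply/funext => w; rewrite (_ : 1.*2 = 2)%N// expr2.
  by rewrite e2 (_ : 1.*2`! = 2)%N// (_ : 1`! = 1)%N// expr1 divr1.
have [q0|q1] := gs_norm sXc e' k.
  have q0' : Ex P (fun w => ev (gam k) (Xc w) ^+ 2) = 0.
    by rewrite -[RHS]q0; congr Ex; apply/funext => w; rewrite expr2.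
  have [|||i ei] := @ae_eq_Ex _ _ _ P (fun=> 1)
      (fun w => expR (2 / 5 * ev (gam k) (Xc w) ^+ 2)).
  - exact: L1_cst.
  - by apply: measurableT_comp => //; apply: measurable_funM => //; exact: measurable_funX.
  - have := Ex_eq0_ae (sXc (gam k)).2 (fun w => sqr_ge0 _) q0'.
    by apply: filterS => w ->; rewrite mulr0 expR0.
  by split => //; rewrite -ei Ex_cst; lra.
apply: gauss_exp_moment => // t; rewrite (ga t).1.
have -> : a = 2^-1; last by [].
by have := q1; rewrite -/gam -/q qE; lra.
Qed.

(** Measurability aside, the tail estimate uses the Gaussian structure only through these four
    facts. In the construction t j k is Cov(f_j(X), xi_k), V j is the variance of f_j(X) and a j its
    expectation. *)
Lemma gaussian_expansion (Xn : nat -> T -> E) :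
  (forall n, (1 <= n)%N -> is_cond_exp P (sigma_first e X n) X (Xn n)) ->
  exists (xi : nat -> T -> R) (t : nat -> nat -> R) (V a : nat -> R),
  [/\ forall k, measurable_fun [set: T] (xi k) /\
        L1 P (fun w => expR (2 / 5 * xi k w ^+ 2)) /\
        Ex P (fun w => expR (2 / 5 * xi k w ^+ 2)) <= 13 / 5,
      forall j n, (1 <= n)%N -> {ae P, forall w,
        ev (f j) (Xn n w) = a j + \sum_(0 <= k < n) t j k * xi k w},
      forall j n, (1 <= n)%N ->
        L1 P (fun w => (ev (f j) (X w) - ev (f j) (Xn n w)) ^+ 2) /\
        Ex P (fun w => (ev (f j) (X w) - ev (f j) (Xn n w)) ^+ 2) =
          V j - \sum_(0 <= k < n) t j k ^+ 2
    & forall j n, (1 <= n)%N ->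
        ev (f j) (cov P X (f j) - cov P (Xn n) (f j)) =
          V j - \sum_(0 <= k < n) t j k ^+ 2].
Proof.
move=> hXn; exists (fun k w => ev (gam k) (Xc w)), (fun j k => q (f j) (gam k)).
exists (fun j => q (f j) (f j)), (fun j => ev (f j) m); split.
- by move=> k; split; [exact: wXc|exact: gs_exp_moment].
- by move=> j n n1; exact: cond_exp_projection (hXn n n1) (f j).
- by move=> j n n1; exact: cond_exp_residual (hXn n n1) (f j).
- by move=> j n n1; apply: (ev_cov_diff (hXn n n1)); exact: nf.1.
Qed.

Lemma cond_exp_weakly_measurable n Y :
  is_cond_exp P (sigma_first e X n) X Y -> weakly_measurable Y.
Proof.
rewrite sigma_first_upto => -[bY _ _].
apply: borel_weakly_measurable bY; exact: sigma_upto_measurable.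
Qed.

Lemma gaussian_weakly_measurable : weakly_measurable X.
Proof. exact: wX. Qed.

End ConditionalExpectation.

(** * The tail estimate *)

Section SummationByParts.
Context {R : realFieldType}.
Variables (c sg t : nat -> R) (m : nat).
Hypothesis sg_gt0 : forall k, (m <= k)%N -> 0 < sg k.
Hypothesis sg_decr : forall k, (m <= k)%N -> sg k.+1 <= sg k.
Hypothesis c_sg : forall k, (m <= k)%N -> c k = c k.+1 + sg k ^+ 2.

(* The constraints on the tails of [t k ^+ 2] are tight for [t = sg]. *)
Lemma summation_by_parts N : (m <= N)%N ->
  (forall i, (m <= i <= N)%N -> \sum_(i <= k < N.+1) t k ^+ 2 <= c i) ->
  \sum_(m <= k < N.+1) t k ^+ 2 / sg k <=
    \sum_(m <= k < N.+1) sg k + c N.+1 / sg N.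
Proof.
move=> mN H.
(* Downward induction on the starting index. The slack of the constraint at i, divided by sg i, is
   kept in the statement: the step exchanges it for the slack at i+1, whose denominator is
   smaller. *)
suff key l i : (m <= i)%N -> (i + l = N)%N ->
    \sum_(i <= k < N.+1) t k ^+ 2 / sg k <= \sum_(i <= k < N.+1) sg k +
      c N.+1 / sg N - (c i - \sum_(i <= k < N.+1) t k ^+ 2) / sg i.
  apply: (le_trans (key (N - m)%N m (leqnn m) (subnKC mN))).
  rewrite gerBl; apply: divr_ge0; last by apply/ltW/sg_gt0.
  by rewrite subr_ge0 H// leqnn.
elim: l i => [|l IH] i mi iN.
  move: iN; rewrite addn0 => <-; rewrite !big_nat1 (c_sg mi); have := sg_gt0 mi => s0.
  rewrite le_eqVlt; apply/orP; left; apply/eqP; field.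
  by rewrite gt_eqF.
have i_N : (i < N)%N by rewrite -iN addnS ltnS leq_addr.
have i_N1 : (i < N.+1)%N by exact: ltnW.
rewrite !(big_ltn i_N1) (c_sg mi).
have {IH} := IH i.+1 (leqW mi); rewrite addSnnS => /(_ iN).
have A0 : \sum_(i.+1 <= k < N.+1) t k ^+ 2 <= c i.+1 by rewrite H// (leqW mi).
set A := \sum_(i.+1 <= k < N.+1) t k ^+ 2 in A0 *.
set B := \sum_(i.+1 <= k < N.+1) _ / _; set S := \sum_(i.+1 <= k < N.+1) sg k.
set L := c N.+1 / sg N => IH.
have s0 := sg_gt0 mi; have s1 := sg_gt0 (leqW mi).
have h : (c i.+1 - A) / sg i <= (c i.+1 - A) / sg i.+1.
  by rewrite ler_wpM2l ?subr_ge0// lef_pV2 ?posrE// sg_decr.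
have -> : sg i + S + L - (c i.+1 + sg i ^+ 2 - (t i ^+ 2 + A)) / sg i =
    S + L - (c i.+1 - A) / sg i + t i ^+ 2 / sg i.
  by field; rewrite gt_eqF.
lra.
Qed.

End SummationByParts.

Section WeightedChiSquare.
Context d {T : measurableType d} {R : realType} (P : probability T R).
Variables (xi : nat -> T -> R) (sg : nat -> R) (S : R).
Hypothesis xiP : forall k, measurable_fun [set: T] (xi k) /\
        L1 P (fun w => expR (2 / 5 * xi k w ^+ 2)) /\
        Ex P (fun w => expR (2 / 5 * xi k w ^+ 2)) <= 13 / 5.
Hypothesis sg_ge0 : forall k, 0 <= sg k.
Hypothesis S_gt0 : 0 < S.

Let Q n N w := \sum_(n <= k < N) sg k * xi k w ^+ 2.

Lemma measurable_chi n N : measurable_fun [set: T] (Q n N).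
Proof.
apply: measurable_sum => k; apply: measurable_funM => //; apply: measurable_funX.
by have [] := xiP k.
Qed.

(* Jensen's inequality for exp, from the tangent at the barycentre; the missing
   mass 1 - sum p is put at the origin. *)
Lemma expR_jensen n N (p y : nat -> R) : (forall k, 0 <= p k) ->
  \sum_(n <= k < N) p k <= 1 ->
  expR (\sum_(n <= k < N) p k * y k) <=
    \sum_(n <= k < N) p k * expR (y k) + (1 - \sum_(n <= k < N) p k).
Proof.
move=> p0 p1; set b := \sum_(n <= k < N) p k * y k; set s := \sum_(n <= k < N) p k.
have tan u : expR b * (1 + (u - b)) <= expR u.
  rewrite -{2}(subrK b u) expRD mulrC ler_wpM2r ?expR_ge0//; exact: expR_ge1Dx.
have h1 : expR b * (s - s * b + b) <= \sum_(n <= k < N) p k * expR (y k).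
  have -> : s - s * b + b = \sum_(n <= k < N) p k * (1 + (y k - b)).
    rewrite /s /b mulr_suml -sumrB -big_split/=; apply: eq_bigr => k _; ring.
  rewrite mulr_sumr; apply: ler_sum => k _; rewrite mulrCA ler_wpM2l//.
have h2 : expR b * ((1 - s) * (1 - b)) <= 1 - s.
  rewrite mulrCA -[leRHS]mulr1 ler_wpM2l ?subr_ge0//.
  by have := tan 0; rewrite sub0r expR0.
have -> : expR b = expR b * (s - s * b + b) + expR b * ((1 - s) * (1 - b)) by ring.
exact: lerD.
Qed.

(** Exponential Markov inequality, with the Jensen majorant [J] of exp (2 Q / (5 S)). The mass
    missing from the weights sg k / S contributes the value 1, which is also below 13/5. *)
Lemma chi_tail n N K : \sum_(n <= k < N) sg k <= S ->
  Ex P (fun w => 1 - (Q n N w <= K * S)%R%:R) <= 13 / 5 * expR (- (2 / 5 * K)).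
Proof.
move=> sS; pose p k := sg k / S.
have p0 k : 0 <= p k by rewrite divr_ge0// ltW.
have p1 : \sum_(n <= k < N) p k <= 1 by rewrite -mulr_suml ler_pdivrMr// mul1r.
pose J w := \sum_(n <= k < N) p k * expR (2 / 5 * xi k w ^+ 2) +
  (1 - \sum_(n <= k < N) p k).
have ik k : L1 P (fun w => p k * expR (2 / 5 * xi k w ^+ 2)).
  by apply: L1Z; have [_ []] := xiP k.
have iJ : L1 P J by apply: L1D; [exact: L1_sum|exact: L1_cst].
have EJ : Ex P J <= 13 / 5.
  rewrite /J ExD; [|exact: L1_sum|exact: L1_cst].
  rewrite Ex_sum// Ex_cst.
  apply: (@le_trans _ _ (\sum_(n <= k < N) p k * (13 / 5) + (1 - \sum_(n <= k < N) p k))).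
    rewrite lerD2r; apply: ler_sum => k _; have [_ [i1 e1]] := xiP k.
    by rewrite ExZ// ler_wpM2l.
  by rewrite -mulr_suml; lra.
apply: (@le_trans _ _ (Ex P (fun w => expR (- (2 / 5 * K)) * J w))); last first.
  by rewrite ExZ// mulrC ler_wpM2r// expR_ge0.
apply: Ex_le; [|exact: L1Z|move=> w].
  apply: L1B; first exact: L1_cst.
  apply: (@L1_bounded _ _ _ _ _ 1) => [|w]; last exact: cut_norm_le1.
  by apply: measurable_cut; exact: measurable_chi.
have J1 : expR (2 / 5 * (Q n N w / S)) <= J w.
  have -> : 2 / 5 * (Q n N w / S) = \sum_(n <= k < N) p k * (2 / 5 * xi k w ^+ 2).
    rewrite /Q mulr_suml mulr_sumr; apply: eq_bigr => k _; rewrite /p; ring.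
  exact: expR_jensen.
have J0 : 0 <= J w by exact: le_trans (expR_ge0 _) J1.
have [h|h] := leP (Q n N w) (K * S).
  by rewrite mulr1n subrr mulr_ge0// expR_ge0.
rewrite mulr0n subr0.
apply: (@le_trans _ _ (expR (- (2 / 5 * K)) * expR (2 / 5 * (Q n N w / S)))).
  rewrite -expRD -[leLHS]expR0 ler_expR.
  have : K <= Q n N w / S by rewrite ler_pdivlMr// ltW.
  lra.
by rewrite ler_wpM2l// expR_ge0.
Qed.

(** The bound of [chi_tail] is uniform in N and the partial sums increase, so it passes to the
    intersection of the decreasing events. *)
Lemma chi_all n K : (forall N, \sum_(n <= k < N) sg k <= S) ->
  1 - 13 / 5 * expR (- (2 / 5 * K)) <= Ex P (fun w => `[< forall N, Q n N w <= K * S >]%:R) /\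
  measurable_fun [set: T] (fun w => `[< forall N, Q n N w <= K * S >]%:R : R).
Proof.
move=> sS.
have mc N : measurable_fun [set: T] (fun w => (Q n N w <= K * S)%R%:R : R).
  by apply: measurable_cut; exact: measurable_chi.
have ic N : L1 P (fun w => (Q n N w <= K * S)%R%:R).
  by apply: (@L1_bounded _ _ _ _ _ 1) => // w; exact: cut_norm_le1.
have lim w : (Q n N w <= K * S)%R%:R @[N --> \oo] -->
    (`[< forall N, Q n N w <= K * S >]%:R : R).
  have [h|h] := pselect (forall N, Q n N w <= K * S).
    rewrite asboolT// (_ : (fun N => _) = fun=> 1); first exact: cvg_cst.
    by apply/funext => N; rewrite h.
  rewrite asboolF//; apply: cvg_near_cst.
  move/existsNP : h => [N0 /negP]; rewrite -ltNge => h.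
  near=> N; have N0N : (N0 <= N)%N by near: N; exact: nbhs_infty_ge.
  suff -> : (Q n N w <= K * S) = false by [].
  apply/negbTE; rewrite -ltNge; apply: lt_le_trans h _.
  have QS M : Q n M w <= Q n M.+1 w.
    rewrite /Q; have [nM|Mn] := leqP n M.
      by rewrite big_nat_recr//= lerDl mulr_ge0// sqr_ge0.
    by rewrite !big_geq//; exact: ltnW.
  rewrite -(subnK N0N); elim: (N - N0)%N => [//|l IH].
  by rewrite addSn; exact: le_trans IH (QS _).
have [iA EA] := Ex_dominated mc lim (L1_cst P 1) (fun N w => cut_norm_le1 _ _).
split; last exact: L1_measurable iA.
apply: (cvgr_to_ge EA); apply: nearW => N.
have := chi_tail K (sS N); rewrite ExB//; last exact: L1_cst.
by rewrite Ex_cst; lra.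
Unshelve. all: by end_near. Qed.

End WeightedChiSquare.

(** By monotone convergence the sum of the U_k has finite expectation, so it is finite almost
    everywhere. This gives convergence of f(X^(N)) to f(X) along the whole sequence, directly from
    mean squares. *)
Lemma ae_cvg0_summable d (T : measurableType d) (R : realType)
    (P : probability T R) (U : nat -> T -> R) (C : R) :
  (forall k, L1 P (U k)) -> (forall k w, 0 <= U k w) ->
  (forall N, \sum_(0 <= k < N) Ex P (U k) <= C) ->
  {ae P, forall w, U k w @[k --> \oo] --> (0 : R)}.
Proof.
move=> iU U0 UC.
pose F w := (\sum_(k <oo) (U k w)%:E)%E.
have mUk k : measurable_fun [set: T] (fun w => (U k w)%:E).
  by apply/measurable_EFinP; exact: L1_measurable (iU k).
have mF : measurable_fun [set: T] F.
  by apply: ge0_emeasurable_sum => // k w _ _; rewrite lee_fin.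
have F0 w : (0 <= F w)%E by apply: nneseries_ge0 => k _ _; rewrite lee_fin.
have iF : P.-integrable [set: T] F.
  apply/integrableP; split => //.
  under eq_integral do rewrite gee0_abs//.
  rewrite /F integral_nneseries//; last by move=> k w _; rewrite lee_fin.
  apply: le_lt_trans (ltry C); apply: lime_le.
    by apply: is_cvg_nneseries => k _ _; apply: integral_ge0 => w _; rewrite lee_fin.
  apply: nearW => N; under eq_bigr do rewrite -ExE//.
  by rewrite sumEFin lee_fin.
apply: filterS (integrable_ae measurableT iF) => w /(_ I) Fw.
apply: cvg_series_cvg_0; apply: nondecreasing_is_cvgn.
  by apply/nondecreasing_seqP => N; rewrite seriesSr lerDl.
exists (fine (F w)) => _ [N _ <-].
rewrite -lee_fin fineK// /series/= -sumEFin.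
by apply: nneseries_lim_ge => k _ _; rewrite lee_fin.
Qed.

(** From e >= (1 + 1/12)^12, which is about 2.613. *)
Lemma expR1_gt (R : realType) : 13 / 5 < expR 1 :> R.
Proof.
have h : 13 / 12 <= expR (1 / 12) :> R.
  by apply: le_trans (expR_ge1Dx _); lra.
have -> : expR 1 = expR (1 / 12) ^+ 12 :> R.
  by rewrite -expRM_natl; congr expR; field.
apply: (@lt_le_trans _ _ ((13 / 12) ^+ 12)); last by apply: lerXn2r; rewrite ?nnegrE ?expR_ge0.
by rewrite expr_div_n ltr_pdivlMr ?exprn_gt0//; lra.
Qed.

Lemma nneseries_bounded (R : realType) (u : nat -> R) m : (forall j, 0 <= u j) ->
  (\sum_(m <= j <oo) (u j)%:E < +oo)%E ->
  exists C, forall N, \sum_(m <= j < N) u j <= C.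
Proof.
move=> u0 uoo; exists (fine (\sum_(m <= j <oo) (u j)%:E)%E) => N.
rewrite -lee_fin fineK; last first.
  by rewrite ge0_fin_numE//; apply: nneseries_ge0 => j _ _; rewrite lee_fin.
by rewrite -sumEFin; apply: nneseries_lim_ge => j _ _; rewrite lee_fin.
Qed.

Section Increments.
Context {R : realType}.
Variable c : nat -> R.
Hypothesis c_pos : forall j, (1 <= j)%N -> 0 < c j.
Hypothesis c_l1 : (\sum_(1 <= j <oo) (`|c j|)%:E < +oo)%E.
Hypothesis dc_decr : forall i j, (2 <= i)%N -> (i <= j)%N ->
  c j.-1 - c j <= c i.-1 - c i.

(* A non-positive increment would be followed by non-positive increments only, and
   then c would be bounded from below by a positive constant. *)
Lemma increment_gt0 j : (2 <= j)%N -> 0 < c j.-1 - c j.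
Proof.
move=> j2; rewrite ltNge; apply/negP => cj.
have cge i : (j <= i)%N -> c j <= c i.
  move=> ji; rewrite -(subnKC ji); elim: (i - j)%N => [|l IH]; first by rewrite addn0.
  have := dc_decr j2 (leq_addr l.+1 j); rewrite addnS /=; lra.
have [C hC] := nneseries_bounded (fun j => normr_ge0 (c j)) c_l1.
have cj0 : 0 < c j by apply: c_pos; exact: ltnW.
have lin l : l%:R * c j <= C.
  apply: le_trans (hC (j + l)%N); rewrite (big_cat_nat (n := j)) ?leq_addr//=; last exact: ltnW.
  rewrite -[leLHS]add0r lerD ?sumr_ge0//.
  rewrite mulr_natl -{1}(addKn j l) -sumr_const_nat; apply: ler_sum_nat => i /andP[ji _].
  by apply: le_trans (ler_norm _); exact: cge.
have C0 : 0 <= C by have := lin 0%N; rewrite mul0r.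
have := lin (Num.bound (C / c j)).
have : C / c j < (Num.bound (C / c j))%:R by apply: archi_boundP; rewrite divr_ge0// ltW.
by rewrite ltr_pdivrMr// => /lt_le_trans h /h; rewrite ltxx.
Qed.

End Increments.

Theorem theorem3p3 (d : measure_display) (T : measurableType d) (R : realType)
    (P : probability T R) (E : completeNormedModType R) (hE : separable E)
    (X : T -> E) (hX : gaussian P X)
    (e : nat -> dual E)
    (Xn : nat -> T -> E)
    (hXn : forall n, (1 <= n)%N -> is_cond_exp P (sigma_first e X n) X (Xn n))
    (c : nat -> R)
    (c_pos : forall j, (1 <= j)%N -> 0 < c j)
    (c_decr : forall i j, (1 <= i)%N -> (i <= j)%N -> c j <= c i)
    (c_l1 : (\sum_(1 <= j <oo) (`|c j|)%:E < +oo)%E)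
    (c_cov : forall n, (1 <= n)%N ->
       (dual_opnorm (fun f => (cov P X f - cov P (Xn n) f)%R) <= (c n)%:E)%E)
    (dc_decr : forall i j, (2 <= i)%N -> (i <= j)%N ->
       c j.-1 - c j <= c i.-1 - c i)
    (dc_sum : (\sum_(2 <= j <oo) (Num.sqrt (c j.-1 - c j)%R)%:E < +oo)%E)
    (dc_lim : c j / Num.sqrt (c j.-1 - c j) @[j --> \oo] --> 0)
    (n : nat) (hn : (1 <= n)%N) (tau : R) (htau : 0 < tau) :
  ((1 - expR (- tau))%R%:E <
   P [set w | (`|X w - Xn n w| <=
               Num.sqrt (5 * Num.max 1 tau) *
               limn (fun N => \sum_(n.+1 <= j < N) Num.sqrt (c j.-1 - c j)))%R])%E.
Proof.
have [f nf] : exists f : nat -> dual E, norming f by exact: separable_norming.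
have [xi [t [V [a [xiP projE resE covE]]]]] := gaussian_expansion hE nf hX hXn.
(* Index shift: coordinates are numbered from 0 and functionals from 1, so that coordinate k carries
   the increment from c_k to c_(k+1), and k >= n corresponds to j >= n + 1. *)
pose sg k := Num.sqrt (c k - c k.+1).
have sg_gt0 k : (1 <= k)%N -> 0 < sg k.
  by move=> k1; rewrite sqrtr_gt0; apply: (increment_gt0 c_pos c_l1 dc_decr (j := k.+1)).
have sg_ge0 k : 0 <= sg k by exact: sqrtr_ge0.
have sg_decr k : (1 <= k)%N -> sg k.+1 <= sg k.
  by move=> k1; apply: ler_wsqrtr; apply: (dc_decr k.+1 k.+2).
have c_sg k : (1 <= k)%N -> c k = c k.+1 + sg k ^+ 2.
  move=> k1; rewrite sqr_sqrtr; first by rewrite addrC subrK.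
  by apply/ltW; apply: (increment_gt0 c_pos c_l1 dc_decr (j := k.+1)).
set S := limn _.
have partialE N : \sum_(n.+1 <= j < N.+1) Num.sqrt (c j.-1 - c j) = \sum_(n <= k < N) sg k.
  by rewrite big_add1.
have nd : nondecreasing_seq (fun N => \sum_(n.+1 <= j < N) Num.sqrt (c j.-1 - c j)).
  apply/nondecreasing_seqP => N; have [nN|Nn] := leqP n.+1 N.
    by rewrite big_nat_recr//= lerDl sqrtr_ge0.
  by rewrite [leLHS](big_geq (ltnW Nn)) sumr_ge0// => ? _; exact: sqrtr_ge0.
have cvS : cvgn (fun N => \sum_(n.+1 <= j < N) Num.sqrt (c j.-1 - c j)).
  apply: nondecreasing_is_cvgn => //.
  have [C hC] := nneseries_bounded (fun j => sqrtr_ge0 (c j.-1 - c j)) dc_sum.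
  exists C => _ [N _ <-]; apply: le_trans (hC N).
  have [nN|Nn] := leqP n.+1 N; last first.
    by rewrite [leLHS](big_geq (ltnW Nn)) sumr_ge0// => ? _; exact: sqrtr_ge0.
  rewrite [leRHS](big_cat_nat (n := n.+1))//=.
  by rewrite lerDr sumr_ge0// => ? _; exact: sqrtr_ge0.
have sS N : \sum_(n <= k < N) sg k <= S.
  by rewrite -partialE; exact: nondecreasing_cvgn_le nd cvS N.+1.
have S0 : 0 < S by apply: lt_le_trans (sS n.+1); rewrite big_nat1 sg_gt0.
set M := Num.max 1 tau; have M1 : 1 <= M by rewrite le_max lexx.
have Mtau : tau <= M by rewrite le_max lexx orbT.
(* Level of the exponential Markov inequality, chosen so that the exponent 2/5 K is 2 M. *)
set K := 5 * M; have K0 : 0 < K by rewrite /K; lra.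
set L := Num.sqrt K; have L0 : 0 < L by rewrite sqrtr_gt0.
have LL : L * L = K by rewrite -expr2 sqr_sqrtr// ltW.
(* The operator bound is applied to f_j, of dual norm at most 1, and the resulting vector is tested
   with f_j again. *)
have tail j N : (1 <= N)%N -> V j - \sum_(0 <= k < N) t j k ^+ 2 <= c N.
  move=> N1; rewrite -covE//.
  have fj1 : (dual_norm (f j) <= 1)%E.
    apply: ge_ereal_sup => _ [x /= x1 <-]; rewrite lee_fin.
    by apply: le_trans x1; exact: nf.1.
  apply: le_trans (ler_norm _) (le_trans (nf.1 _ _) _).
  rewrite -lee_fin; apply: le_trans (c_cov N N1).
  by apply: ereal_sup_ubound; exists (f j).
have V_ge j N : (1 <= N)%N -> \sum_(0 <= k < N) t j k ^+ 2 <= V j.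
  move=> N1; rewrite -subr_ge0; have [_ <-] := resE j N N1.
  by apply: Ex_ge0 => w; exact: sqr_ge0.
have tails j i N : (1 <= i)%N -> (i <= N)%N -> \sum_(i <= k < N.+1) t j k ^+ 2 <= c i.
  move=> i1 iN; have := V_ge j N.+1 isT; have := tail j i i1.
  rewrite (big_cat_nat (n := i) (p := N.+1))//=; last exact: ltnW.
  lra.
have sbp j N : (n <= N)%N ->
    \sum_(n <= k < N.+1) t j k ^+ 2 / sg k <= S + c N.+1 / sg N.
  move=> nN; apply: le_trans (summation_by_parts (m := n) (c := c) _ _ _ nN _) _.
  - by move=> k nk; apply: sg_gt0; exact: leq_trans hn nk.
  - by move=> k nk; apply: sg_decr; exact: leq_trans hn nk.
  - by move=> k nk; apply: c_sg; exact: leq_trans hn nk.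
  - by move=> i /andP[ni iN]; apply: tails => //; exact: leq_trans hn ni.
  - by rewrite lerD2r.
(* The mean squares are bounded by c_(N+1), and c is summable. *)
have lim_ae j : {ae P, forall w,
    ev (f j) (Xn N.+1 w) @[N --> \oo] --> ev (f j) (X w)}.
  have [C hC] := nneseries_bounded (fun j => normr_ge0 (c j)) c_l1.
  have := @ae_cvg0_summable _ _ _ P
    (fun N w => (ev (f j) (X w) - ev (f j) (Xn N.+1 w)) ^+ 2) C _ _ _.
  have h1 k : L1 P (fun w => (ev (f j) (X w) - ev (f j) (Xn k.+1 w)) ^+ 2).
    by have [] := resE j k.+1 isT.
  have h2 k w : 0 <= (ev (f j) (X w) - ev (f j) (Xn k.+1 w)) ^+ 2 by exact: sqr_ge0.
  have h3 N : \sum_(0 <= k < N)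
      Ex P (fun w => (ev (f j) (X w) - ev (f j) (Xn k.+1 w)) ^+ 2) <= C.
    apply: le_trans (hC N.+1); rewrite big_add1 /=; apply: ler_sum => k _.
    have [_ ->] := resE j k.+1 isT.
    by apply: le_trans (ler_norm _); exact: tail.
  move=> /(_ h1 h2 h3); apply: filterS => w /cvgrPdist_lt h.
  apply/cvgrPdist_lt => eps eps0.
  have /h : 0 < eps ^+ 2 by exact: exprn_gt0.
  apply: filterS => N; rewrite sub0r normrN normrX => hN.
  by rewrite -(ltr_pXn2r (n := 2)) ?nnegrE// ltW.
pose Q N w := \sum_(n <= k < N) sg k * xi k w ^+ 2.
have [EA mA] := chi_all xiP sg_ge0 S0 K sS.
set A := (fun w => `[< forall N, _ >]%:R) in EA mA.
have bound : {ae P, forall w, (forall N, Q N w <= K * S) -> `|X w - Xn n w| <= L * S}.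
  (* Countably many functionals and indices share a single null set. *)
  have proj_ae := ae_foralln (fun j => ae_foralln (fun N => projE j N.+1 isT)).
  have lims := ae_foralln lim_ae.
  apply: filterS2 proj_ae lims => w pw lw Qw.
  apply: (norming_leP _ _ nf).2 => j; rewrite evB.
  have dl : c N.+1 / sg N @[N --> \oo] --> (0 : R).
    by rewrite (cvg_shiftS (fun j => c j / Num.sqrt (c j.-1 - c j))).
  (* The boundary term of the summation by parts is subtracted before the limit, which leaves the
     bound L S valid for every large N. *)
  have vl : ev (f j) (Xn N.+1 w) - ev (f j) (Xn n w) - L / 2 * (c N.+1 / sg N)
      @[N --> \oo] --> ev (f j) (X w) - ev (f j) (Xn n w) - L / 2 * 0.
    apply: cvgB; first by apply: cvgB; [exact: lw|exact: cvg_cst].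
    by apply: cvgM; [exact: cvg_cst|exact: dl].
  rewrite mulr0 subr0 in vl; apply: (cvgr_to_le vl).
  near=> N; have nN : (n <= N)%N by near: N; exact: nbhs_infty_ge.
  have -> : ev (f j) (Xn N.+1 w) - ev (f j) (Xn n w) =
      \sum_(n <= k < N.+1) t j k * xi k w.
    have pn := pw j n.-1; rewrite (prednK hn) in pn.
    rewrite (pw j N) pn (big_cat_nat (n := n) (p := N.+1))//=; last exact: ltnW.
    by rewrite opprD addrACA subrr add0r addrC addrA addNr add0r.
  (* Cauchy-Schwarz in its additive form with parameter L: as L^2 = K, the two sums contribute L S /
     2 each when Q <= K S. *)
  have amgm k : (n <= k)%N -> t j k * xi k w <=
      L / 2 * (t j k ^+ 2 / sg k) + L^-1 / 2 * (sg k * xi k w ^+ 2).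
    move=> nk; have sk := sg_gt0 k (leq_trans hn nk).
    rewrite -subr_ge0.
    have -> : L / 2 * (t j k ^+ 2 / sg k) + L^-1 / 2 * (sg k * xi k w ^+ 2) -
        t j k * xi k w = (2 * L * sg k)^-1 * (L * t j k - sg k * xi k w) ^+ 2.
      by field; rewrite !gt_eqF.
    by rewrite mulr_ge0 ?sqr_ge0// invr_ge0 !mulr_ge0// ltW.
  have h1 : \sum_(n <= k < N.+1) t j k * xi k w <=
      L / 2 * (\sum_(n <= k < N.+1) t j k ^+ 2 / sg k) + L^-1 / 2 * Q N.+1 w.
    rewrite /Q !mulr_sumr -big_split/=; apply: ler_sum_nat => k /andP[nk _].
    exact: amgm.
  have h2 : L / 2 * (\sum_(n <= k < N.+1) t j k ^+ 2 / sg k) <=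
      L / 2 * (S + c N.+1 / sg N).
    by rewrite ler_wpM2l ?sbp// divr_ge0// ltW.
  have h3 : L^-1 / 2 * Q N.+1 w <= L / 2 * S.
    apply: (@le_trans _ _ (L^-1 / 2 * (K * S))).
      by rewrite ler_wpM2l ?Qw// divr_ge0// invr_ge0 ltW.
    rewrite -LL le_eqVlt; apply/orP; left; apply/eqP; field.
    by rewrite gt_eqF.
  lra.
pose B w : R := (`|X w - Xn n w| <= L * S)%R%:R.
have wX := gaussian_weakly_measurable hX.
have wXn := cond_exp_weakly_measurable hX (hXn n hn).
have mN : measurable_fun [set: T] (fun w => `|X w - Xn n w|).
  by apply: (weakly_measurable_norm nf); exact: weakly_measurableB.
have mB : measurable_fun [set: T] B by exact: measurable_cut.
have iB : L1 P B by apply: (@L1_bounded _ _ _ _ _ 1) => // w; exact: cut_norm_le1.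
have A1 w : `|A w| <= 1.
  by rewrite /A ger0_norm// lern1; case: `[< _ >].
have iA : L1 P A by exact: (@L1_bounded _ _ _ _ _ 1).
have AB : Ex P A <= Ex P B.
  (* The inclusion of the events holds up to a null set only, hence the detour through the product A
     B. *)
  have [|iAB ->] := @ae_eq_Ex _ _ _ P A (fun w => A w * B w) iA (measurable_funM mA mB).
    apply: filterS bound => w hw; rewrite /A /B.
    have [h|h] := pselect (forall N, Q N w <= K * S).
      by rewrite hw// mulr1n mulr1.
    by rewrite asboolF// mul0r.
  apply: Ex_le => // w; rewrite ler_piMl//.
  exact: le_trans (ler_norm _) (A1 w).
have -> : P [set w | `|X w - Xn n w| <= L * S] = (Ex P B)%:E.
  rewrite -Ex_indic; last first.
    rewrite -[X in measurable X]setTI; exact: measurable_fun_le.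
  congr (Ex P _)%:E; apply/funext => w; rewrite indicE /B; congr (_%:R).
  congr nat_of_bool; apply/idP/idP => h; first exact: set_mem h.
  exact: mem_set.
rewrite lte_fin; apply: lt_le_trans (le_trans EA AB).
rewrite ltrD2l ltrN2.
(* One factor exp (- M) beats 13/5 since 13/5 < e <= exp M, which is the source of the strict
   inequality; the other is at most exp (- tau). *)
have -> : - (2 / 5 * K) = - M + - M by rewrite /K; field.
rewrite expRD mulrA.
apply: (@lt_le_trans _ _ (expR (- M))); last by rewrite ler_expR lerN2.
rewrite -[ltRHS]mul1r ltr_pM2r ?expR_gt0// expRN ltr_pdivrMr ?expR_gt0// mul1r.
by apply: lt_le_trans (expR1_gt R) _; rewrite ler_expR.
Unshelve. all: by end_near. Qed.
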